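(* Let $\mu$ be the probability measure on $\Theta=[0,\infty)^d$ with density $\mu(\theta)=\dfrac{\pi(\theta)\exp\{n\ell(\theta)\}}{\int_{[0,\infty)^d}\pi(\theta)\exp\{n\ell(\theta)\}\,d\theta}$, where $\ell$ has a unique maximizer $\hat\theta$ over $\Theta$ and $\pi=\bigotimes_{j\in[d]}\pi_j$ with each $\pi_j$ log-concave. Let $S_0,S_1,d_0,d_1$ and the good set $\hat\Theta_\delta$ (with radii parameters $\delta_0,\delta_1$) be as defined in the context. Assume that: (1) for some $C_0>0$, $\inf_{i\in S_0}|\hat\theta_i|\ge C_0$; (2) there is $C_{S_0}>0$ with $-\nabla^2_{S_0}\ell(\theta)\succeq C_{S_0}I$ for all $\theta\in\hat\Theta_\delta$; (3) there is $C_{S_1}>0$ with $\partial_j\ell(\hat\theta)\le -C_{S_1}$ for all $j\in S_1$; (4) $\ell$ is $C^2$ on $\hat\Theta_\delta$ and $\sup_{\theta\in\hat\Theta_\delta}\|\nabla^2\ell(\theta)\|_{\rm op}\le s_2<\infty$; (5) $n\ge\delta_0^2d_0/C_0^2$. Then the measure $\mu|_{\hat\Theta_\delta}=\mu\mathbf 1_{\hat\Theta_\delta}/\mu(\hat\Theta_\delta)$ satisfies a Poincaré inequality with $$C_{\mathsf{PI}}(\mu|_{\hat\Theta_\delta})\le\Bigl(\frac{1}{nC_{S_0}}\vee\frac{4\max_{j\in S_1}\exp(\operatorname{osc}_{[0,\delta_1/n]}\log\pi_j)}{n^2C_{S_1}^2}\Bigr)\exp\Bigl(2s_2\Bigl(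\frac{\delta_0\delta_1(d_0d_1)^{1/2}}{n^{1/2}}+\frac{\delta_1^2d_1}{n}\Bigr)\Bigr).$$
   Context: Notation: $[d]=\{1,\dots,d\}$; $a\vee b=\max(a,b)$; $\operatorname{osc}_I f=\sup_I f-\inf_I f$. For $S\subseteq[d]$, $\theta_S$ is the subvector of $\theta$ indexed by $S$, and $\nabla^2_S\ell$ is the $S\times S$ block of the Hessian. Derivatives at boundary points of $[0,\infty)^d$ are one-sided. $\ell$ is $C^2$ in the interior of $[0,\infty)^d$. Poincaré constant: for a probability measure $\nu$ on $\mathbb{R}^d$, $C_{\mathsf{PI}}(\nu)$ is the least $C$ such that $\int f^2\,d\nu-(\int f\,d\nu)^2\le C\int\|\nabla f\|_2^2\,d\nu$ for all smooth compactly supported $f:\mathbb{R}^d\to\mathbb{R}$. Index sets: $S_0=\{j\in[d]:\hat\theta_j>0\}$, $S_1=\{j\in[d]:\hat\theta_j=0\}$, $d_0=|S_0|$, $d_1=|S_1|$; it is assumed that $d_1\ge1$. Good set: for $\delta_0,\delta_1>0$ with $\delta_0\sqrt{d_0/n}<C_0$, $$\hat\Theta_\delta=\Bigl\{\theta\in\Theta:\ \|\theta_{S_0}-\hat\theta_{S_0}\|_2\le\delta_0\sqrt{d_0/n},\ \|\theta_{S_1}-\hat\theta_{S_1}\|_\infty\le\delta_1/n\Bigr\}.$$ *)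

(* Defs.v *)
From HB Require Import structures.
From mathcomp Require Import all_boot all_order all_algebra.
From mathcomp Require Import all_classical all_reals all_analysis.
From mathcomp Require Import measurable_realfun.

Set Implicit Arguments.
Unset Strict Implicit.
Unset Printing Implicit Defensive.

Import Order.TTheory GRing.Theory Num.Theory.
Import numFieldNormedType.Exports.

Local Open Scope classical_set_scope.
Local Open Scope ring_scope.

(* The product sigma-algebra, generated by the entries; on 'rV[R]_d it is the
   Borel sigma-algebra of R^d. *)
Definition measure_matrix_display : measure_display -> measure_display.
Proof. exact. Qed.

Section measurable_matrix.
Context {d} {T : measurableType d}.
Variables m n : nat.

Definition entry_cylinders : set (set 'M[T]_(m, n)) :=
  [set A | exists i j, exists2 B : set T, measurable B &
    A = (fun M : 'M[T]_(m, n) => M i j) @^-1` B].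

HB.instance Definition _ := @isMeasurable.Build (measure_matrix_display d)
  'M[T]_(m, n) <<s entry_cylinders >>
  (@sigma_algebra0 _ setT entry_cylinders)
  (fun A => @sigma_algebraC _ entry_cylinders A)
  (@sigma_algebra_bigcup _ setT entry_cylinders).

End measurable_matrix.

Lemma measurable_entry d (T : measurableType d) m n (i : 'I_m) (j : 'I_n) :
  measurable_fun [set: 'M[T]_(m, n)] (fun M : 'M[T]_(m, n) => M i j).
Proof.
move=> _ B mB; rewrite setTI; apply: sub_sigma_algebra.
by exists i, j, B.
Qed.

Lemma measurable_fun_entryP d d' (S : measurableType d) (T : measurableType d')
    m n (f : S -> 'M[T]_(m, n)) :
  (forall i j, measurable_fun [set: S] (fun x => f x i j)) ->
  measurable_fun [set: S] f.
Proof.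
move=> mf; apply: (measurability (@entry_cylinders _ T m n)) => //.
move=> _ [A [i [j [B mB ->]]] <-]; rewrite setTI.
by have := mf i j measurableT B mB; rewrite setTI.
Qed.

Section lebesgue_rV.
Context {R : realType}.

Definition consrV n (p : R * 'rV[R]_n) : 'rV[R]_(1 + n) := row_mx p.1%:M p.2.

Lemma measurable_consrV n : measurable_fun [set: R * 'rV[R]_n] (@consrV n).
Proof.
apply: measurable_fun_entryP => i j; rewrite ord1 /consrV.
case: (split_ordP j) => k ->.
  have -> : (fun p : R * 'rV[R]_n => row_mx p.1%:M p.2 0 (lshift n k)) = fst.
    by apply/funext => p; rewrite row_mxEl ord1 mxE eqxx.
  exact: measurable_fst.
have -> : (fun p : R * 'rV[R]_n => row_mx p.1%:M p.2 0 (rshift 1 k)) =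
          (fun M : 'rV[R]_n => M 0 k) \o snd.
  by apply/funext => p; rewrite row_mxEr.
by apply: measurableT_comp => //; exact: measurable_entry.
Qed.

Definition lebesgue_cons n (m : {sigma_finite_measure set 'rV[R]_n -> \bar R}) :
    set 'rV[R]_n.+1 -> \bar R :=
  pushforward (@lebesgue_measure R \x m)%E (@consrV n).

Section instances.
Variables (n : nat) (m : {sigma_finite_measure set 'rV[R]_n -> \bar R}).

Let lebesgue_cons0 : lebesgue_cons m set0 = 0%E.
Proof. by rewrite /lebesgue_cons /pushforward preimage_set0 measure0. Qed.

Let lebesgue_cons_ge0 A : (0 <= lebesgue_cons m A)%E.
Proof. by rewrite /lebesgue_cons /pushforward measure_ge0. Qed.

Let lebesgue_cons_sigma_additive : semi_sigma_additive (lebesgue_cons m).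
Proof.
move=> F mF tF mUF; rewrite /lebesgue_cons /pushforward preimage_bigcup.
have mpre A : measurable A -> measurable (@consrV n @^-1` A).
  by move=> mA; rewrite -[X in measurable X]setTI; exact: measurable_consrV.
apply: measure_semi_sigma_additive.
- by move=> k; exact: mpre.
- apply/trivIsetP => /= i j _ _ ij; rewrite -preimage_setI.
  by move/trivIsetP : tF => /(_ _ _ _ _ ij) ->//; rewrite preimage_set0.
- by rewrite -preimage_bigcup; exact: mpre.
Qed.

HB.instance Definition _ := isMeasure.Build _ _ _ (lebesgue_cons m)
  lebesgue_cons0 lebesgue_cons_ge0 lebesgue_cons_sigma_additive.

Let lebesgue_cons_sigma_finite : sigma_finite setT (lebesgue_cons m).
Proof.
have [F TF Foo] : sigma_finite setT (@lebesgue_measure R \x m)%E.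
  have /sigma_finiteP[F [TF ndF Foo]] := sigma_finiteT (@lebesgue_measure R).
  have /sigma_finiteP[G [TG ndG Goo]] := sigma_finiteT m.
  exists (fun k => F k `*` G k).
    rewrite -setXTT TF TG predeqE => -[x y]; split.
      move=> [/= [k _ Fx] [l _ Gy]]; exists (maxn k l) => //; split.
      - by move: x Fx; exact/subsetPset/ndF/leq_maxl.
      - by move: y Gy; exact/subsetPset/ndG/leq_maxr.
    by move=> [k _ []/= ? ?]; split; exists k.
  move=> k; have [? ?] := Foo k; have [? ?] := Goo k.
  split; first exact: measurableX.
  by rewrite product_measure1E// lte_mul_pinfty// ge0_fin_numE.
pose u (v : 'rV[R]_n.+1) : R * 'rV[R]_n := (v 0 0, rsubmx (v : 'rV[R]_(1 + n))).
have uK p : u (consrV p) = p.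
  case: p => x v; rewrite /u /consrV /=; congr pair; last by rewrite row_mxKr.
  transitivity ((x%:M : 'M[R]_1) 0 0); last by rewrite mxE eqxx.
  by rewrite -(row_mxEl x%:M v 0 0); congr (row_mx _ _ _ _); exact/val_inj.
have mu : measurable_fun [set: 'rV[R]_n.+1] u.
  apply/measurable_fun_pair; first exact: measurable_entry.
  apply: measurable_fun_entryP => i j.
  rewrite [X in measurable_fun _ X](_ : _ =
    (fun M : 'rV[R]_n.+1 => M i (rshift 1 j))); last first.
    by apply/funext => M; rewrite mxE.
  exact: measurable_entry.
exists (fun k => u @^-1` F k).
  by rewrite -preimage_bigcup -TF preimage_setT.
move=> k; have [mF oF] := Foo k; split.
  by rewrite -[X in measurable X]setTI; exact: mu.
rewrite /lebesgue_cons /pushforward -comp_preimage.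
by rewrite (_ : u \o _ = id) //; apply/funext => p /=; rewrite uK.
Qed.

HB.instance Definition _ := Measure_isSigmaFinite.Build _ _ _ (lebesgue_cons m)
  lebesgue_cons_sigma_finite.

End instances.

(* Lebesgue measure on R^n: R^0 is a single point of mass 1, and R^(n+1) is the
   product of R and R^n. *)
Fixpoint lebesgue_rV (n : nat) : {sigma_finite_measure set 'rV[R]_n -> \bar R} :=
  match n with
  | 0 => \d_(0 : 'rV[R]_0)
  | n'.+1 => lebesgue_cons (lebesgue_rV n')
  end.

End lebesgue_rV.

Section euclidean.
Context {R : realType}.

(* The norm `|x| of the library on 'rV[R]_n is the sup norm. *)
Definition norm2 n (x : 'rV[R]_n) : R := Num.sqrt (\sum_i x 0 i ^+ 2).

Definition opnorm n (A : 'M[R]_n) : R :=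
  sup [set norm2 (x *m A^T) | x in [set x : 'rV[R]_n | norm2 x <= 1]].

Definition loewner_ge n (A B : 'M[R]_n) : Prop :=
  forall x : 'rV[R]_n, 0 <= (x *m (A - B) *m x^T) 0 0.

Definition subvec n (S : {set 'I_n}) (x : 'rV[R]_n) : 'rV[R]_#|S| :=
  \row_k x 0 (enum_val k).

Definition submx_block n (S : {set 'I_n}) (A : 'M[R]_n) : 'M[R]_#|S| :=
  \matrix_(k, l) A (enum_val k) (enum_val l).

Definition unit_vec n (i : 'I_n) : 'rV[R]_n := delta_mx 0 i.

End euclidean.

Section relative_derivatives.
Context {R : realType} {n : nat}.
Variable D : set 'rV[R]_n.
Implicit Types (f : 'rV[R]_n -> R) (x : 'rV[R]_n) (A : set 'rV[R]_n).

(* Partial derivatives of a function on D: the increments are those that stay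
   in D, so the derivative is one-sided at a boundary point where only one
   direction is available and the usual one in the interior of D. *)
Definition rel_steps (i : 'I_n) x : set_system R :=
  within [set h | D (x + h *: unit_vec i)] (0 : R)^'.

Definition rel_quotient (i : 'I_n) f x (h : R) : R :=
  h^-1 * (f (x + h *: unit_vec i) - f x).

Definition rel_derivable (i : 'I_n) f x : Prop :=
  cvg (rel_quotient i f x @ rel_steps i x).

Definition rel_partial (i : 'I_n) f x : R :=
  lim (rel_quotient i f x @ rel_steps i x).

Definition rel_hessian f x : 'M[R]_n :=
  \matrix_(i, j) rel_partial i (rel_partial j f) x.

(* For the derivative of rel_partial j f in direction i to make sense at x,
   rel_partial j f has to exist at all nearby points x + h e_i of D. *)
Definition rel_derivable2 (i j : 'I_n) f x : Prop :=
  (\forall h \near rel_steps i x, rel_derivable j f (x + h *: unit_vec i)) /\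
  rel_derivable i (rel_partial j f) x.

Definition C2_on A f : Prop :=
  [/\ {within A, continuous f},
      forall i, (forall x, A x -> rel_derivable i f x) /\
                {within A, continuous (rel_partial i f)} &
      forall i j, (forall x, A x -> rel_derivable2 i j f x) /\
                  {within A, continuous (rel_partial i (rel_partial j f))}].

End relative_derivatives.

Section poincare.
Context {R : realType} {n : nat}.

Definition iter_partial (s : seq 'I_n) (f : 'rV[R]_n -> R) : 'rV[R]_n -> R :=
  foldr (fun i g x => 'D_(unit_vec i) g x) f s.

Definition smooth (f : 'rV[R]_n -> R) : Prop :=
  forall s : seq 'I_n, continuous (iter_partial s f) /\
    forall x i, derivable (iter_partial s f) x (unit_vec i).

Definition compactly_supported (f : 'rV[R]_n -> R) : Prop :=
  compact (closure [set x | f x != 0]).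

Definition gradient (f : 'rV[R]_n -> R) (x : 'rV[R]_n) : 'rV[R]_n :=
  \row_i 'D_(unit_vec i) f x.

Definition poincare_ineq (nu : probability 'rV[R]_n R) (C : R) : Prop :=
  forall f : 'rV[R]_n -> R, smooth f -> compactly_supported f ->
    (\int[nu]_x (f x ^+ 2)%:E - (\int[nu]_x (f x)%:E) ^+ 2 <=
     C%:E * \int[nu]_x (norm2 (gradient f x) ^+ 2)%:E)%E.

(* +oo when no constant is admissible *)
Definition poincare_const (nu : probability 'rV[R]_n R) : \bar R :=
  ereal_inf [set C%:E | C in [set C : R | 0 <= C /\ poincare_ineq nu C]].

End poincare.

Section posterior.
Context {R : realType}.

Definition osc (T : Type) (A : set T) (f : T -> \bar R) : \bar R :=
  (ereal_sup (f @` A) - ereal_inf (f @` A))%E.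

Definition log_concave_on (A : set R) (f : R -> R) : Prop :=
  (forall x, A x -> 0 <= f x) /\
  forall x y t, A x -> A y -> 0 <= t <= 1 ->
    f x `^ t * f y `^ (1 - t) <= f (t * x + (1 - t) * y).

Variable d : nat.
Implicit Types (t th : 'rV[R]_d) (l : 'rV[R]_d -> R) (prior : 'I_d -> R -> R).

Definition orthant : set 'rV[R]_d := [set t | forall j, 0 <= t 0 j].

Definition posterior_weight n l prior t : R :=
  (\prod_j prior j (t 0 j)) * expR (n%:R * l t).

Definition posterior_density n l prior t : R :=
  posterior_weight n l prior t /
  (\int[lebesgue_rV d]_(u in orthant) posterior_weight n l prior u)%R.

Definition is_posterior n l prior (mu : probability 'rV[R]_d R) : Prop :=
  forall A : set 'rV[R]_d, measurable A ->
    mu A = (\int[lebesgue_rV d]_(t in A `&` orthant)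
              (posterior_density n l prior t)%:E)%E.

Definition unique_maximizer (A : set 'rV[R]_d) l th : Prop :=
  A th /\ forall t, A t -> t != th -> l t < l th.

Definition S0 th : {set 'I_d} := [set j | 0 < th 0 j]%SET.
Definition S1 th : {set 'I_d} := [set j | th 0 j == 0]%SET.

Definition good_set n (delta0 delta1 : R) th : set 'rV[R]_d :=
  [set t | [/\ orthant t,
    norm2 (subvec (S0 th) t - subvec (S0 th) th) <=
      delta0 * Num.sqrt (#|S0 th|%:R / n%:R) &
    `|subvec (S1 th) t - subvec (S1 th) th| <= delta1 / n%:R]].

Lemma measurable_good_set n (delta0 delta1 : R) th :
  measurable (good_set n delta0 delta1 th).
Proof.
have mle (f : 'rV[R]_d -> R) c : measurable_fun setT f ->
    measurable [set t | f t <= c].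
  move=> mf; rewrite -[X in measurable X]setTI.
  have -> : [set t | f t <= c] = f @^-1` `]-oo, c].
    by apply/seteqP; split => t /=; rewrite in_itv.
  exact: mf.
have mcoord j c : measurable_fun setT (fun t : 'rV[R]_d => t 0 j - c).
  by apply: measurable_funB => //; exact: measurable_entry.
have -> : good_set n delta0 delta1 th =
    [set t | orthant t] `&`
    ([set t | norm2 (subvec (S0 th) t - subvec (S0 th) th) <=
      delta0 * Num.sqrt (#|S0 th|%:R / n%:R)] `&`
    [set t | `|subvec (S1 th) t - subvec (S1 th) th| <= delta1 / n%:R]).
  by apply/seteqP; split => t /=; [case|case=> ? []].
apply: measurableI; last apply: measurableI.
- have -> : [set t | orthant t] = \bigcap_(j in [set: 'I_d]) [set t | - t 0 j <= 0].
    by apply/seteqP; split => t /= h j; [by move=> _ /=; rewrite oppr_le0|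
      have := h j I; rewrite /= oppr_le0].
  apply: fin_bigcap_measurable; first exact: finite_finset.
  by move=> j _; apply: mle; apply: measurableT_comp => //; exact: measurable_entry.
- apply: mle.
  apply: (measurableT_comp (continuous_measurable_fun (@sqrt_continuous R))).
  apply: measurable_sum => i; apply: measurable_funX.
  rewrite [X in measurable_fun _ X](_ : _ =
    (fun t => t 0 (enum_val i) - th 0 (enum_val i))) //.
  by apply/funext => t; rewrite !mxE.
- apply: mle.
  rewrite [X in measurable_fun _ X](_ : _ = (fun t : 'rV[R]_d =>
      \big[Num.max/0]_(ij : 'I_1 * 'I_#|S1 th|)
         `|t 0 (enum_val ij.2) - th 0 (enum_val ij.2)|)); last first.
    apply/funext => t; rewrite [LHS]mx_normrE; apply: eq_bigr => ij _.
    by rewrite !mxE.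
  elim: (index_enum _) => [|ij r IH].
    by under eq_fun do rewrite big_nil; exact: measurable_cst.
  under eq_fun do rewrite big_cons.
  by apply: measurable_maxr => //; apply: measurableT_comp => //; exact: mcoord.
Qed.

(* The normalised restriction of mu to the good set. The last argument of
   mnormalize is only a default value, used when the good set has mass 0. *)
Definition good_posterior n (delta0 delta1 : R) th
    (mu : probability 'rV[R]_d R) : probability 'rV[R]_d R :=
  mnormalize (mrestr mu (measurable_good_set n delta0 delta1 th)) \d_th.

End posterior.

Arguments orthant {R d}.

(* Main.v *)
(* With [x = theta_{S0}] and [y = theta_{S1}], concavity of [ell] in [x], the
   negative slopes [b_j] of [ell] in the directions of [S1] and the bound on the
   Hessian show that, on the good set and up to a factor [exp (+- D)], the
   unnormalised posterior is the product of
     [rho x = pi_{S0} x exp (n ell (x, 0))] on a ball and of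
     [pi_j y_j exp (n b_j y_j)] on [0, L], [L = delta1 / n], for [j] in [S1].
   The weight [rho] satisfies
     [rho x rho x' exp (kappa |x - x'|^2 / 4) <= rho ((x + x') / 2)^2],
   [kappa = n C_{S0}]. Prekopa-Leindler applied to [rho] times
   [exp (e f - c e^2 |grad f|^2)] and to [rho exp (- e f)] bounds the product of
   their integrals by [(int rho)^2]; expanding to order [e^2] gives the Poincare
   inequality for [rho] with constant [1 / kappa]. The one-dimensional factors
   satisfy one by the Hardy inequality for the exponential weight, at the price
   of the oscillation of [log pi_j]. Tensorization and the Holley-Stroock
   comparison with the product weight conclude. *)
Require Import Defs.
From mathcomp Require Import all_boot all_order all_algebra.
From mathcomp Require Import all_classical all_reals all_analysis.
From mathcomp Require Import measurable_realfun ring lra.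
Set Implicit Arguments.
Unset Strict Implicit.
Unset Printing Implicit Defensive.
Import Order.TTheory GRing.Theory Num.Theory.
Import numFieldNormedType.Exports.
Local Open Scope classical_set_scope.
Local Open Scope ring_scope.

(** * Prekopa-Leindler at the midpoint *)

Section midpoint_measure.
Context {R : realType}.
Local Notation lam := (@lebesgue_measure R).

(** The midpoint form of Prekopa-Leindler needs no smoothness of the weight, only an inequality that
    survives extension by zero. So the sphere bounding the ball, the faces of the orthant and priors
    that are merely log-concave give no boundary terms, and [ell] is differentiated only at points
    of the good set, where its derivatives are controlled. The slopes [b_j] are frozen at
    [theta_hat]: slopes varying with [x] would destroy the product structure. Freezing them costs at
    most [s2] times the length of [y = theta_{S1}], at most [L sqrt d1], times a distance to
    [theta_hat], at most [r0 + L sqrt d1], where [r0] is the radius of the ball; multiplied by [n]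
    this is [D]. The comparison with the product weight is paid on both sides of the inequality,
    whence [exp (2 D)]. The factor 4 is produced by the AM-GM step of the Hardy inequality. The
    intermediate inequalities concern unnormalised weights, a free centre instead of the mean, and a
    class of functions closed under averaging out a coordinate. Smooth compactly supported functions
    return only at the end. *)

Lemma lebesgue_measure_preimage_double (a : R) (A : set R) : measurable A ->
  (lam A = 2%:E * lam [set z | A (z *+ 2 - a)%R])%E.
Proof.
move=> mA.
have mf : measurable_fun [set: measurableTypeR R]
    (fun z : measurableTypeR R => (z *+ 2 - a : measurableTypeR R)).
  apply: measurable_funB => //.
  by under eq_fun do rewrite mulr2n; apply: measurable_funD.
pose m1 : {measure set (measurableTypeR R) -> \bar R} :=
  measure_function_pushforward__canonical__measure_function_Measure lam mf.
pose m2 : {measure set (measurableTypeR R) -> \bar R} :=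
  mscale (NngNum (ler0n R 2)) m1.
rewrite (@lebesgue_measure_unique _ m2) //= => X [[x y] _ <-] /=.
rewrite /mscale /= /pushforward /=.
rewrite (_ : _ @^-1` _ = `](x + a) / 2, (y + a) / 2]%classic); last first.
  apply/seteqP; split => z /=; rewrite !in_itv /= => /andP[? ?]; apply/andP; split; lra.
rewrite !lebesgue_measure_itv /= !lte_fin.
have -> : ((x + a) / 2 < (y + a) / 2) = (x < y) by apply/idP/idP => ?; lra.
case: ifP => _; last by rewrite mule0.
by rewrite -!EFinB -EFinM; congr EFin; field.
Qed.

(* One-dimensional Brunn-Minkowski: near-extreme points [a] of [A] and [b] of
   [B] give the essentially disjoint pieces [(a + B) / 2] and [(A + b) / 2]. *)
Lemma lebesgue_measure_midpoint (A B C : set R) :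
  measurable A -> measurable B -> measurable C ->
  A !=set0 -> B !=set0 -> has_ubound A -> has_lbound B ->
  (forall x y, A x -> B y -> C ((x + y) / 2)) ->
  (lam A + lam B <= 2%:E * lam C)%E.
Proof.
move=> mA mB mC A0 B0 ubA lbB ABC.
apply/lee_addgt0Pr => e e0.
have e20 : 0 < e / 2 by lra.
have [a Aa aA] := sup_adherent e20 (conj A0 ubA).
have [b Bb bB] := inf_adherent e20 (conj B0 lbB).
have Ale x : A x -> x <= a + e / 2.
  by move=> Ax; have := ub_le_sup ubA Ax; lra.
have Bge y : B y -> b - e / 2 <= y.
  by move=> By; have := ge_inf lbB By; lra.
(* Each truncation loses measure at most [e / 2]. After it, the points [(x + b) / 2] with [x] in
   [A'] lie at or left of [(a + b) / 2], and the points [(a + y) / 2] with [y] in [B'] strictly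
   right of it; leaving [b] out of [B'] makes the two pieces disjoint. *)
pose A' := A `&` `]-oo, a]; pose B' := B `&` `]b, +oo[.
have mA' : measurable A' by apply: measurableI.
have mB' : measurable B' by apply: measurableI.
have hA : (lam `]a, (a + e / 2)%R] <= (e / 2)%:E)%E.
  rewrite lebesgue_measure_itv/= lte_fin; case: ifP => _; last by rewrite lee_fin; lra.
  by rewrite -EFinD lee_fin; lra.
have hB : (lam `[(b - e / 2)%R, b] <= (e / 2)%:E)%E.
  rewrite lebesgue_measure_itv/= lte_fin; case: ifP => _; last by rewrite lee_fin; lra.
  by rewrite -EFinD lee_fin; lra.
have lA : (lam A <= lam A' + (e / 2)%:E)%E.
  apply: (@le_trans _ _ (lam (A' `|` `]a, (a + e / 2)%R]))).
    apply: le_measure; rewrite ?inE//; first by apply: measurableU.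
    move=> x Ax; have [xa|ax] := leP x a; [left|right]; rewrite /= ?in_itv/=.
      by split; rewrite ?in_itv.
    by rewrite ax Ale.
  apply: (@le_trans _ _ (_ + _)%E); first exact: measureU2.
  by apply: leeD2l; exact: hA.
have lB : (lam B <= lam B' + (e / 2)%:E)%E.
  apply: (@le_trans _ _ (lam (B' `|` `[(b - e / 2)%R, b]))).
    apply: le_measure; rewrite ?inE//; first by apply: measurableU.
    move=> x Bx; have [xb|bx] := leP x b; [right|left]; rewrite /= ?in_itv/=.
      by rewrite xb Bge.
    by split; rewrite //= in_itv/= bx.
  apply: (@le_trans _ _ (_ + _)%E); first exact: measureU2.
  by apply: leeD2l; exact: hB.
have mdbl (c : R) D : measurable D -> measurable [set z : R | D (z *+ 2 - c)%R].
  move=> mD; rewrite -[X in measurable X]setTI.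
  have mf : measurable_fun [set: R] (fun z : R => z *+ 2 - c).
    apply: measurable_funB => //.
    by under eq_fun do rewrite mulr2n; apply: measurable_funD.
  exact: mf.
apply: (@le_trans _ _ (lam A' + lam B' + e%:E)%E).
  rewrite (_ : e%:E = (e / 2)%:E + (e / 2)%:E)%E; last by rewrite -EFinD; congr EFin; lra.
  by rewrite addeACA; apply: leeD.
rewrite leeD2r//.
rewrite (lebesgue_measure_preimage_double b mA').
rewrite (lebesgue_measure_preimage_double a mB').
rewrite -ge0_muleDr ?measure_ge0// lee_pmul2l//.
rewrite -measureU//; last 3 first.
- exact: mdbl.
- exact: mdbl.
- apply/seteqP; split => z //= -[[_ /=]]; rewrite in_itv/= => h1 [_ /=]; rewrite in_itv/= andbT => h2.
  by exfalso; lra.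
apply: le_measure; rewrite ?inE//.
  by apply: measurableU; exact: mdbl.
move=> z [[Az _]|[Bz _]].
  by have := ABC _ _ Az Bb; congr C; rewrite mulr2n; field.
by have := ABC _ _ Aa Bz; congr C; rewrite mulr2n; field.
Qed.

(** Layer-cake formula, by Tonelli for the region under the graph of [w]. Cutting at height 1 keeps
    only the levels at which both functions of the next inequality, normalised to supremum 1, have
    nonempty superlevel sets. *)
Lemma integral_mine1 (w : R -> \bar R) :
  measurable_fun setT w -> (forall x, 0 <= w x)%E ->
  (\int[lam]_x mine (w x) 1 =
   \int[lam]_(t in `[0%R, 1%R[) lam [set x | t%:E < w x])%E.
Proof.
move=> mw w0.
pose F (p : R * R) : \bar R := (\1_[set p : R * R | 0 <= p.2 < 1 /\ (p.2%:E < w p.1)%E] p)%:E.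
have mF : measurable_fun setT F.
  apply/measurable_EFinP; apply: measurable_indic.
  have -> : [set p : R * R | 0 <= p.2 < 1 /\ (p.2%:E < w p.1)%E] =
      (setT `*` `[0%R, 1%R[%classic) `&`
      (fun p : R * R => (p.2%:E < w p.1)%E) @^-1` [set true].
    apply/seteqP; split => -[x y] /=; rewrite in_itv/=; first by case.
    by case=> -[_ ->].
  apply: measurableI; first exact: measurableX.
  rewrite -[X in measurable X]setTI.
  apply: measurable_fun_lte => //.
    by apply/measurable_EFinP; exact: measurable_snd.
  exact: measurableT_comp.
have F0 p : (0 <= F p)%E by rewrite lee_fin.
transitivity (\int[lam]_x \int[lam]_t F (x, t))%E.
  apply: eq_integral => x _.
  rewrite /F (_ : (fun t => _) = (fun t => (\1_[set t : R | 0 <= t < 1 /\ (t%:E < w x)%E] t)%:E)); last first.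
    by apply/funext => t; rewrite !indicE; congr ((_ : bool)%:R%:E); apply/idP/idP; rewrite !inE.
  rewrite integral_indic ?setIT//; last first.
    have -> : [set t : R | 0 <= t < 1 /\ (t%:E < w x)%E] =
        `[0%R, 1%R[%classic `&` (fun t : R => (t%:E < w x)%E) @^-1` [set true].
      by apply/seteqP; split => t /=; rewrite in_itv.
    apply: measurableI => //.
    by rewrite -[X in measurable X]setTI; apply: measurable_fun_lte.
  have [w1|w1] := leP 1%E (w x).
    rewrite (_ : [set t | _] = `[0%R, 1%R[%classic); last first.
      apply/seteqP; split => t /=; rewrite in_itv/=; first by case.
      by move=> /andP[t0 t1]; rewrite t0 t1; split => //; apply: lt_le_trans w1; rewrite lte_fin.
    rewrite [RHS](lebesgue_measure_itv `[0%R, 1%R[)/= lte_fin ltr01 oppr0 adde0.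
    by [].
  case: (w x) (w0 x) w1 => [r| |] //; rewrite lee_fin lte_fin => r0 r1.
  rewrite (_ : [set t | _] = `[0%R, r[%classic); last first.
    apply/seteqP; split => t /=; rewrite in_itv/= lte_fin; first by case=> /andP[-> _] ->.
    by move=> /andP[t0 t1]; split => //; rewrite t0 (lt_trans t1).
  rewrite [RHS](lebesgue_measure_itv `[0%R, r[)/= lte_fin sube0.
  by case: ltP => // r0'; congr EFin; apply/eqP; rewrite eq_le r0 r0'.
rewrite (@fubini_tonelli _ _ _ _ R lam lam F mF F0).
rewrite [RHS]integral_mkcond; apply: eq_integral => t _.
rewrite /F patchE; have [t01|t01] := boolP (0 <= t < 1).
  rewrite mem_set /= ?in_itv//=.
  rewrite (_ : (fun x => _) = (fun x => (\1_[set x : R | (t%:E < w x)%E] x)%:E)); last first.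
    by apply/funext => x; rewrite !indicE; congr ((_ : bool)%:R%:E); apply/idP/idP; rewrite !inE//=; case.
  rewrite integral_indic ?setIT//.
  have -> : [set x | (t%:E < w x)%E] = (fun x : R => (t%:E < w x)%E) @^-1` [set true].
    by apply/seteqP; split.
  by rewrite -[X in measurable X]setTI; apply: measurable_fun_lte.
rewrite memNset /= ?in_itv//=; last exact/negP.
by rewrite integral0_eq// => x _; rewrite indicE memNset//= => -[h _]; move: t01; rewrite h.
Qed.

End midpoint_measure.

Section prekopa_leindler.
Context {R : realType}.
Local Notation lam := (@lebesgue_measure R).

(** One-dimensional Brunn-Minkowski is applied to the superlevel sets at each height [t < 1] and
    integrated in [t]. It requires both sets to be nonempty, which is why the two suprema must
    agree. *)
Lemma prekopa_leindler_sup1 (u v : R -> R) (w : R -> \bar R) (k : R) :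
  measurable_fun setT u -> measurable_fun setT v -> measurable_fun setT w ->
  (forall x, 0 <= u x <= 1) -> (forall x, 0 <= v x <= 1) ->
  (forall x, 0 <= w x)%E ->
  (forall x, u x != 0 -> `|x| <= k) -> (forall x, v x != 0 -> `|x| <= k) ->
  (forall t, t < 1 -> exists x, t < u x) ->
  (forall t, t < 1 -> exists x, t < v x) ->
  (forall x y, (u x * v y)%:E <= w ((x + y) / 2)%R * w ((x + y) / 2)%R)%E ->
  (\int[lam]_x (u x)%:E + \int[lam]_x (v x)%:E <= 2%:E * \int[lam]_x w x)%E.
Proof.
move=> mu mv mw u01 v01 w0 uk vk usup vsup uvw.
have trunc (f : R -> R) : measurable_fun setT f -> (forall x, 0 <= f x <= 1) ->
    (\int[lam]_x (f x)%:E = \int[lam]_(t in `[0%R, 1%R[) lam [set x | t%:E < (f x)%:E])%E.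
  move=> mf f01; transitivity (\int[lam]_x mine (f x)%:E 1)%E.
    apply: eq_integral => x _; rewrite min_l// lee_fin.
    by case/andP: (f01 x).
  rewrite integral_mine1//; last 2 first.
  - exact/measurable_EFinP.
  - by move=> x; rewrite lee_fin; case/andP: (f01 x).
have mlev (f : R -> \bar R) t : measurable_fun setT f -> measurable [set x | (t%:E < f x)%E].
  move=> mf; have -> : [set x | (t%:E < f x)%E] = (fun x => (t%:E < f x)%E) @^-1` [set true].
    by apply/seteqP; split.
  by rewrite -[X in measurable X]setTI; apply: measurable_fun_lte.
have mdist (f : R -> \bar R) : measurable_fun setT f ->
    measurable_fun setT (fun t : R => lam [set x | (t%:E < f x)%E]).
  move=> mf; pose A := [set p : R * R | (p.1%:E < f p.2)%E].
  have mA : measurable A.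
    have -> : A = (fun p : R * R => (p.1%:E < f p.2)%E) @^-1` [set true].
      by apply/seteqP; split.
    rewrite -[X in measurable X]setTI; apply: measurable_fun_lte => //.
      by apply/measurable_EFinP; exact: measurable_fst.
    exact: measurableT_comp.
  have := measurable_fun_xsection lam mA.
  by congr measurable_fun; apply/funext => t /=; congr (lam _); apply/seteqP; split => x /=; rewrite /xsection/= inE.
rewrite !trunc//.
apply: (@le_trans _ _ (2%:E * \int[lam]_x mine (w x) 1)%E); last first.
  rewrite lee_pmul2l//; apply: ge0_le_integral => //.
  - by move=> x _; rewrite le_min w0 lee01.
  - exact: measurable_mine.
  - by move=> x _; rewrite ge_min lexx.
rewrite integral_mine1// -ge0_integralD//; last 2 first.
- apply: measurable_funTS; exact: (mdist (EFin \o u) (measurableT_comp _ mu)).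
- apply: measurable_funTS; exact: (mdist (EFin \o v) (measurableT_comp _ mv)).
rewrite -ge0_integralZl_EFin//; last by apply: measurable_funTS; exact: mdist.
apply: ge0_le_integral => //.
- by move=> t _; apply: adde_ge0.
- apply: emeasurable_funD; apply: measurable_funTS.
    exact: (mdist (EFin \o u) (measurableT_comp _ mu)).
  exact: (mdist (EFin \o v) (measurableT_comp _ mv)).
- by apply: emeasurable_funM => //; apply: measurable_funTS; exact: mdist.
move=> t /=; rewrite in_itv/= => /andP[t0 t1].
have mlevR (f : R -> R) : measurable_fun setT f -> measurable [set x | t < f x].
  by move=> mf; exact: (mlev (EFin \o f) t (measurableT_comp _ mf)).
apply: lebesgue_measure_midpoint => //.
- exact: mlevR.
- exact: mlevR.
- exact: mlev.
- by have [x tx] := usup t t1; exists x.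
- by have [x tx] := vsup t t1; exists x.
- exists k => x /= tx; apply: le_trans (ler_norm x) _; apply: uk.
  by rewrite gt_eqF// (le_lt_trans t0).
- exists (- k) => x /= tx; rewrite lerNl; apply: le_trans (ler_norm _) _; rewrite normrN; apply: vk.
  by rewrite gt_eqF// (le_lt_trans t0).
(* Values above [t] at [x] and [y] force [w ^ 2 > t ^ 2] at the midpoint, hence [w > t] there. *)
move=> x y /= tx ty; rewrite ltNge; apply/negP => wt.
have := uvw x y; move: wt (w0 ((x + y) / 2)); case: (w _) => [r| |]//.
rewrite -EFinM !lee_fin => rt r0; apply/negP; rewrite -ltNge.
by apply: (@le_lt_trans _ _ (t * t)); [exact: ler_pM|exact: ltr_pM].
Qed.

(** Rescaling [u] and [v] to supremum 1 reduces this to the additive inequality; AM-GM then turns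
    the sum of the integrals into their product. *)
Lemma prekopa_leindler_bounded (u v : R -> R) (w : R -> \bar R) (k M : R) :
  measurable_fun setT u -> measurable_fun setT v -> measurable_fun setT w ->
  (forall x, 0 <= u x <= M) -> (forall x, 0 <= v x <= M) ->
  (forall x, 0 <= w x)%E ->
  (forall x, u x != 0 -> `|x| <= k) -> (forall x, v x != 0 -> `|x| <= k) ->
  (forall x y, (u x * v y)%:E <= w ((x + y) / 2)%R * w ((x + y) / 2)%R)%E ->
  (\int[lam]_x (u x)%:E * \int[lam]_x (v x)%:E <=
   \int[lam]_x w x * \int[lam]_x w x)%E.
Proof.
move=> mu mv mw uM vM w0 uk vk uvw.
have W0 : (0 <= \int[lam]_x w x)%E by apply: integral_ge0.
have U0 (f : R -> R) : (forall x, 0 <= f x <= M) -> (0 <= \int[lam]_x (f x)%:E)%E.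
  by move=> f0; apply: integral_ge0 => x _; rewrite lee_fin; case/andP: (f0 x).
pose supr (f : R -> R) := sup (range f).
have hs (f : R -> R) : (forall x, 0 <= f x <= M) -> has_sup (range f).
  move=> fM; split; first by exists (f 0), 0.
  by exists M => _ [x _ <-]; case/andP: (fM x).
have les (f : R -> R) : (forall x, 0 <= f x <= M) -> forall x, f x <= supr f.
  by move=> fM x; apply: ub_le_sup; [case: (hs f fM)|exists x].
have s0 (f : R -> R) : (forall x, 0 <= f x <= M) -> supr f <= 0 -> (\int[lam]_x (f x)%:E = 0)%E.
  move=> fM sf; apply: integral0_eq => x _; congr EFin; apply/eqP.
  by rewrite eq_le (le_trans (les f fM x) sf); case/andP: (fM x).
have [a0|a0] := leP (supr u) 0; first by rewrite (s0 u)// mul0e mule_ge0.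
have [b0|b0] := leP (supr v) 0; first by rewrite (s0 v)// mule0 mule_ge0.
set a := supr u in a0 *; set b := supr v in b0 *.
(* Dividing [w] by the geometric mean of the two suprema preserves the midpoint hypothesis for
   [u / a] and [v / b]. *)
pose s := Num.sqrt (a * b).
have ab0 : 0 < a * b by exact: mulr_gt0.
have sE : s * s = a * b by rewrite -expr2 sqr_sqrtr// ltW.
have s_gt0 : 0 < s by rewrite sqrtr_gt0.
have nrm (f : R -> R) c : 0 < c -> c = supr f -> (forall x, 0 <= f x <= M) ->
    (forall x, 0 <= c^-1 * f x <= 1) /\ (forall t, t < 1 -> exists x, t < c^-1 * f x).
  move=> c0 cE fM; split=> [x|t t1].
    rewrite mulr_ge0 ?invr_ge0 ?(ltW c0)//=; last by case/andP: (fM x).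
    by rewrite mulrC ler_pdivrMr// mul1r cE les.
  have e0 : 0 < c * (1 - t) by rewrite mulr_gt0// subr_gt0.
  have [_ [x _ <-] h] := sup_adherent e0 (hs f fM).
  exists x; rewrite mulrC ltr_pdivlMr//; move: h; rewrite -/(supr f) -cE; nra.
have [u1 us] := nrm u a a0 erefl uM.
have [v1 vs] := nrm v b b0 erefl vM.
have sV0 : 0 <= s^-1 by rewrite invr_ge0 ltW.
have := @prekopa_leindler_sup1 (fun x => a^-1 * u x) (fun x => b^-1 * v x)
  (fun x => s^-1%:E * w x)%E k.
have im (f : R -> R) c : measurable_fun setT f -> (forall x, 0 <= f x <= M) -> 0 <= c ->
    (\int[lam]_x (c * f x)%:E = c%:E * \int[lam]_x (f x)%:E)%E.
  move=> mf f0 c0; under eq_integral do rewrite EFinM.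
  rewrite ge0_integralZl_EFin//; first by move=> x _; rewrite lee_fin; case/andP: (f0 x).
  exact/measurable_EFinP.
have a_ge0 := ltW a0; have b_ge0 := ltW b0.
rewrite (im u)// ?invr_ge0// (im v)// ?invr_ge0// ge0_integralZl_EFin//.
move=> H.
have {}H : ((a^-1)%:E * (\int[lam]_x (u x)%:E) + (b^-1)%:E * (\int[lam]_x (v x)%:E) <=
    2%:E * (s^-1%:E * (\int[lam]_x w x)))%E.
  apply: H => //.
  - exact: measurable_funM.
  - exact: measurable_funM.
  - exact: emeasurable_funM.
  - by move=> x; rewrite mule_ge0.
  - by move=> x; rewrite mulf_eq0 negb_or => /andP[_ /uk].
  - by move=> x; rewrite mulf_eq0 negb_or => /andP[_ /vk].
  - move=> x y; rewrite muleACA -EFinM -invfM sE.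
    rewrite mulrACA -invfM EFinM lee_pmul2l//=; last by rewrite lte_fin invr_gt0.
(* An infinite integral of [w] makes the claim trivial; with that integral finite, the additive
   inequality rules out an infinite integral of [u] or [v]. *)
move: W0 (U0 u uM) (U0 v vM) H; case: (\int[lam]_x w x)%E => [W| |]//; last first.
  by move=> _ _ _ _; rewrite mulyy leey.
case: (\int[lam]_x (u x)%:E)%E => [A| |]//; last first.
  move=> _ _ B0; have bV0 : (0 <= (b^-1)%:E :> \bar R)%E by rewrite lee_fin invr_ge0.
  have := mule_ge0 bV0 B0; rewrite gt0_muley ?lte_fin ?invr_gt0//.
  by case: (_ * _)%E.
case: (\int[lam]_x (v x)%:E)%E => [B| |]//; last first.
  by move=> _ A0 _; rewrite gt0_muley ?lte_fin ?invr_gt0.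
rewrite -!EFinM -EFinD !lee_fin => W0 A0 B0 H.
pose p := a^-1 * A; pose q := b^-1 * B; pose r := s^-1 * W.
have AE : A = a * p by rewrite /p mulrA divff ?mul1r// gt_eqF.
have BE : B = b * q by rewrite /q mulrA divff ?mul1r// gt_eqF.
have WE : W = s * r by rewrite /r mulrA divff ?mul1r// gt_eqF.
have p0 : 0 <= p by rewrite mulr_ge0// invr_ge0 ltW.
have q0 : 0 <= q by rewrite mulr_ge0// invr_ge0 ltW.
rewrite AE BE WE mulrACA [leRHS]mulrACA sE ler_pM2l//.
have {}H : p + q <= 2 * r by exact: H.
have : 0 <= (p - q) ^+ 2 by exact: sqr_ge0.
nra.
Qed.

(** [u] and [v] are truncated in height and in support at level [k]. This only decreases them, so
    the same [w] works for every [k], and monotone convergence removes the truncation. *)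
Lemma prekopa_leindler1 (u v w : R -> \bar R) :
  measurable_fun setT u -> measurable_fun setT v -> measurable_fun setT w ->
  (forall x, 0 <= u x)%E -> (forall x, 0 <= v x)%E -> (forall x, 0 <= w x)%E ->
  (forall x y, u x * v y <= w ((x + y) / 2)%R * w ((x + y) / 2)%R)%E ->
  (\int[lam]_x u x * \int[lam]_x v x <=
   \int[lam]_x w x * \int[lam]_x w x)%E.
Proof.
move=> mu mv mw u0 v0 w0 uvw.
pose tr (f : R -> \bar R) (k : nat) (x : R) : R :=
  if `|x| <= k%:R then fine (mine (f x) k%:R%:E) else 0.
have trE (f : R -> \bar R) k x : (0 <= f x)%E ->
    ((tr f k x)%:E = if (`|x| <= k%:R)%R then mine (f x) k%:R%:E else 0)%E.
  move=> f0; rewrite /tr; case: ifP => // _; rewrite fineK//.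
  rewrite ge0_fin_numE; first by rewrite gt_min ltry orbT.
  by rewrite le_min f0 lee_fin ler0n.
have tr0 (f : R -> \bar R) k x : (0 <= f x)%E -> 0 <= tr f k x <= k%:R.
  move=> f0; rewrite -2!lee_fin trE//; case: ifP => _; last by rewrite lexx lee_fin/=.
  by rewrite le_min f0 lee_fin ler0n/= ge_min lexx orbT.
have mtr : forall (f : R -> \bar R) k, measurable_fun setT f -> measurable_fun setT (tr f k).
  move=> f k mf; apply: measurable_fun_ifT.
  - by apply: measurable_fun_ler => //; exact: measurableT_comp.
  - by apply: measurableT_comp => //; exact: measurable_mine.
  - by [].
have trle (f : R -> \bar R) k x : (0 <= f x)%E -> ((tr f k x)%:E <= f x)%E.
  by move=> f0; rewrite trE//; case: ifP => // _; rewrite ge_min lexx.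
have trnd (f : R -> \bar R) x : (0 <= f x)%E ->
    {homo (fun k => (tr f k x)%:E) : m n / (m <= n)%N >-> (m <= n)%E}.
  move=> f0 m n mn; rewrite !trE//.
  have mnR : m%:R <= n%:R :> R by rewrite ler_nat.
  case: ifP => xm; last by case: ifP => // _; rewrite le_min f0 lee_fin ler0n.
  rewrite (le_trans xm mnR) le_min ge_min lexx/=.
  by rewrite ge_min lee_fin mnR orbT.
have trcvg (f : R -> \bar R) x : (0 <= f x)%E -> (tr f k x)%:E @[k --> \oo] --> f x.
  move=> f0; case E : (f x) (f0) => [r| |]// r0.
    apply: cvg_near_cst; near=> k; apply/eqP.
    rewrite trE// E ifT; last by near: k; exact: nbhs_infty_ger.
    by rewrite min_l// lee_fin; near: k; exact: nbhs_infty_ger.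
  apply/cvgeyPge => A; near=> k.
  rewrite trE// E ifT; last by near: k; exact: nbhs_infty_ger.
  by rewrite min_r ?leey// lee_fin; near: k; exact: nbhs_infty_ger.
have icvg (f : R -> \bar R) : measurable_fun setT f -> (forall x, 0 <= f x)%E ->
    (\int[lam]_x (tr f k x)%:E)%E @[k --> \oo] --> (\int[lam]_x f x)%E.
  move=> mf f0.
  have -> : (\int[lam]_x f x = \int[lam]_x limn (fun k => (tr f k x)%:E))%E.
    by apply: eq_integral => x _; apply/esym/cvg_lim => //; exact: trcvg.
  apply: cvg_monotone_convergence => //.
  - by move=> n; apply/measurable_EFinP; exact: mtr.
  - by move=> n x _; rewrite lee_fin; case/andP: (tr0 f n x (f0 x)).
  - by move=> x _; exact: trnd.
have U0 : (0 <= \int[lam]_x u x)%E by apply: integral_ge0.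
have V0 : (0 <= \int[lam]_x v x)%E by apply: integral_ge0.
have W0 : (0 <= \int[lam]_x w x)%E by apply: integral_ge0.
have [->|Un0] := eqVneq (\int[lam]_x u x)%E 0%E; first by rewrite mul0e mule_ge0.
have [->|Vn0] := eqVneq (\int[lam]_x v x)%E 0%E; first by rewrite mule0 mule_ge0.
have UV : (\int[lam]_x u x *? \int[lam]_x v x)%E.
  by rewrite mule_defE negb_or (negbTE Un0) (negbTE Vn0).
have UVk := cvgeM (FF := eventually_filter) UV (icvg u mu u0) (icvg v mv v0).
rewrite -(cvg_lim _ UVk)//; apply: lime_le; first by apply/cvg_ex; eexists; exact: UVk.
apply: nearW => k; apply: (@prekopa_leindler_bounded _ _ w k%:R k%:R) => //.
- exact: mtr.
- exact: mtr.
- by move=> x; exact: tr0.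
- by move=> x; exact: tr0.
- by move=> x; rewrite /tr; case: ifP => //; rewrite eqxx.
- by move=> x; rewrite /tr; case: ifP => //; rewrite eqxx.
- move=> x y; apply: le_trans (uvw x y); rewrite EFinM; apply: lee_pmul.
  + by rewrite lee_fin; case/andP: (tr0 u k x (u0 x)).
  + by rewrite lee_fin; case/andP: (tr0 v k y (v0 y)).
  + exact: trle.
  + exact: trle.
Unshelve. all: by end_near. Qed.

End prekopa_leindler.

(** * Iterated integrals on R^n and Prekopa-Leindler in every dimension *)

Section lebesgue_rV_tonelli.
Context {R : realType}.
Local Notation lam := (@lebesgue_measure R).

Lemma consrV0 n (x : R) (y : 'rV[R]_n) : consrV (x, y) 0 0 = x.
Proof.
rewrite /consrV /=.
transitivity ((x%:M : 'M[R]_1) 0 0); last by rewrite mxE eqxx.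
by rewrite -(row_mxEl x%:M y 0 0); congr (row_mx _ _ _ _); exact/val_inj.
Qed.

Lemma consrV_lift n (x : R) (y : 'rV[R]_n) (i : 'I_n) :
  consrV (x, y) 0 (lift ord0 i) = y 0 i.
Proof.
rewrite /consrV /= -(row_mxEr x%:M y 0 i).
by congr (row_mx _ _ _ _); exact/val_inj.
Qed.

Lemma measurable_consrV_section n (f : 'rV[R]_n.+1 -> \bar R) (s : R) :
  measurable_fun setT f -> measurable_fun setT (fun y => f (consrV (s, y))).
Proof.
move=> mf; have mg : measurable_fun setT (f \o @consrV R n).
  by apply: measurableT_comp => //; exact: measurable_consrV.
exact: (measurableT_comp mg).
Qed.

Lemma measurable_integral_consrV n (f : 'rV[R]_n.+1 -> \bar R) :
  measurable_fun setT f -> (forall x, 0 <= f x)%E ->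
  measurable_fun setT (fun s : R => \int[lebesgue_rV n]_y f (consrV (s, y)))%E.
Proof.
move=> mf f0; have mg : measurable_fun setT (f \o @consrV R n).
  by apply: measurableT_comp => //; exact: measurable_consrV.
exact: (measurable_fun_fubini_tonelli_F _ mg (fun x => f0 _)).
Qed.

Lemma integral_lebesgue_rVS n (f : 'rV[R]_n.+1 -> \bar R) :
  measurable_fun setT f -> (forall x, 0 <= f x)%E ->
  (\int[lebesgue_rV n.+1]_x f x =
   \int[lam]_s \int[lebesgue_rV n]_y f (consrV (s, y)))%E.
Proof.
move=> mf f0; have mg : measurable_fun setT (f \o @consrV R n).
  by apply: measurableT_comp => //; exact: measurable_consrV.
pose pm : {measure set (measurableTypeR R * 'rV[R]_n)%type -> \bar R} :=
  (lam \x lebesgue_rV n)%E.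
transitivity (\int[pm]_p (f \o @consrV R n) p)%E.
  have mc : measurable_fun [set: (measurableTypeR R * 'rV[R]_n)%type]
      (@consrV R n : _ -> 'rV[R]_n.+1) by exact: measurable_consrV.
  exact: (ge0_integral_pushforward mc pm
    measurableT mf (fun x _ => f0 x)).
exact: (@fubini_tonelli1 _ _ _ _ R lam (lebesgue_rV n) _ mg (fun x => f0 _)).
Qed.

Lemma integral_lebesgue_rV0 (f : 'rV[R]_0 -> \bar R) :
  (\int[lebesgue_rV 0]_x f x = f 0%R)%E.
Proof.
have mf : measurable_fun setT f.
  move=> _ B mB; rewrite setTI.
  have [f0|f0] := pselect (B (f 0)).
    rewrite (_ : _ @^-1` _ = setT)//; apply/seteqP; split => // x _ /=.
    by rewrite [x]thinmx0.
  rewrite (_ : _ @^-1` _ = set0)//; apply/seteqP; split => // x /=.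
  by rewrite [x]thinmx0.
by rewrite [LHS](integral_dirac _ measurableT mf) diracT mul1e.
Qed.

(** For fixed first coordinates [s] and [t], the inequality in dimension [n] applied to the sections
    says exactly that the marginals satisfy the hypothesis of the one-dimensional inequality. *)
Lemma prekopa_leindler n (u v w : 'rV[R]_n -> \bar R) :
  measurable_fun setT u -> measurable_fun setT v -> measurable_fun setT w ->
  (forall x, 0 <= u x)%E -> (forall x, 0 <= v x)%E -> (forall x, 0 <= w x)%E ->
  (forall x y, u x * v y <= w (2^-1 *: (x + y))%R * w (2^-1 *: (x + y))%R)%E ->
  (\int[lebesgue_rV n]_x u x * \int[lebesgue_rV n]_x v x <=
   \int[lebesgue_rV n]_x w x * \int[lebesgue_rV n]_x w x)%E.
Proof.
elim: n u v w => [|n IH] u v w mu mv mw u0 v0 w0 uvw.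
  rewrite !integral_lebesgue_rV0.
  by apply: le_trans (uvw 0 0) _; rewrite addr0 scaler0.
rewrite !integral_lebesgue_rVS//.
apply: prekopa_leindler1.
- exact: measurable_integral_consrV.
- exact: measurable_integral_consrV.
- exact: measurable_integral_consrV.
- by move=> x; exact: integral_ge0.
- by move=> x; exact: integral_ge0.
- by move=> x; exact: integral_ge0.
move=> s t; apply: IH => //; [exact: measurable_consrV_section..|].
move=> x y.
have -> : consrV ((s + t) / 2, 2^-1 *: (x + y)) = 2^-1 *: (consrV (s, x) + consrV (t, y)).
  apply/rowP => i; rewrite [RHS]mxE [X in _ = _ * X]mxE.
  case: (unliftP ord0 i) => [j|] ->; last by rewrite !consrV0 mulrC.
  by rewrite !consrV_lift !mxE.
exact: uvw.
Qed.

End lebesgue_rV_tonelli.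

(** * Poincare inequality for strongly log-concave weights *)

Section linearization.
Context {R : realType}.

(** The Taylor polynomial times [exp (- x)] has derivative [- exp (- x) x ^ 3 / 6], so it peaks at 0
    with value 1. The odd order is what makes the bound hold for negative arguments too. *)
Lemma expR_ge_taylor3 (z : R) : 1 + z + z ^+ 2 / 2 + z ^+ 3 / 6 <= expR z.
Proof.
pose psi (x : R) := expR (- x) * (1 + x + x ^+ 2 / 2 + x ^+ 3 / 6).
pose dpsi (x : R) := - (expR (- x) * (x ^+ 3 / 6)).
have dP (x : R) : is_derive x 1 psi (dpsi x).
  apply: is_derive_eq; rewrite /dpsi /GRing.scale /=; by field.
have cP (a b : R) : {within `[a, b], continuous psi}.
  apply: derivable_within_continuous => x _; exact: ex_derive.
suff : psi z <= 1.
  by rewrite /psi expRN mulrC ler_pdivrMr ?expR_gt0// mul1r.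
have p0 : psi 0 = 1 by rewrite /psi oppr0 expR0 expr2 exprS !mul0r !addr0 mul1r.
have dle (c : R) : 0 <= c -> dpsi c <= 0.
  by move=> c0; rewrite oppr_le0 mulr_ge0 ?expR_ge0// divr_ge0// exprn_ge0.
have dge (c : R) : c <= 0 -> 0 <= dpsi c.
  move=> c0; rewrite oppr_ge0 mulr_ge0_le0 ?expR_ge0// mulr_le0_ge0 ?invr_ge0//.
  by rewrite exprS mulr_le0_ge0// sqr_ge0.
have [z0|z0|->] := ltgtP z 0; last by rewrite p0.
  have [c /[!in_itv]/= /andP[zc c0] E] := MVT z0 (fun x _ => dP x) (cP _ _).
  have := dge c (ltW c0); rewrite -p0; nra.
have [c /[!in_itv]/= /andP[c0 zc] E] := MVT z0 (fun x _ => dP x) (cP _ _).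
have := dle c (ltW c0); rewrite -p0; nra.
Qed.

Lemma expR_ge_expansion (M : R) : 0 <= M -> exists2 C : R, 0 <= C &
  forall e a b : R, 0 < e <= 1 -> `|a| <= M -> 0 <= b <= M ->
  1 + e * a + e ^+ 2 * (a ^+ 2 / 2 - b) - C * e ^+ 3 <= expR (e * a - e ^+ 2 * b).
Proof.
(* With [r = a - e b], [M ^ 2] absorbs the cross term [e ^ 3 a b] of [(e r) ^ 2 / 2], and
   [(2 M) ^ 3] absorbs the cubic term, since [r] is at most [2 M] in absolute value. *)
move=> M0; exists (M ^+ 2 + (2 * M) ^+ 3); first by rewrite addr_ge0// exprn_ge0// mulr_ge0.
move=> e a b /andP[e0 e1] aM /andP[b0 bM].
apply: le_trans (expR_ge_taylor3 _).
pose r := a - e * b.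
have -> : e * a - e ^+ 2 * b = e * r by rewrite /r; ring.
have e2 : e * b <= M by nra.
have rM : `|r| <= 2 * M.
  rewrite /r; apply: (le_trans (ler_normB _ _)).
  by rewrite (ger0_norm (x := e * b)); [lra|rewrite mulr_ge0// ltW].
have r3 : - (2 * M) ^+ 3 <= r ^+ 3.
  have : `|r ^+ 3| <= (2 * M) ^+ 3 by rewrite normrX lerXn2r// nnegrE mulr_ge0.
  by rewrite ler_norml => /andP[].
have e3 : 0 < e ^+ 3 by rewrite exprn_gt0.
have ab : a * b <= M ^+ 2.
  have := ler_norm (a * b); rewrite normrM (ger0_norm b0) => h.
  by apply: le_trans h _; rewrite expr2 ler_pM.
have r2 : e ^+ 2 * a ^+ 2 - 2 * e ^+ 3 * M ^+ 2 <= (e * r) ^+ 2.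
  have -> : (e * r) ^+ 2 = e ^+ 2 * a ^+ 2 - 2 * e ^+ 3 * (a * b) + (e ^+ 2 * b) ^+ 2.
    by rewrite /r; ring.
  have := sqr_ge0 (e ^+ 2 * b); nra.
have -> : e * r = e * a - e ^+ 2 * b by rewrite /r; ring.
have -> : (e * a - e ^+ 2 * b) ^+ 2 = (e * r) ^+ 2 by rewrite /r; ring.
have -> : (e * a - e ^+ 2 * b) ^+ 3 = e ^+ 3 * r ^+ 3 by rewrite /r; ring.
have : 0 <= (2 * M) ^+ 3 by rewrite exprn_ge0// mulr_ge0.
nra.
Qed.

(** The terms of order 0 cancel and those of order 1 are absent, so the coefficient [Z (p + q)] of
    [e ^ 2] in [U V - Z ^ 2] decides the sign for small [e]. *)
Lemma second_order_product (Z p q C e1 : R) : 0 < Z -> 0 <= C -> 0 < e1 ->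
  (forall e, 0 < e <= e1 -> exists U V, [/\ Z + e ^+ 2 * p - C * e ^+ 3 <= U,
     Z + e ^+ 2 * q - C * e ^+ 3 <= V & U * V <= Z ^+ 2]) ->
  p + q <= 0.
Proof.
move=> Z0 C0 e10 H; rewrite leNgt; apply/negP => d0.
set d := p + q in d0.
pose B := `|p| + `|q| + C.
have B0 : 0 <= B by rewrite !addr_ge0.
(* The third bound makes the two remainders cost at most [d / 2] together. The fourth keeps both
   lower bounds positive, so that they can be multiplied. The last makes [e ^ 2 P Q] at least
   [- Z d / 4], against a gain of [Z d / 2]. *)
pose e := Num.min e1 (Num.min 1 (Num.min (d / (4 * (C + 1)))
   (Num.min (Z / (B + 1)) (Z * d / (4 * (B ^+ 2 + 1)))))).
have B2 : 0 <= B ^+ 2 by exact: sqr_ge0.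
have e0 : 0 < e.
  rewrite !lt_min e10 ltr01/=; apply/and3P; split; apply: divr_gt0; try nra.
have ee1 : e <= e1 by rewrite ge_min lexx.
have e_1 : e <= 1 by rewrite !ge_min lexx orbT.
have eC : e * (4 * (C + 1)) <= d.
  by rewrite -ler_pdivlMr; [rewrite !ge_min lexx !orbT|nra].
have eB : e * (B + 1) <= Z.
  by rewrite -ler_pdivlMr; [rewrite !ge_min lexx !orbT|nra].
have eB2 : e * (4 * (B ^+ 2 + 1)) <= Z * d.
  by rewrite -ler_pdivlMr; [rewrite !ge_min lexx !orbT|nra].
have [|U [V [hU hV UV]]] := H e; first by rewrite e0 ee1.
pose P := p - C * e; pose Q := q - C * e.
have PB : `|P| <= B.
  apply: (le_trans (ler_normB _ _)); rewrite /B (ger0_norm (x := C * e)); last by rewrite mulr_ge0// ltW.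
  have := normr_ge0 q; nra.
have QB : `|Q| <= B.
  apply: (le_trans (ler_normB _ _)); rewrite /B (ger0_norm (x := C * e)); last by rewrite mulr_ge0// ltW.
  have := normr_ge0 p; nra.
have PQ : - B ^+ 2 <= P * Q.
  have : `|P * Q| <= B ^+ 2 by rewrite normrM expr2 ler_pM.
  by rewrite ler_norml => /andP[].
have ePB : e ^+ 2 * B < Z by rewrite expr2; nra.
have hU' : 0 < Z + e ^+ 2 * P.
  have : - B <= P by move: PB; rewrite ler_norml => /andP[].
  have : 0 < e ^+ 2 by rewrite exprn_gt0.
  nra.
have hV' : 0 < Z + e ^+ 2 * Q.
  have : - B <= Q by move: QB; rewrite ler_norml => /andP[].
  have : 0 < e ^+ 2 by rewrite exprn_gt0.
  nra.
have : (Z + e ^+ 2 * P) * (Z + e ^+ 2 * Q) <= Z ^+ 2.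
  apply: le_trans UV; apply: ler_pM; [exact: ltW|exact: ltW| |].
    by rewrite (_ : Z + e ^+ 2 * P = Z + e ^+ 2 * p - C * e ^+ 3)// /P; ring.
  by rewrite (_ : Z + e ^+ 2 * Q = Z + e ^+ 2 * q - C * e ^+ 3)// /Q; ring.
apply/negP; rewrite -ltNge.
have -> : (Z + e ^+ 2 * P) * (Z + e ^+ 2 * Q) =
    Z ^+ 2 + e ^+ 2 * (Z * (P + Q) + e ^+ 2 * (P * Q)) by ring.
rewrite ltrDl mulr_gt0 ?exprn_gt0//.
have PQd : d / 2 <= P + Q by rewrite /P /Q; have := eC; rewrite /d; nra.
have e2 : e ^+ 2 * B ^+ 2 <= Z * d / 4.
  apply: (@le_trans _ _ (e * B ^+ 2)); last by lra.
  by rewrite ler_wpM2r// expr2; nra.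
have e20 : 0 <= e ^+ 2 by exact: sqr_ge0.
have : - (e ^+ 2 * B ^+ 2) <= e ^+ 2 * (P * Q) by rewrite -mulrN ler_wpM2l.
have : Z * (d / 2) <= Z * (P + Q) by rewrite ler_wpM2l// ltW.
have : 0 < Z * d by rewrite mulr_gt0.
lra.
Qed.

Lemma integrable_bounded_density d (T : measurableType d)
    (mu : {measure set T -> \bar R}) (rho h : T -> R) (M : R) :
  measurable_fun setT rho -> measurable_fun setT h -> (forall x, 0 <= rho x) ->
  (\int[mu]_x (rho x)%:E < +oo)%E -> (forall x, rho x != 0 -> `|h x| <= M) ->
  mu.-integrable setT (EFin \o (fun x => h x * rho x)).
Proof.
move=> mrho mh rho0 rhoy hM.
have irho : mu.-integrable setT (EFin \o rho).
  apply/integrableP; split; first exact/measurable_EFinP.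
  by under eq_integral do rewrite /= ger0_norm//.
apply: (le_integrable measurableT _ _ (integrableZl measurableT M irho)).
  by apply/measurable_EFinP; exact: measurable_funM.
move=> x _ /=; rewrite -?EFinM /= lee_fin !normrM (ger0_norm (rho0 x)).
have [->|r0] := eqVneq (rho x) 0; first by rewrite !mulr0.
by rewrite ler_wpM2r// (le_trans (hM x r0))// ler_norm.
Qed.

(* Second-order expansion, as [e] tends to 0, of a property (tau). *)
Lemma variance_le_of_exponential d (T : measurableType d)
    (mu : {measure set T -> \bar R}) (rho f g : T -> R) (M e1 : R) :
  measurable_fun setT rho -> measurable_fun setT f -> measurable_fun setT g ->
  (forall x, 0 <= rho x) -> (\int[mu]_x (rho x)%:E < +oo)%E ->
  (forall x, rho x != 0 -> `|f x| <= M) -> (forall x, rho x != 0 -> 0 <= g x <= M) ->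
  0 < e1 ->
  (forall e : R, (0 < e <= e1)%R ->
    \int[mu]_x (rho x * expR (e * f x - e ^+ 2 * g x))%:E *
    \int[mu]_x (rho x * expR (- (e * f x)))%:E <=
    \int[mu]_x (rho x)%:E * \int[mu]_x (rho x)%:E)%E ->
  (\int[mu]_x ((f x - (\int[mu]_y (f y * rho y) / \int[mu]_y rho y)) ^+ 2 * rho x)%:E <=
   \int[mu]_x (g x * rho x)%:E)%E.
Proof.
move=> mrho mf mg rho0 rhoy fM gM e10 H.
pose I (h : T -> R) := (\int[mu]_x (h x * rho x))%R.
have IE (h : T -> R) (M' : R) : measurable_fun setT h -> (forall x, rho x != 0 -> `|h x| <= M') ->
    (\int[mu]_x (h x * rho x)%:E = (I h)%:E)%E.
  move=> mh hM; rewrite /I /Rintegral fineK//.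
  apply: integrable_fin_num => //; exact: (@integrable_bounded_density _ _ _ _ _ M').
have ID (h1 h2 : T -> R) (M1 M2 : R) : measurable_fun setT h1 -> measurable_fun setT h2 ->
    (forall x, rho x != 0 -> `|h1 x| <= M1) -> (forall x, rho x != 0 -> `|h2 x| <= M2) ->
    I (fun x => h1 x + h2 x) = I h1 + I h2.
  move=> m1 m2 b1 b2; rewrite /I -RintegralD//.
  - by apply: eq_Rintegral => x _; rewrite mulrDl.
  - exact: (@integrable_bounded_density _ _ _ _ _ M1).
  - exact: (@integrable_bounded_density _ _ _ _ _ M2).
have IZ (h : T -> R) (k M1 : R) : measurable_fun setT h -> (forall x, rho x != 0 -> `|h x| <= M1) ->
    I (fun x => k * h x) = k * I h.
  move=> mh hM; rewrite /I -RintegralZl//.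
  - by apply: eq_Rintegral => x _; rewrite mulrA.
  - exact: (@integrable_bounded_density _ _ _ _ _ M1).
pose Z := I (cst 1).
have ZE : (\int[mu]_x (rho x)%:E = Z%:E)%E.
  rewrite -(IE (cst 1) 1)//; last by move=> x _; rewrite normr1.
  by apply: eq_integral => x _; rewrite mul1r.
have Z0 : 0 <= Z by rewrite -lee_fin -ZE integral_ge0// => x _; rewrite lee_fin.
have Ige0 (h : T -> R) : measurable_fun setT h -> (forall x, rho x != 0 -> 0 <= h x) ->
    (0 <= \int[mu]_x (h x * rho x)%:E)%E.
  move=> mh h0; apply: integral_ge0 => x _; rewrite lee_fin.
  by have [->|r0] := eqVneq (rho x) 0; [rewrite mulr0|rewrite mulr_ge0// h0].
have Gge0 : (0 <= \int[mu]_x (g x * rho x)%:E)%E.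
  by apply: Ige0 => // x /gM/andP[].
rewrite (_ : (\int[mu]_y rho y)%R = Z); last first.
  by apply: eq_Rintegral => x _; rewrite mul1r.
rewrite -/(I f); set c := I f / Z.
(* If the weight has no mass then [c = 0], as division by 0 returns 0, and the left side is at most
   [M ^ 2] times the mass. *)
have [Zeq0|Zn0] := eqVneq Z 0.
  rewrite /c Zeq0 invr0 mulr0 (_ : (\int[mu]_x ((f x - 0) ^+ 2 * rho x)%:E = 0)%E)//.
  apply/eqP; rewrite eq_le; apply/andP; split; last first.
    apply: Ige0 => [|x _]; last exact: sqr_ge0.
    by apply: measurable_funX; apply: measurable_funB.
  apply: (@le_trans _ _ ((M ^+ 2)%:E * \int[mu]_x (rho x)%:E)%E); last by rewrite ZE Zeq0 mule0.
  rewrite -ge0_integralZl_EFin//; last 3 first.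
  - by move=> x _; rewrite lee_fin.
  - exact/measurable_EFinP.
  - exact: sqr_ge0.
  apply: ge0_le_integral => //.
  - by move=> x _; rewrite lee_fin mulr_ge0// sqr_ge0.
  - by apply/measurable_EFinP; apply: measurable_funM => //; apply: measurable_funX; apply: measurable_funB.
  - by apply/measurable_EFinP; apply: measurable_funM.
  move=> x _; rewrite -EFinM lee_fin subr0.
  have [->|r0] := eqVneq (rho x) 0; first by rewrite !mulr0.
  rewrite ler_wpM2r// -real_normK ?num_real// lerXn2r ?nnegrE ?fM//.
  exact: le_trans (fM x r0).
have Zgt0 : 0 < Z by rewrite lt_neqAle eq_sym Zn0.
(* Centring multiplies the two exponential integrals by factors [exp (e c)] and [exp (- e c)], which
   cancel in the product, and it removes the first-order terms of the expansion. *)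
pose f0 x := f x - c.
have mf0 : measurable_fun setT f0 by apply: measurable_funB.
pose M0 := `|M| + `|c|.
have M00 : 0 <= M0 by rewrite addr_ge0.
have f0M x : rho x != 0 -> `|f0 x| <= M0.
  by move=> r0; apply: (le_trans (ler_normB _ _)); rewrite lerD2r (le_trans (fM x r0))// ler_norm.
have gM0 x : rho x != 0 -> 0 <= g x <= M0.
  move=> /gM/andP[-> h]; rewrite /= (le_trans h)// (le_trans (ler_norm _))//.
  by rewrite lerDl.
have gM0' x : rho x != 0 -> `|g x| <= M0 by move=> /gM0/andP[? ?]; rewrite ger0_norm.
have If0 : I f0 = 0.
  rewrite /f0 (ID f (cst (- c)) M `|c|)//; last by move=> x _; rewrite normrN.
  rewrite (_ : I (cst (- c)) = - c * Z); last first.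
    rewrite -(IZ (cst 1) (- c) 1)//; last by move=> x _; rewrite normr1.
    by congr I; apply/funext => x; rewrite /= mulr1.
  by rewrite /c; field.
have mf02 : measurable_fun setT (fun x => f0 x ^+ 2) by exact: measurable_funX.
have f02M x : rho x != 0 -> `|f0 x ^+ 2| <= M0 ^+ 2.
  by move=> r0; rewrite normrX lerXn2r ?nnegrE ?f0M.
have [C C0 expC] := expR_ge_expansion M00.
rewrite (IE (fun x => f0 x ^+ 2) (M0 ^+ 2))// (IE g M0)// lee_fin -subr_le0.
(* The integral with [f0] and [g] contributes half of the variance minus [I g]; the integral with
   [- f0] contributes the other half. *)
have -> : I (fun x => f0 x ^+ 2) - I g =
    (I (fun x => f0 x ^+ 2) / 2 - I g) + I (fun x => f0 x ^+ 2) / 2 by field.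
have e10' : 0 < Num.min e1 1 by rewrite lt_min e10 ltr01.
have CZ0 : 0 <= C * Z by rewrite mulr_ge0.
apply: (second_order_product Zgt0 CZ0 e10') => e /andP[e0].
rewrite le_min => /andP[ee1 e_1].
have mexp (a b : T -> R) : measurable_fun setT a -> measurable_fun setT b ->
    measurable_fun setT (fun x => expR (e * a x - e ^+ 2 * b x)).
  move=> ma mb; apply: measurableT_comp => //.
  by apply: measurable_funB; apply: measurable_funM.
have bexp (a b : T -> R) x : `|a x| <= M0 -> 0 <= b x <= M0 ->
    `|expR (e * a x - e ^+ 2 * b x)| <= expR M0.
  move=> aM /andP[b0 bM]; rewrite ger0_norm ?expR_ge0// ler_expR.
  have : a x <= M0 by apply: le_trans (ler_norm _) aM.
  have : 0 <= e ^+ 2 * b x by rewrite mulr_ge0// sqr_ge0.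
  nra.
pose u x := expR (e * f0 x - e ^+ 2 * g x).
pose v x := expR (e * - f0 x - e ^+ 2 * 0).
have lowb (a b : T -> R) : measurable_fun setT a -> measurable_fun setT b ->
    (forall x, rho x != 0 -> `|a x| <= M0) ->
    (forall x, rho x != 0 -> 0 <= b x <= M0) -> I a = 0 ->
    Z + e ^+ 2 * (I (fun x => a x ^+ 2) / 2 - I b) - C * Z * e ^+ 3 <=
      I (fun x => expR (e * a x - e ^+ 2 * b x)).
  move=> ma mb aM bM Ia.
  have bM' x : rho x != 0 -> `|b x| <= M0 by move=> /bM/andP[? ?]; rewrite ger0_norm.
  have a2M x : rho x != 0 -> `|a x ^+ 2| <= M0 ^+ 2.
    by move=> r0; rewrite normrX lerXn2r ?nnegrE ?aM.
  have ma2 : measurable_fun setT (fun x => a x ^+ 2) by exact: measurable_funX.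
  pose k := 1 - C * e ^+ 3.
  have cstI r : I (cst r) = r * Z.
    rewrite -(IZ (cst 1) r 1)//; last by move=> x _; rewrite normr1.
    by congr I; apply/funext => x; rewrite /= mulr1.
  have -> : Z + e ^+ 2 * (I (fun x => a x ^+ 2) / 2 - I b) - C * Z * e ^+ 3 =
      I (fun x => (cst k x + e * a x) + (e ^+ 2 / 2 * a x ^+ 2 + - e ^+ 2 * b x)).
    have m1 : measurable_fun setT (fun x => e * a x) by exact: measurable_funM.
    have m2 : measurable_fun setT (fun x => e ^+ 2 / 2 * a x ^+ 2) by exact: measurable_funM.
    have m3 : measurable_fun setT (fun x => - e ^+ 2 * b x) by exact: measurable_funM.
    have b1 x : rho x != 0 -> `|e * a x| <= `|e| * M0.
      by move=> r0; rewrite normrM ler_wpM2l// aM.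
    have b2 x : rho x != 0 -> `|e ^+ 2 / 2 * a x ^+ 2| <= `|e ^+ 2 / 2| * M0 ^+ 2.
      by move=> r0; rewrite normrM ler_wpM2l// a2M.
    have b3 x : rho x != 0 -> `|- e ^+ 2 * b x| <= `|- e ^+ 2| * M0.
      by move=> r0; rewrite normrM ler_wpM2l// bM'.
    rewrite (ID _ _ (`|k| + `|e| * M0) (`|e ^+ 2 / 2| * M0 ^+ 2 + `|- e ^+ 2| * M0)).
    - rewrite (ID (cst k) _ `|k| _ (measurable_cst _) m1 (fun x _ => lexx `|k|) b1).
      rewrite (ID _ _ _ _ m2 m3 b2 b3) (IZ a e M0)// (IZ b _ M0)//.
      by rewrite (IZ (fun x => a x ^+ 2) _ (M0 ^+ 2))// cstI Ia /k; field.
    - exact: measurable_funD.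
    - exact: measurable_funD.
    - by move=> x r0; rewrite (le_trans (ler_normD _ _))// lerD2l b1.
    - by move=> x r0; rewrite (le_trans (ler_normD _ _))// lerD// ?b2 ?b3.
  apply: le_Rintegral => //.
  - apply: (@integrable_bounded_density _ _ _ _ _ (`|k| + `|e| * M0 + (`|e ^+ 2 / 2| * M0 ^+ 2 + `|- e ^+ 2| * M0))) => //.
      by apply: measurable_funD; apply: measurable_funD => //; exact: measurable_funM.
    move=> x r0; rewrite (le_trans (ler_normD _ _))// lerD// (le_trans (ler_normD _ _))//.
      by rewrite lerD2l normrM ler_wpM2l// aM.
    by rewrite lerD// normrM ler_wpM2l ?a2M ?bM'.
  - apply: (@integrable_bounded_density _ _ _ _ _ (expR M0)) => //; first exact: mexp.
    by move=> x r0; apply: bexp; [exact: aM|exact: bM].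
  move=> x _; have [->|r0] := eqVneq (rho x) 0; first by rewrite !mulr0.
  rewrite ler_wpM2r//; have := expC e (a x) (b x) _ (aM x r0) (bM x r0).
  rewrite e0 e_1 => /(_ isT); apply: le_trans; rewrite /k /=.
  by rewrite le_eqVlt; apply/orP; left; apply/eqP; field.
exists (I u), (I v); split.
- exact: lowb.
- have := lowb (fun x => - f0 x) (cst 0) _ _ _ _ _.
  rewrite (_ : I (fun x => - f0 x) = 0); last first.
    by rewrite -[RHS](mulr0 (-1)) -If0 -(IZ f0 (-1) M0)//; congr I; apply/funext => x; rewrite mulN1r.
  rewrite (_ : I (cst 0) = 0); last first.
    by rewrite -[RHS](mul0r Z) -(IZ (cst 1) 0 1)//; [congr I; apply/funext => x; rewrite /= mul0r|move=> x _; rewrite normr1].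
  rewrite subr0 (_ : (fun x => (- f0 x) ^+ 2) = (fun x => f0 x ^+ 2)); last by apply/funext => x; rewrite sqrrN.
  apply => //.
  + exact: measurableT_comp.
  + by move=> x r0; rewrite normrN f0M.
  + by move=> x r0; rewrite lexx M00.
- have := H e; rewrite e0 ee1 => /(_ isT).
  have -> : (\int[mu]_x (rho x * expR (e * f x - e ^+ 2 * g x))%:E = (expR (e * c) * I u)%:E)%E.
    rewrite -(IZ u _ (expR M0)); last 2 first.
    + exact: mexp.
    + by move=> x r0; apply: bexp; [exact: f0M|exact: gM0].
    rewrite -(IE _ (expR (e * c) * expR M0)); last 2 first.
    + by apply: measurable_funM => //; exact: mexp.
    + move=> x r0; rewrite normrM (ger0_norm (expR_ge0 _)) ler_wpM2l ?expR_ge0//.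
      by apply: bexp; [exact: f0M|exact: gM0].
    apply: eq_integral => x _; congr EFin; rewrite /u -expRD mulrC; congr (expR _ * _).
    by rewrite /f0; ring.
  have mNf0 : measurable_fun setT (fun x => - f0 x) by exact: measurableT_comp.
  have -> : (\int[mu]_x (rho x * expR (- (e * f x)))%:E = (expR (- (e * c)) * I v)%:E)%E.
    rewrite -(IZ v _ (expR M0)); last 2 first.
    + exact: (mexp (fun x => - f0 x) (cst 0)).
    + by move=> x r0; apply: (bexp (fun x => - f0 x) (cst 0)); rewrite ?normrN ?f0M//= lexx.
    rewrite -(IE _ (expR (- (e * c)) * expR M0)); last 2 first.
    + by apply: measurable_funM => //; exact: (mexp (fun x => - f0 x) (cst 0)).
    + move=> x r0; rewrite normrM (ger0_norm (expR_ge0 _)) ler_wpM2l ?expR_ge0//.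
      by apply: (bexp (fun x => - f0 x) (cst 0)); rewrite ?normrN ?f0M//= lexx.
    apply: eq_integral => x _; congr EFin; rewrite /v -expRD mulrC; congr (expR _ * _).
    by rewrite /f0; ring.
  rewrite ZE -!EFinM lee_fin mulrACA expRxMexpNx_1 mul1r -expr2.
  exact.
Qed.

End linearization.

Section weighted_poincare.
Context {R : realType}.

Lemma norm2_sqr n (x : 'rV[R]_n) : norm2 x ^+ 2 = \sum_i x 0 i ^+ 2.
Proof. by rewrite sqr_sqrtr// sumr_ge0// => i _; rewrite sqr_ge0. Qed.

Definition dotrV n (x y : 'rV[R]_n) : R := \sum_i x 0 i * y 0 i.

Definition in_box (K : R) n (x : 'rV[R]_n) : Prop := forall i, `|x 0 i| <= K.

(* [G] is the gradient of [f] on a box, with a uniform quadratic Taylor bound;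
   unlike smoothness, this passes to averages over some of the coordinates. *)
Definition tame (K : R) n (f : 'rV[R]_n -> R) (G : 'rV[R]_n -> 'rV[R]_n) : Prop :=
  [/\ measurable_fun setT f,
      forall i, measurable_fun setT (fun x => G x 0 i) &
      exists M, forall x, in_box K x ->
        [/\ `|f x| <= M, forall i, `|G x 0 i| <= M &
         forall y, in_box K y ->
           `|f y - f x - dotrV (G x) (y - x)| <= M * norm2 (y - x) ^+ 2]].

(** The free centre [c] replaces the mean, which minimises the left side anyway. No normalisation of
    [w] enters, and a pointwise comparison of weights can keep the same [c]. *)
Definition weighted_poincare (K : R) n (w : 'rV[R]_n -> R) (C : R) : Prop :=
  forall f G, tame K f G -> exists c,
    (\int[lebesgue_rV n]_x ((f x - c) ^+ 2 * w x)%:E <=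
     C%:E * \int[lebesgue_rV n]_x (norm2 (G x) ^+ 2 * w x)%:E)%E.

Lemma measurable_norm2_sqr d (T : measurableType d) n (G : T -> 'rV[R]_n) :
  (forall i, measurable_fun setT (fun x => G x 0 i)) ->
  measurable_fun setT (fun x => norm2 (G x) ^+ 2).
Proof.
move=> mG; under eq_fun do rewrite norm2_sqr.
by apply: measurable_sum => i; exact: measurable_funX.
Qed.

(** For [s > 1 / kappa] the exponential inequality is tested with [g = s |grad f| ^ 2]. Completing
    the square leaves [|x - y| ^ 2 / (4 s)]; the gap to [kappa / 4 |x - y| ^ 2] pays for the
    quadratic Taylor error of [f]. Then [s] tends to [1 / kappa]. *)
Lemma weighted_poincare_midpoint n (K kappa : R) (rho : 'rV[R]_n -> R) :
  0 < kappa -> measurable_fun setT rho -> (forall x, 0 <= rho x) ->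
  (forall x, rho x != 0 -> in_box K x) ->
  (\int[lebesgue_rV n]_x (rho x)%:E < +oo)%E ->
  (forall x y, rho x * rho y * expR (kappa / 4 * norm2 (x - y) ^+ 2) <=
     rho (2^-1 *: (x + y)) ^+ 2) ->
  weighted_poincare K rho kappa^-1.
Proof.
move=> k0 mrho rho0 rhoK rhoy mid f G [mf mG [M HM]].
pose mu := @lebesgue_rV R n.
have mg := measurable_norm2_sqr mG.
pose M0 := `|M| + 1.
have M00 : 0 < M0 by rewrite ltr_pwDr.
have MM0 : M <= M0 by rewrite /M0 (le_trans (ler_norm M))// lerDl.
have gM x : rho x != 0 -> 0 <= norm2 (G x) ^+ 2 <= n%:R * M0 ^+ 2.
  move=> r0; rewrite sqr_ge0/= norm2_sqr.
  apply: (@le_trans _ _ (\sum_(i < n) M0 ^+ 2)).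
    apply: ler_sum => i _; rewrite -real_normK ?num_real// lerXn2r ?nnegrE// ?(ltW M00)//.
    have [_ h _] := HM x (rhoK x r0); exact: le_trans (h i) MM0.
  by rewrite sumr_const card_ord mulr_natl.
pose c := \int[mu]_y (f y * rho y) / \int[mu]_y rho y.
exists c.
have main s : kappa^-1 < s -> (\int[mu]_x ((f x - c) ^+ 2 * rho x)%:E <=
    s%:E * \int[mu]_x (norm2 (G x) ^+ 2 * rho x)%:E)%E.
  move=> ks; have kV0 : 0 < kappa^-1 by rewrite invr_gt0.
  have s0 : 0 < s by exact: lt_trans ks.
  (* This is the largest [e] with [e M0 + 1 / (4 s) <= kappa / 4]: the Taylor error still fits into
     the strong concavity. *)
  pose e1 := (kappa - s^-1) / (4 * M0).
  have e10 : 0 < e1.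
    by rewrite divr_gt0 ?mulr_gt0// subr_gt0 invf_plt ?posrE.
  have Ms0 : 0 <= s * (n%:R * M0 ^+ 2).
    by rewrite mulr_ge0 ?(ltW s0)// mulr_ge0// sqr_ge0.
  rewrite -ge0_integralZl_EFin//; last 3 first.
  - by move=> x _; rewrite lee_fin mulr_ge0// sqr_ge0.
  - by apply/measurable_EFinP; exact: measurable_funM.
  - exact: ltW.
  rewrite (eq_integral (fun x => (s * norm2 (G x) ^+ 2 * rho x)%:E)); last first.
    by move=> x _; rewrite -EFinM mulrA.
  apply: (@variance_le_of_exponential _ _ _ mu rho f (fun x => s * norm2 (G x) ^+ 2)
    (M0 + s * (n%:R * M0 ^+ 2)) e1) => //.
  - exact: measurable_funM.
  - move=> x r0; have [h _ _] := HM x (rhoK x r0).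
    by rewrite (le_trans h)// (le_trans MM0)// lerDl.
  - move=> x r0; rewrite mulr_ge0 ?sqr_ge0 ?(ltW s0)//=.
    have /andP[_ h] := gM x r0.
    have : s * norm2 (G x) ^+ 2 <= s * (n%:R * M0 ^+ 2) by rewrite ler_wpM2l// ltW.
    by lra.
  move=> e /andP[e0 ee1].
  apply: (@prekopa_leindler _ n (fun x => (rho x * expR (e * f x - e ^+ 2 * (s * norm2 (G x) ^+ 2)))%:E)
    (fun x => (rho x * expR (- (e * f x)))%:E) (fun x => (rho x)%:E)).
  - apply/measurable_EFinP; apply: measurable_funM => //; apply: measurableT_comp => //.
    by apply: measurable_funB; apply: measurable_funM => //; exact: measurable_funM.
  - apply/measurable_EFinP; apply: measurable_funM => //; apply: measurableT_comp => //.
    by apply: measurableT_comp => //; exact: measurable_funM.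
  - exact/measurable_EFinP.
  - by move=> x; rewrite lee_fin mulr_ge0// expR_ge0.
  - by move=> x; rewrite lee_fin mulr_ge0// expR_ge0.
  - by move=> x; rewrite lee_fin.
  move=> x y; rewrite -!EFinM lee_fin -expr2.
  have [->|rx] := eqVneq (rho x) 0; first by rewrite !mul0r sqr_ge0.
  have [->|ry] := eqVneq (rho y) 0; first by rewrite mul0r mulr0 sqr_ge0.
  apply: le_trans (mid x y); rewrite mulrACA -expRD ler_wpM2l ?mulr_ge0// ler_expR.
  have [_ _ tay] := HM x (rhoK x rx).
  have := tay y (rhoK y ry).
  have -> : norm2 (y - x) ^+ 2 = norm2 (x - y) ^+ 2.
    by rewrite !norm2_sqr; apply: eq_bigr => i _; rewrite !mxE -sqrrN opprB.
  have D0 := sqr_ge0 (norm2 (x - y)); set D := norm2 (x - y) ^+ 2 in D0 *.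
  rewrite ler_norml => /andP[tl _].
  have {}tl : f x - f y <= - dotrV (G x) (y - x) + M0 * D.
    have : M * D <= M0 * D by rewrite ler_wpM2r.
    lra.
  (* AM-GM: [e G_i d_i <= e^2 s G_i^2 + d_i^2 / (4 s)] *)
  have amgm : e * - dotrV (G x) (y - x) <= e ^+ 2 * (s * norm2 (G x) ^+ 2) + D / (4 * s).
    rewrite /D !norm2_sqr /dotrV -sumrN mulr_sumr mulr_suml 2!mulr_sumr -big_split/=.
    apply: ler_sum => i _; rewrite !mxE.
    rewrite -subr_ge0 (_ : _ - _ = (2 * s * e * G x 0 i - (x 0 i - y 0 i)) ^+ 2 / (4 * s)).
      by rewrite divr_ge0 ?sqr_ge0// mulr_ge0// ltW.
    by field; rewrite gt_eqF.
  have ebound : e * M0 * 4 <= kappa - s^-1.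
    by move: ee1; rewrite /e1 ler_pdivlMr ?mulr_gt0//; lra.
  have {}tl : e * (f x - f y) <= e * - dotrV (G x) (y - x) + e * (M0 * D).
    by rewrite -mulrDr ler_wpM2l// ltW.
  have : D * (e * M0 * 4) <= D * (kappa - s^-1) by rewrite ler_wpM2l.
  move: amgm; rewrite (_ : D / (4 * s) = D * s^-1 / 4); last by rewrite invfM; ring.
  lra.
have gfin : (\int[mu]_x (norm2 (G x) ^+ 2 * rho x)%:E)%E \is a fin_num.
  apply: integrable_fin_num => //.
  apply: (@integrable_bounded_density _ _ _ _ _ _ (n%:R * M0 ^+ 2)) => // x r0.
  by have /andP[? ?] := gM x r0; rewrite ger0_norm.
(* Letting [s] decrease to [1 / kappa] is legitimate because the gradient integral is finite;
   [B + 1] guards against [B = 0]. *)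
rewrite -/mu -(fineK gfin); apply/lee_addgt0Pr => e e0.
set B := fine _.
have B0 : 0 <= B by apply: fine_ge0; apply: integral_ge0 => x _; rewrite lee_fin mulr_ge0 ?sqr_ge0.
have d0 : 0 < e / (B + 1) by rewrite divr_gt0// ltr_wpDl.
apply: (le_trans (main (kappa^-1 + e / (B + 1)) _)); first by rewrite ltrDl.
rewrite -(fineK gfin) -/B -EFinM -EFinD lee_fin mulrDl lerD2l.
by rewrite mulrAC ler_pdivrMr ?ltr_wpDl// ler_wpM2l ?(ltW e0)// lerDl.
Qed.

End weighted_poincare.

(** * One-dimensional factors *)

Section exponential_weight.
Context {R : realType}.
Local Notation lam := (@lebesgue_measure R).

Lemma is_derive_of_remainder (f : R -> R) (x d M e : R) : 0 < e ->
  (forall h, `|h| < e -> `|f (x + h) - f x - d * h| <= M * h ^+ 2) ->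
  is_derive x 1 f d.
Proof.
move=> e0 H.
have cv : (fun h => h^-1 *: (f (h *: 1 + x) - f x)) @ 0^' --> d.
  apply/cvgrPdist_le => /= eps eps0; near=> h.
  have h0 : h != 0 by near: h; exact: nbhs_dnbhs_neq.
  have he : `|h| < e.
    by near: h; apply: dnbhs0_lt.
  have hM : `|h| < eps / (`|M| + 1).
    by near: h; apply: dnbhs0_lt; rewrite divr_gt0// ltr_wpDl.
  rewrite /GRing.scale /= mulr1 (addrC h).
  have -> : d - h^-1 * (f (x + h) - f x) = - (h^-1 * (f (x + h) - f x - d * h)).
    by field.
  rewrite normrN normrM normfV ler_pdivrMl ?normr_gt0//.
  apply: (le_trans (H h he)).
  apply: (@le_trans _ _ ((`|M| + 1) * `|h| ^+ 2)).
    by rewrite real_normK ?num_real// ler_wpM2r ?sqr_ge0// (le_trans (ler_norm M))// lerDl.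
  rewrite expr2 mulrA mulrC ler_wpM2l// mulrC.
  by move/ltW: hM; rewrite ler_pdivlMr ?ltr_wpDl// mulrC.
by split; [apply/cvg_ex; exists d|exact: cvg_lim].
Unshelve. all: by end_near. Qed.

Variables (K M : R) (f g : R -> R).
Hypothesis tay : forall x y, `|x| <= K -> `|y| <= K ->
  `|f y - f x - g x * (y - x)| <= M * (y - x) ^+ 2.

Let in_nbhs (x h : R) : `|x| < K -> `|h| < K - `|x| -> `|x + h| <= K.
Proof. by move=> xK hK; rewrite (le_trans (ler_normD _ _))//; lra. Qed.

Lemma tame1_is_derive (x : R) : `|x| < K -> is_derive x 1 f (g x).
Proof.
move=> xK; apply: (@is_derive_of_remainder _ _ _ M (K - `|x|)); first by rewrite subr_gt0.
move=> h hK; have := @tay x (x + h) (ltW xK) (in_nbhs xK hK).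
by rewrite (_ : x + h - x = h)//; ring.
Qed.

(** Adding the Taylor bounds based at [x] and at [y] eliminates [f] and leaves
    [|g x - g y| |x - y| <= 2 M |x - y| ^ 2], so [g] is Lipschitz. *)
Lemma tame1_continuous (x : R) : `|x| < K -> {for x, continuous g}.
Proof.
move=> xK; apply/cvgrPdist_le => /= e e0; near=> y.
have yK : `|y| <= K.
  have -> : y = x + (y - x) by ring.
  apply: in_nbhs => //; rewrite distrC; near: y.
  by apply: cvgr_dist_lt => //; rewrite subr_gt0.
have yM : `|x - y| < e / (2 * (`|M| + 1)).
  by near: y; apply: cvgr_dist_lt => //; rewrite divr_gt0// mulr_gt0// ltr_wpDl.
have [->|xy] := eqVneq x y; first by rewrite subrr normr0 ltW.
have d0 : 0 < `|x - y| by rewrite normr_gt0 subr_eq0.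
rewrite -(ler_pM2r d0) -normrM.
have h1 := tay (ltW xK) yK; have h2 := tay yK (ltW xK).
have -> : (g x - g y) * (x - y) =
   (f y - f x - g x * (y - x)) + (f x - f y - g y * (x - y)) by ring.
rewrite (le_trans (ler_normD _ _))//.
have e1 : (y - x) ^+ 2 = `|x - y| ^+ 2 by rewrite real_normK ?num_real// -sqrrN opprB.
have e2 : (x - y) ^+ 2 = `|x - y| ^+ 2 by rewrite real_normK ?num_real.
rewrite e1 in h1; rewrite e2 in h2.
have MM : M * `|x - y| ^+ 2 <= (`|M| + 1) * `|x - y| ^+ 2.
  by rewrite ler_wpM2r ?sqr_ge0// (le_trans (ler_norm M))// lerDl.
have : 2 * (`|M| + 1) * `|x - y| <= e.
  by move/ltW: yM; rewrite ler_pdivlMr ?mulr_gt0 ?ltr_wpDl// mulrC.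
rewrite -(ler_pM2r d0) => h3; rewrite expr2 in h1 h2 MM; nra.
Unshelve. all: by end_near. Qed.

(** Integrate the derivative of [H = (f - f 0) ^ 2 exp (- a x)]: the boundary term vanishes at 0 and
    is nonnegative at [L], so [a int H <= int 2 (f - f 0) g exp (- a x)]. AM-GM with weights [2 / a]
    and [a / 2] absorbs half of the left side and leaves the constant [4 / a ^ 2]. *)
Lemma hardy_exponential (L a : R) : 0 < L < K -> 0 < a ->
  (\int[lam]_(x in `[0%R, L]) ((f x - f 0) ^+ 2 * expR (- (a * x)))%:E <=
   (4 / a ^+ 2)%:E * \int[lam]_(x in `[0%R, L]) (g x ^+ 2 * expR (- (a * x)))%:E)%E.
Proof.
move=> /andP[L0 LK] a0.
(* The strict inequality [L < K] makes the derivatives two-sided even at the endpoints 0 and [L]. *)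
have inK x : x \in `[0%R, L] -> `|x| < K.
  by rewrite in_itv/= => /andP[x0 xL]; rewrite ger0_norm// (le_lt_trans xL).
pose E x := expR (- (a * x)).
pose H x := (f x - f 0) ^+ 2 * E x.
pose dH x := 2 * (f x - f 0) * g x * E x - a * H x.
pose Q x := g x ^+ 2 * E x.
have dE (x : R) : is_derive x 1 E (- a * E x).
  by apply: is_derive_eq; rewrite /GRing.scale /= /E; ring.
have dHP x : x \in `[0%R, L] -> is_derive x 1 H (dH x).
  move=> /inK/tame1_is_derive df.
  by apply: is_derive_eq; rewrite /dH /H /GRing.scale /=; ring.
have cE : continuous E.
  by move=> x; apply/differentiable_continuous/derivable1_diffP; exact: ex_derive.
have cf x : x \in `[0%R, L] -> {for x, continuous f}.
  move=> /inK/tame1_is_derive df.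
  by apply/differentiable_continuous/derivable1_diffP; exact: ex_derive.
have cg x : x \in `[0%R, L] -> {for x, continuous g}.
  by move=> /inK/tame1_continuous.
have cff x : x \in `[0%R, L] -> {for x, continuous (fun y => f y - f 0)}.
  by move=> xL; apply: cvgB; [exact: cf|exact: cvg_cst].
have cH x : x \in `[0%R, L] -> {for x, continuous H}.
  by move=> xL; apply: cvgM; [apply: cvgM; exact: cff|exact: cE].
have cQ x : x \in `[0%R, L] -> {for x, continuous Q}.
  by move=> xL; apply: cvgM; [apply: cvgM; exact: cg|exact: cE].
have cdH x : x \in `[0%R, L] -> {for x, continuous dH}.
  move=> xL; apply: cvgB; last by apply: cvgM; [exact: cvg_cst|exact: cH].
  apply: cvgM; last exact: cE.
  apply: cvgM; last exact: cg.
  by apply: cvgM; [exact: cvg_cst|exact: cff].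
have cZ (k : R) (h : R -> R) : (forall x, x \in `[0%R, L] -> {for x, continuous h}) ->
    forall x, x \in `[0%R, L] -> {for x, continuous (fun y => k * h y)}.
  by move=> hc x xL; apply: cvgM; [exact: cvg_cst|exact: hc].
have within (h : R -> R) : (forall x, x \in `[0%R, L] -> {for x, continuous h}) ->
    {within `[0%R, L], continuous h}.
  by move=> hc; apply: continuous_in_subspaceT => x; rewrite inE; exact: hc.
have intg (h : R -> R) : (forall x, x \in `[0%R, L] -> {for x, continuous h}) ->
    lam.-integrable `[0%R, L] (EFin \o h).
  move=> hc; apply: continuous_compact_integrable; first exact: segment_compact.
  exact: within.
have FTC : (\int[lam]_(x in `[0%R, L]) (dH x)%:E = (H L)%:E - (H 0)%:E)%E.
  apply: continuous_FTC2 => //.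
  - exact: within.
  - split.
    + move=> x /subset_itv_oo_cc xL; have := dHP x xL => hd; exact: ex_derive.
    + apply: cvg_at_right_filter; apply: cH; by rewrite in_itv/= lexx ltW.
    + apply: cvg_at_left_filter; apply: cH; by rewrite in_itv/= lexx ltW.
  - move=> x /subset_itv_oo_cc xL; have := dHP x xL => hd.
    by rewrite derive1E; exact: derive_val.
have iH := intg _ cH; have iQ := intg _ cQ; have idH := intg _ cdH.
have pos : 0 <= \int[lam]_(x in `[0%R, L]) dH x.
  rewrite /Rintegral FTC /= {2}/H subrr expr0n/= mul0r subr0.
  by rewrite mulr_ge0 ?sqr_ge0// expR_ge0.
have le : \int[lam]_(x in `[0%R, L]) dH x <=
    \int[lam]_(x in `[0%R, L]) (2 / a * Q x - a / 2 * H x).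
  apply: le_Rintegral => //.
    by apply: intg => x xL; apply: cvgB; exact: cZ.
  move=> x _; rewrite -subr_ge0 /dH /H /Q.
  rewrite (_ : _ - _ = (2 * g x - a * (f x - f 0)) ^+ 2 * E x / (2 * a)).
    apply: divr_ge0; last by rewrite mulr_ge0// ltW.
    by apply: mulr_ge0; [exact: sqr_ge0|exact: expR_ge0].
  by field; rewrite gt_eqF.
have rE : \int[lam]_(x in `[0%R, L]) (2 / a * Q x - a / 2 * H x) =
    2 / a * \int[lam]_(x in `[0%R, L]) Q x - a / 2 * \int[lam]_(x in `[0%R, L]) H x.
  rewrite RintegralB ?RintegralZl//.
    exact: (intg _ (cZ _ _ cQ)).
  exact: (intg _ (cZ _ _ cH)).
rewrite rE in le.
have fH : (\int[lam]_(x in `[0%R, L]) (H x)%:E)%E \is a fin_num.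
  exact: integrable_fin_num iH.
have fQ : (\int[lam]_(x in `[0%R, L]) (Q x)%:E)%E \is a fin_num.
  exact: integrable_fin_num iQ.
rewrite -/(H _) -(fineK fH) -(fineK fQ) -EFinM lee_fin.
have {le} := le_trans pos le.
rewrite subr_ge0 -ler_pdivlMl ?divr_gt0//.
move=> h; apply: (le_trans h); rewrite le_eqVlt; apply/orP; left; apply/eqP.
by rewrite /Rintegral; field; rewrite gt_eqF.
Qed.

End exponential_weight.

Section poincare1.
Context {R : realType}.
Local Notation lam := (@lebesgue_measure R).

Definition tame1 (K : R) (f g : R -> R) : Prop :=
  [/\ measurable_fun setT f, measurable_fun setT g &
   exists M, forall x, `|x| <= K ->
     [/\ `|f x| <= M, `|g x| <= M &
      forall y, `|y| <= K -> `|f y - f x - g x * (y - x)| <= M * (y - x) ^+ 2]].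

Definition weighted_poincare1 (K : R) (v : R -> R) (C : R) : Prop :=
  forall f g, tame1 K f g -> exists c,
    (\int[lam]_x ((f x - c) ^+ 2 * v x)%:E <=
     C%:E * \int[lam]_x (g x ^+ 2 * v x)%:E)%E.

(** The Hardy inequality is anchored at [f 0], which is therefore the centre. Replacing the
    exponential by [v] costs [B] on the left and [1 / m] on the right. *)
Lemma weighted_poincare1_exponential (K L a m B : R) (v : R -> R) :
  0 < L < K -> 0 < a -> 0 < m -> measurable_fun setT v ->
  (forall x, ~~ (0 <= x <= L) -> v x = 0) ->
  (forall x, 0 <= x <= L -> m * expR (- (a * x)) <= v x <= B * expR (- (a * x))) ->
  weighted_poincare1 K v (4 * B / (a ^+ 2 * m)).
Proof.
move=> LK a0 m0 mv v0 vb f g [mf mg [M HM]]; exists (f 0).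
have mB : m <= B.
  have h0 : 0 <= (0 : R) <= L by rewrite lexx ltW//; case/andP: LK.
  have := vb 0 h0; rewrite mulr0 oppr0 expR0 !mulr1 => /andP[].
  exact: le_trans.
have B0 : 0 <= B by rewrite (le_trans _ mB)// ltW.
pose E x := expR (- (a * x)).
have mE : measurable_fun setT E.
  by apply: measurableT_comp => //; apply: measurableT_comp => //; exact: measurable_funM.
have toitv (h : R -> R) : (\int[lam]_x (h x * v x)%:E = \int[lam]_(x in `[0%R, L]) (h x * v x)%:E)%E.
  rewrite [RHS]integral_mkcond; apply: eq_integral => x _; rewrite patchE.
  by case: ifPn => //; rewrite notin_setE /= in_itv/= => /negP/v0 ->; rewrite mulr0.
have vge0 x : x \in `[0, L] -> 0 <= v x.
  rewrite in_itv/= => /vb/andP[+ _]; apply: le_trans.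
  by rewrite mulr_ge0 ?expR_ge0// ltW.
have tay x y : `|x| <= K -> `|y| <= K -> `|f y - f x - g x * (y - x)| <= M * (y - x) ^+ 2.
  by move=> xK yK; have [_ _] := HM x xK; exact.
have mff : measurable_fun setT (fun x => (f x - f 0) ^+ 2).
  by apply: measurable_funX; apply: measurable_funB.
have mgg : measurable_fun setT (fun x => g x ^+ 2) by exact: measurable_funX.
rewrite !toitv.
apply: (@le_trans _ _ (B%:E * \int[lam]_(x in `[0%R, L]) ((f x - f 0) ^+ 2 * E x)%:E)%E).
  rewrite -ge0_integralZl_EFin//; last 2 first.
  - by move=> x _; rewrite lee_fin mulr_ge0 ?sqr_ge0// expR_ge0.
  - by apply/measurable_EFinP; apply: measurable_funTS; exact: measurable_funM.
  apply: ge0_le_integral => //.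
  - by move=> x xL; rewrite lee_fin mulr_ge0 ?sqr_ge0// vge0.
  - by apply/measurable_EFinP; apply: measurable_funTS; exact: measurable_funM.
  - apply/measurable_EFinP; apply: measurable_funTS; apply: measurable_funM => //.
    exact: measurable_funM.
  move=> x /=; rewrite in_itv/= => /vb/andP[_ h].
  by rewrite -EFinM lee_fin mulrCA ler_wpM2l// sqr_ge0.
have H := hardy_exponential tay LK a0.
apply: (@le_trans _ _ (B%:E * ((4 / a ^+ 2)%:E * \int[lam]_(x in `[0%R, L]) (g x ^+ 2 * E x)%:E))%E).
  by rewrite lee_wpmul2l// lee_fin.
have -> : ((4 * B / (a ^+ 2 * m))%:E * \int[lam]_(x in `[0%R, L]) (g x ^+ 2 * v x)%:E =
    B%:E * ((4 / a ^+ 2)%:E * (m^-1%:E * \int[lam]_(x in `[0%R, L]) (g x ^+ 2 * v x)%:E)))%E.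
  by rewrite !muleA -!EFinM; congr (_%:E * _)%E; field; rewrite !gt_eqF.
rewrite lee_wpmul2l ?lee_fin// lee_wpmul2l ?lee_fin ?divr_ge0 ?sqr_ge0//.
rewrite -ge0_integralZl_EFin//; last 3 first.
- by move=> x xL; rewrite lee_fin mulr_ge0 ?sqr_ge0// vge0.
- by apply/measurable_EFinP; apply: measurable_funTS; exact: measurable_funM.
- by rewrite invr_ge0 ltW.
apply: ge0_le_integral => //.
- by move=> x xL; rewrite lee_fin mulr_ge0 ?sqr_ge0// expR_ge0.
- by apply/measurable_EFinP; apply: measurable_funTS; exact: measurable_funM.
- apply/measurable_EFinP; apply: measurable_funTS; apply: measurable_funM => //.
  exact: measurable_funM.
move=> x /=; rewrite in_itv/= => /vb/andP[h _].
rewrite -EFinM lee_fin mulrCA ler_wpM2l ?sqr_ge0//.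
by rewrite ler_pdivlMl.
Qed.

End poincare1.

(** * Tensorization *)

Section weighted_mean.
Context {R : realType} d (T : measurableType d) (mu : {measure set T -> \bar R}).
Variable v : T -> R.
Hypotheses (mv : measurable_fun setT v) (v0 : forall x, 0 <= v x).
Hypotheses (v_gt0 : (0 < \int[mu]_x (v x)%:E)%E) (v_fin : (\int[mu]_x (v x)%:E < +oo)%E).

Let A : R := \int[mu]_x v x.

Definition wmean (h : T -> R) : R := \int[mu]_x (h x * v x) / \int[mu]_x v x.

Lemma wmass_EFin : (\int[mu]_x (v x)%:E)%E = A%:E.
Proof. by rewrite /A /Rintegral fineK// gt0_fin_numE. Qed.

Lemma wmass_gt0 : 0 < A.
Proof. by rewrite -lte_fin -wmass_EFin. Qed.

Let A0 := wmass_gt0.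

Lemma wmean_integral_EFin (h : T -> R) (M : R) : measurable_fun setT h ->
  (forall x, v x != 0 -> `|h x| <= M) ->
  (\int[mu]_x (h x * v x)%:E = (A * wmean h)%:E)%E.
Proof.
move=> mh hM; rewrite /wmean mulrC divfK ?gt_eqF//.
rewrite /Rintegral fineK//; apply: integrable_fin_num => //.
exact: (@integrable_bounded_density _ _ _ _ _ _ M).
Qed.

Lemma wmeanD (h1 h2 : T -> R) (M1 M2 : R) :
  measurable_fun setT h1 -> measurable_fun setT h2 ->
  (forall x, v x != 0 -> `|h1 x| <= M1) -> (forall x, v x != 0 -> `|h2 x| <= M2) ->
  wmean (fun x => h1 x + h2 x) = wmean h1 + wmean h2.
Proof.
move=> m1 m2 b1 b2; rewrite /wmean -mulrDl -RintegralD//.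
- by congr (_ / _); apply: eq_Rintegral => x _; rewrite mulrDl.
- exact: (@integrable_bounded_density _ _ _ _ _ _ M1).
- exact: (@integrable_bounded_density _ _ _ _ _ _ M2).
Qed.

Lemma wmeanZ (h : T -> R) (k M : R) :
  measurable_fun setT h -> (forall x, v x != 0 -> `|h x| <= M) ->
  wmean (fun x => k * h x) = k * wmean h.
Proof.
move=> mh hM; rewrite /wmean mulrA -RintegralZl//.
- by congr (_ / _); apply: eq_Rintegral => x _; rewrite mulrA.
- exact: (@integrable_bounded_density _ _ _ _ _ _ M).
Qed.

Lemma wmean_cst (k : R) : wmean (cst k) = k.
Proof.
have -> : cst k = (fun x => k * (cst 1 : T -> R) x) by apply/funext => x; rewrite /= mulr1.
rewrite (wmeanZ k (M := 1))//; last by move=> x _; rewrite normr1.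
rewrite /wmean (_ : \int[mu]_x (cst 1 x * v x) = A) ?divff ?mulr1 ?gt_eqF//.
by apply: eq_Rintegral => x _; rewrite mul1r.
Qed.

Lemma wmean_sum (I : Type) (r : seq I) (h : I -> T -> R) (M : I -> R) :
  (forall i, measurable_fun setT (h i)) ->
  (forall i x, v x != 0 -> `|h i x| <= M i) ->
  wmean (fun x => \sum_(i <- r) h i x) = \sum_(i <- r) wmean (h i).
Proof.
move=> mh hM; elim: r => [|i r IH].
  under eq_fun do rewrite big_nil; by rewrite (wmean_cst 0) big_nil.
under eq_fun do rewrite big_cons.
rewrite big_cons -IH (wmeanD (M1 := M i) (M2 := \sum_(j <- r) M j))//.
- exact: measurable_sum.
- exact: hM.
- move=> x vx; apply: le_trans (ler_norm_sum _ _ _) _.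
  by apply: ler_sum => j _; exact: hM.
Qed.

Lemma wmean_norm_le (h : T -> R) (M : R) : measurable_fun setT h ->
  (forall x, v x != 0 -> `|h x| <= M) -> `|wmean h| <= M.
Proof.
move=> mh hM; rewrite /wmean normrM normfV (gtr0_norm A0) ler_pdivrMr//.
have ih := @integrable_bounded_density _ _ _ mu _ _ M mv mh v0 v_fin hM.
apply: (le_trans (le_normr_Rintegral _ ih)) => //.
have iv : mu.-integrable setT (EFin \o v).
  have := @integrable_bounded_density _ _ _ mu v (cst 1) 1 mv (measurable_cst _) v0 v_fin.
  rewrite (_ : (fun x => cst 1 x * v x) = v); last by apply/funext => x; rewrite mul1r.
  by apply => x _; rewrite normr1.
rewrite -RintegralZl//; apply: le_Rintegral => //.
- exact: integrable_norm.
- by apply: (integrableZl _ M iv).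
move=> x _; rewrite normrM (ger0_norm (v0 x)).
by have [->|vx] := eqVneq (v x) 0; [rewrite !mulr0|rewrite ler_wpM2r// hM].
Qed.

(** Once the square is expanded, the centre enters only through [- 2 k wmean h + k ^ 2]. The
    identity splits variances over fibres, shows that the mean is the best centre and, at [c = 0],
    gives Jensen's inequality for squares. *)
Lemma wmean_bias_variance (h : T -> R) (M c : R) : measurable_fun setT h ->
  (forall x, v x != 0 -> `|h x| <= M) ->
  (\int[mu]_x ((h x - c) ^+ 2 * v x)%:E =
   \int[mu]_x ((h x - wmean h) ^+ 2 * v x)%:E + (A * (wmean h - c) ^+ 2)%:E)%E.
Proof.
move=> mh hM.
have expand k : (\int[mu]_x ((h x - k) ^+ 2 * v x)%:E =
    (A * (wmean (fun x => h x ^+ 2) - 2 * k * wmean h + k ^+ 2))%:E)%E.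
  have m2 : measurable_fun setT (fun x => (h x - k) ^+ 2).
    by apply: measurable_funX; apply: measurable_funB.
  have mh2 : measurable_fun setT (fun x => h x ^+ 2) by exact: measurable_funX.
  have mk : measurable_fun setT (fun x => - (2 * k) * h x) by exact: measurable_funM.
  have h2M x : v x != 0 -> `|h x ^+ 2| <= `|M| ^+ 2.
    by move=> vx; rewrite normrX lerXn2r ?nnegrE// (le_trans (hM x vx))// ler_norm.
  have hkM x : v x != 0 -> `|- (2 * k) * h x| <= `|- (2 * k)| * `|M|.
    by move=> vx; rewrite normrM ler_wpM2l// (le_trans (hM x vx))// ler_norm.
  rewrite (@wmean_integral_EFin _ ((`|M| + `|k|) ^+ 2))//; last first.
    move=> x vx; rewrite normrX lerXn2r ?nnegrE ?addr_ge0//.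
    by rewrite (le_trans (ler_normB _ _))// lerD2r (le_trans (hM x vx))// ler_norm.
  congr ((_ * _)%:E).
  rewrite (_ : (fun x => (h x - k) ^+ 2) =
    (fun x => h x ^+ 2 + (- (2 * k) * h x + cst (k ^+ 2) x))); last first.
    by apply/funext => x /=; ring.
  rewrite (wmeanD (M1 := `|M| ^+ 2) (M2 := `|- (2 * k)| * `|M| + `|k ^+ 2|))//.
  - rewrite (wmeanD (M1 := `|- (2 * k)| * `|M|) (M2 := `|k ^+ 2|))//.
    by rewrite (wmeanZ _ (M := M))// wmean_cst mulNr addrA.
  - exact: measurable_funD.
  - by move=> x vx; rewrite (le_trans (ler_normD _ _))// lerD// hkM.
by rewrite !expand -EFinD; congr EFin; ring.
Qed.

End weighted_mean.

Section tensor.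
Context {R : realType}.
Local Notation lam := (@lebesgue_measure R).

(** Tonelli gives measurability for nonnegative integrands; [h] may change sign here, so the
    positive and negative parts are treated apart. *)
Lemma measurable_Rintegral_fst d (T : measurableType d) (h : R * T -> R) :
  measurable_fun setT h -> measurable_fun setT (fun y => \int[lam]_s h (s, y)).
Proof.
move=> mh; apply: measurableT_comp => //.
have mE : measurable_fun setT (EFin \o h) by exact/measurable_EFinP.
rewrite (_ : (fun y => _) = (fun y => (\int[lam]_s ((EFin \o h)^\+ (s, y)) -
    \int[lam]_s ((EFin \o h)^\- (s, y))))%E); last first.
  apply/funext => y; rewrite integralE.
  by congr (_ - _)%E; apply: eq_integral => s _; rewrite ?funeposE ?funenegE.
apply: emeasurable_funB.
- exact: (@measurable_fun_fubini_tonelli_G _ _ _ T R lam _ (measurable_funepos mE)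
    (funepos_ge0 _)).
- exact: (@measurable_fun_fubini_tonelli_G _ _ _ T R lam _ (measurable_funeneg mE)
    (funeneg_ge0 _)).
Qed.

Lemma integral_lebesgue_rVS_swap n (f : 'rV[R]_n.+1 -> \bar R) :
  measurable_fun setT f -> (forall x, 0 <= f x)%E ->
  (\int[lebesgue_rV n.+1]_x f x =
   \int[lebesgue_rV n]_y \int[lam]_s f (consrV (s, y)))%E.
Proof.
move=> mf f0; rewrite integral_lebesgue_rVS//.
have mg : measurable_fun setT (f \o @consrV R n).
  by apply: measurableT_comp => //; exact: measurable_consrV.
exact: (@fubini_tonelli _ _ _ _ R lam (lebesgue_rV n) _ mg (fun x => f0 _)).
Qed.

Lemma measurable_integral_consrV_swap n (f : 'rV[R]_n.+1 -> \bar R) :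
  measurable_fun setT f -> (forall x, 0 <= f x)%E ->
  measurable_fun setT (fun y : 'rV[R]_n => \int[lam]_s f (consrV (s, y)))%E.
Proof.
move=> mf f0; have mg : measurable_fun setT (f \o @consrV R n).
  by apply: measurableT_comp => //; exact: measurable_consrV.
exact: (@measurable_fun_fubini_tonelli_G _ _ _ _ R lam _ mg (fun x => f0 _)).
Qed.

Definition tailrV n (x : 'rV[R]_n.+1) : 'rV[R]_n := \row_i x 0 (lift ord0 i).

Lemma tailrV_cons n s (y : 'rV[R]_n) : tailrV (consrV (s, y)) = y.
Proof. by apply/rowP => i; rewrite [LHS]mxE consrV_lift. Qed.

Lemma measurable_tailrV n : measurable_fun setT (@tailrV n).
Proof.
apply: measurable_fun_entryP => i j.
under eq_fun do rewrite mxE; exact: measurable_entry.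
Qed.

Lemma in_box_cons K n s (y : 'rV[R]_n) :
  `|s| <= K -> in_box K y -> in_box K (consrV (s, y)).
Proof.
move=> sK yK i; case: (unliftP ord0 i) => [j|] ->; last by rewrite consrV0.
by rewrite consrV_lift.
Qed.

Lemma norm2_sqr_tail n (x : 'rV[R]_n.+1) :
  norm2 x ^+ 2 = x 0 0 ^+ 2 + norm2 (tailrV x) ^+ 2.
Proof.
rewrite !norm2_sqr big_ord_recl; congr (_ + _).
by apply: eq_bigr => i _; rewrite mxE.
Qed.

Definition cons_weight n (v : R -> R) (U : 'rV[R]_n -> R) (x : 'rV[R]_n.+1) : R :=
  v (x 0 0) * U (tailrV x).

Lemma measurable_cons_weight n v (U : 'rV[R]_n -> R) :
  measurable_fun setT v -> measurable_fun setT U ->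
  measurable_fun setT (cons_weight v U).
Proof.
move=> mv mU; apply: measurable_funM.
  by apply: measurableT_comp => //; exact: measurable_entry.
by apply: measurableT_comp => //; exact: measurable_tailrV.
Qed.

Lemma cons_weightE n v (U : 'rV[R]_n -> R) s y :
  cons_weight v U (consrV (s, y)) = v s * U y.
Proof. by rewrite /cons_weight consrV0 tailrV_cons. Qed.

End tensor.

Section tensorization.
Context {R : realType}.
Local Notation lam := (@lebesgue_measure R).
Variables (n : nat) (K : R) (v : R -> R) (U : 'rV[R]_n -> R) (C : R).
Hypotheses (mv : measurable_fun setT v) (v0 : forall s, 0 <= v s).
Hypothesis vK : forall s, v s != 0 -> `|s| <= K.
Hypotheses (v_gt0 : (0 < \int[lam]_s (v s)%:E)%E) (v_fin : (\int[lam]_s (v s)%:E < +oo)%E).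
Hypotheses (mU : measurable_fun setT U) (U0 : forall y, 0 <= U y).
Hypothesis UK : forall y, U y != 0 -> in_box K y.

Let A : R := \int[lam]_s v s.

(* [lam] lives on [measurableTypeR R], not on the canonical measurable type of [R]. *)
Local Notation wm := (@wmean R _ (measurableTypeR R) lam v).

Let measurable_section (h : 'rV[R]_n.+1 -> R) (y : 'rV[R]_n) :
  measurable_fun setT h -> measurable_fun setT (fun s => h (consrV (s, y))).
Proof.
move=> mh; have mg : measurable_fun setT (h \o @consrV R n).
  by apply: measurableT_comp => //; exact: measurable_consrV.
exact: (measurableT_comp mg).
Qed.

Let J (h : 'rV[R]_n.+1 -> R) (y : 'rV[R]_n) : \bar R :=
  (\int[lam]_s (h (consrV (s, y)) * v s)%:E)%E.

Let mhv (h : 'rV[R]_n.+1 -> R) : measurable_fun setT h ->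
  measurable_fun setT (fun x : 'rV[R]_n.+1 => (h x * v (x 0 0))%:E).
Proof.
move=> mh; apply/measurable_EFinP; apply: measurable_funM => //.
by apply: measurableT_comp => //; exact: measurable_entry.
Qed.

Let measurable_J (h : 'rV[R]_n.+1 -> R) : measurable_fun setT h ->
  (forall x, 0 <= h x) -> measurable_fun setT (J h).
Proof.
move=> mh h0; have := @measurable_integral_consrV_swap R n _ (mhv mh).
rewrite (_ : (fun y => _) = J h); last first.
  by apply/funext => y; apply: eq_integral => s _; rewrite consrV0.
by apply => x; rewrite lee_fin mulr_ge0.
Qed.

Let J_ge0 (h : 'rV[R]_n.+1 -> R) y : (forall x, 0 <= h x) -> (0 <= J h y)%E.
Proof. by move=> h0; apply: integral_ge0 => s _; rewrite lee_fin mulr_ge0. Qed.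

Let integral_J (h : 'rV[R]_n.+1 -> R) : measurable_fun setT h ->
  (forall x, 0 <= h x) ->
  (\int[lebesgue_rV n.+1]_x (h x * cons_weight v U x)%:E =
   \int[lebesgue_rV n]_y ((U y)%:E * J h y))%E.
Proof.
move=> mh h0; rewrite integral_lebesgue_rVS_swap; last 2 first.
- by apply/measurable_EFinP; apply: measurable_funM => //; exact: measurable_cons_weight.
- by move=> x; rewrite lee_fin mulr_ge0// mulr_ge0.
apply: eq_integral => y _; rewrite /J -ge0_integralZl_EFin//.
- by apply: eq_integral => s _; rewrite cons_weightE -EFinM; congr EFin; ring.
- by move=> s _; rewrite lee_fin mulr_ge0.
- by apply/measurable_EFinP; apply: measurable_funM => //; exact: measurable_section.
Qed.

(* Averaging out the first coordinate sends tame functions to tame functions,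
   so the inequality for [U] applies to the average of [f]. *)
Lemma weighted_poincare_cons : 0 <= C ->
  weighted_poincare1 K v C -> weighted_poincare K U C ->
  weighted_poincare K (cons_weight v U) C.
Proof.
move=> C0 Pv PU f G [mf mG [M HM]].
pose F y := wm (fun s => f (consrV (s, y))).
pose GF y : 'rV[R]_n := \row_i wm (fun s => G (consrV (s, y)) 0 (lift ord0 i)).
have bnd s y : v s != 0 -> in_box K y ->
   [/\ `|f (consrV (s, y))| <= M, forall i, `|G (consrV (s, y)) 0 i| <= M &
    forall y', in_box K y' -> `|f (consrV (s, y')) - f (consrV (s, y)) -
      dotrV (tailrV (G (consrV (s, y)))) (y' - y)| <= M * norm2 (y' - y) ^+ 2].
  move=> vs yK; have [h1 h2 h3] := HM _ (in_box_cons (vK vs) yK); split => //.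
  move=> y' yK'; have := h3 _ (in_box_cons (vK vs) yK').
  have tE : tailrV (consrV (s, y') - consrV (s, y)) = y' - y.
    by apply/rowP => i; rewrite [LHS]mxE [LHS]mxE [X in _ + X = _]mxE !consrV_lift !mxE.
  have hE : (consrV (s, y') - consrV (s, y)) 0 0 = 0.
    by rewrite [LHS]mxE [X in _ + X = _]mxE !consrV0 subrr.
  rewrite norm2_sqr_tail tE hE expr0n/= add0r.
  rewrite /dotrV big_ord_recl hE mulr0 add0r.
  rewrite (eq_bigr (fun i => tailrV (G (consrV (s, y))) 0 i * (y' - y) 0 i))//.
  by move=> i _; rewrite -tE [tailrV (G _) _ _]mxE [tailrV (_ - _) _ _]mxE.
have mwm (h : 'rV[R]_n.+1 -> R) : measurable_fun setT h ->
    measurable_fun setT (fun y : 'rV[R]_n => wm (fun s => h (consrV (s, y)))).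
  move=> mh; apply: measurable_funM => //.
  apply: (@measurable_Rintegral_fst _ _ _ (fun p : R * 'rV[R]_n => h (consrV p) * v p.1)).
  apply: measurable_funM; first by apply: measurableT_comp => //; exact: measurable_consrV.
  by apply: measurableT_comp => //; exact: measurable_fst.
have tF : tame K F GF.
  split; first exact: mwm.
    by move=> i; under eq_fun do rewrite mxE; exact: (mwm (fun x => G x 0 (lift ord0 i))).
  exists M => y yK; split.
  - apply: (@wmean_norm_le R _ (measurableTypeR R) lam) => //; first exact: measurable_section.
    by move=> s vs; have [] := bnd s y vs yK.
  - move=> i; rewrite mxE; apply: (@wmean_norm_le R _ (measurableTypeR R) lam) => //.
      exact: (measurable_section y (mG (lift ord0 i))).
    by move=> s vs; have [_ + _] := bnd s y vs yK; exact.
  move=> y' yK'.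
  (* By linearity the Taylor remainder of [F] is the average of the remainders [r s], so it inherits
     their common bound. *)
  pose r s := f (consrV (s, y')) - f (consrV (s, y)) -
      dotrV (tailrV (G (consrV (s, y)))) (y' - y).
  pose q i s := (y' - y) 0 i * G (consrV (s, y)) 0 (lift ord0 i).
  have mq i : measurable_fun setT (q i).
    by apply: measurable_funM => //; exact: (measurable_section y (mG (lift ord0 i))).
  have rE s : r s = f (consrV (s, y')) - f (consrV (s, y)) - \sum_i q i s.
    rewrite /r /dotrV; congr (_ - _); apply: eq_bigr => i _.
    by rewrite /q mulrC [tailrV _ _ _]mxE.
  have mr : measurable_fun setT r.
    rewrite (_ : r = fun s => f (consrV (s, y')) - f (consrV (s, y)) - \sum_i q i s); last exact/funext.
    apply: measurable_funB; last by apply: measurable_sum.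
    by apply: measurable_funB; exact: measurable_section.
  have rM s : v s != 0 -> `|r s| <= M * norm2 (y' - y) ^+ 2.
    by move=> vs; have [_ _] := bnd s y vs yK; exact.
  have qM i s : v s != 0 -> `|q i s| <= `|(y' - y) 0 i| * M.
    move=> vs; rewrite normrM ler_wpM2l//.
    by have [_ + _] := bnd s y vs yK; exact.
  have FE : F y' = wm r + (F y + \sum_i (y' - y) 0 i * GF y 0 i).
    have -> : F y' = wm (fun s => r s + (f (consrV (s, y)) + \sum_i q i s)).
      by congr wmean; apply/funext => s; rewrite rE; ring.
    rewrite (@wmeanD R _ (measurableTypeR R) lam v mv v0 v_fin _ _ (M * norm2 (y' - y) ^+ 2)
      (M + \sum_i `|(y' - y) 0 i| * M))//; last 2 first.
    - by apply: measurable_funD; [exact: measurable_section|exact: measurable_sum].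
    - move=> s vs; rewrite (le_trans (ler_normD _ _))// lerD//.
        by have [] := bnd s y vs yK.
      by rewrite (le_trans (ler_norm_sum _ _ _))// ler_sum// => i _; exact: qM.
    rewrite (@wmeanD R _ (measurableTypeR R) lam v mv v0 v_fin _ _ M (\sum_i `|(y' - y) 0 i| * M))//; last 4 first.
    - exact: measurable_section.
    - exact: measurable_sum.
    - by move=> s vs; have [] := bnd s y vs yK.
    - by move=> s vs; rewrite (le_trans (ler_norm_sum _ _ _))// ler_sum// => i _; exact: qM.
    rewrite (@wmean_sum R _ (measurableTypeR R) lam v mv v0 v_gt0 v_fin _ _ _ _ mq qM); congr (_ + (_ + _)).
    apply: eq_bigr => i _; rewrite [GF y 0 i]mxE.
    have gM s : v s != 0 -> `|G (consrV (s, y)) 0 (lift ord0 i)| <= M.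
      by move=> vs; have [_ + _] := bnd s y vs yK; exact.
    exact: (@wmeanZ R _ (measurableTypeR R) lam v mv v0 v_fin _ _ M
      (measurable_section y (mG (lift ord0 i))) gM).
  rewrite (_ : F y' - F y - _ = wm r); first exact: (@wmean_norm_le R _ (measurableTypeR R) lam).
  rewrite FE /dotrV (eq_bigr (fun i => GF y 0 i * (y' - y) 0 i)); last by move=> i _; rewrite mulrC.
  ring.
have [c Hc] := PU F GF tF; exists c.
have mfc : measurable_fun setT (fun x => (f x - c) ^+ 2).
  by apply: measurable_funX; apply: measurable_funB.
have mG0 : measurable_fun setT (fun x => G x 0 0 ^+ 2) by exact: measurable_funX.
have mGt : measurable_fun setT (fun x => norm2 (tailrV (G x)) ^+ 2).
  apply: measurable_norm2_sqr => i.
  have -> : (fun x => tailrV (G x) 0 i) = (fun x => G x 0 (lift ord0 i)) by apply/funext => x; rewrite mxE.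
  exact: mG.
have A0 : 0 < A by exact: (@wmass_gt0 R _ (measurableTypeR R) lam v v_gt0 v_fin).
have AE : (\int[lam]_s v s)%R = A by [].
(* On the fibre over [y], the second moment about [c] is the variance plus [A (F y - c) ^ 2]. The
   fibre inequality supplies its own centre [c']; passing from [c'] to the mean only decreases the
   left side. *)
have step1 y : U y != 0 ->
    (J (fun x => (f x - c) ^+ 2)%R y <=
     C%:E * J (fun x => G x 0 0 ^+ 2)%R y + (A * (F y - c) ^+ 2)%:E)%E.
  move=> Uy; have yK := UK Uy.
  have fM s : v s != 0 -> `|f (consrV (s, y))| <= M by move=> vs; have [] := bnd s y vs yK.
  have ms := measurable_section y mf.
  rewrite /J (@wmean_bias_variance R _ (measurableTypeR R) lam v mv v0 v_gt0 v_fin _ M c ms fM) AE leeD2r//.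
  have [|c' Hc'] := Pv (fun s => f (consrV (s, y))) (fun s => G (consrV (s, y)) 0 0).
    split => //; first exact: (measurable_section y (mG 0)).
    exists M => s sK; have [h1 h2 h3] := HM _ (in_box_cons sK yK); split => //.
    move=> s' sK'; have := h3 _ (in_box_cons sK' yK).
    have tE : tailrV (consrV (s', y) - consrV (s, y)) = 0.
      by apply/rowP => i; rewrite [LHS]mxE [LHS]mxE [X in _ + X = _]mxE !consrV_lift subrr !mxE.
    have hE : (consrV (s', y) - consrV (s, y)) 0 0 = s' - s.
      by rewrite [LHS]mxE [X in _ + X = _]mxE !consrV0.
    rewrite norm2_sqr_tail tE hE norm2_sqr big1 ?addr0; last first.
      by move=> i _; rewrite mxE expr0n.
    rewrite /dotrV big_ord_recl hE big1 ?addr0// => i _.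
    have := congr1 (fun z : 'rV[R]_n => z 0 i) tE; rewrite [LHS]mxE [RHS]mxE => ->.
    by rewrite mulr0.
  apply: le_trans Hc'.
  rewrite (@wmean_bias_variance R _ (measurableTypeR R) lam v mv v0 v_gt0 v_fin _ M c' ms fM) AE leeDl// lee_fin.
  by rewrite mulr_ge0 ?sqr_ge0// ltW.
(* Jensen's inequality in each coordinate: the gradient of the average is the average of the
   gradient. *)
have step2 y : U y != 0 ->
    ((A * norm2 (GF y) ^+ 2)%:E <= J (fun x => norm2 (tailrV (G x)) ^+ 2)%R y)%E.
  move=> Uy; have yK := UK Uy; rewrite norm2_sqr mulr_sumr.
  have -> : J (fun x => norm2 (tailrV (G x)) ^+ 2)%R y =
      (\sum_(i < n) \int[lam]_s (G (consrV (s, y)) 0%R (lift ord0 i) ^+ 2 * v s)%:E)%E.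
    rewrite -ge0_integral_sum//.
    - apply: eq_integral => s _; rewrite norm2_sqr mulr_suml sumEFin.
      by congr EFin; apply: eq_bigr => i _; rewrite mxE.
    - move=> i; apply/measurable_EFinP; apply: measurable_funM => //.
      apply: measurable_funX; exact: (measurable_section y (mG (lift ord0 i))).
    - by move=> i s _; rewrite lee_fin mulr_ge0// sqr_ge0.
  rewrite -sumEFin; apply: lee_sum => i _.
  have gM s : v s != 0 -> `|G (consrV (s, y)) 0 (lift ord0 i)| <= M.
    by move=> vs; have [_ + _] := bnd s y vs yK; exact.
  have := @wmean_bias_variance R _ (measurableTypeR R) lam v mv v0 v_gt0 v_fin _ M 0 (measurable_section y (mG (lift ord0 i))) gM.
  under eq_integral do rewrite subr0.
  move=> ->; rewrite AE subr0 mxE leeDr// integral_ge0// => s _.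
  by rewrite lee_fin mulr_ge0// sqr_ge0.
rewrite integral_J//; last by move=> x; exact: sqr_ge0.
have -> : (\int[lebesgue_rV n.+1]_x (norm2 (G x) ^+ 2 * cons_weight v U x)%:E =
   \int[lebesgue_rV n]_y ((U y)%:E * J (fun x => G x 0 0 ^+ 2)%R y) +
   \int[lebesgue_rV n]_y ((U y)%:E * J (fun x => norm2 (tailrV (G x)) ^+ 2)%R y))%E.
  rewrite -!integral_J//; last 2 first.
  - by move=> x; exact: sqr_ge0.
  - by move=> x; exact: sqr_ge0.
  rewrite -ge0_integralD//.
  - by apply: eq_integral => x _; rewrite norm2_sqr_tail mulrDl EFinD.
  - by move=> x _; rewrite lee_fin mulr_ge0 ?sqr_ge0// mulr_ge0.
  - by apply/measurable_EFinP; apply: measurable_funM => //; exact: measurable_cons_weight.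
  - by move=> x _; rewrite lee_fin mulr_ge0 ?sqr_ge0// mulr_ge0.
  - by apply/measurable_EFinP; apply: measurable_funM => //; exact: measurable_cons_weight.
have mUE : measurable_fun setT (fun y => (U y)%:E) by exact/measurable_EFinP.
have J0 (h : 'rV[R]_n.+1 -> R) y : (forall x, 0 <= h x) -> (0 <= (U y)%:E * J h y)%E.
  by move=> h0; rewrite mule_ge0 ?lee_fin ?J_ge0.
have mF : measurable_fun setT F by case: tF.
have mFc : measurable_fun setT (fun y => (F y - c) ^+ 2 * U y).
  by apply: measurable_funM => //; apply: measurable_funX; apply: measurable_funB.
have mGF : measurable_fun setT (fun y => norm2 (GF y) ^+ 2 * U y).
  by apply: measurable_funM => //; apply: measurable_norm2_sqr; case: tF.
have AsqU0 y z : 0 <= A * (z ^+ 2 * U y).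
  by apply: mulr_ge0; [exact: ltW|apply: mulr_ge0 => //; exact: sqr_ge0].
pose b y := J (fun x => G x 0 0 ^+ 2) y.
have mb : measurable_fun setT (fun y => (U y)%:E * b y)%E.
  by apply: emeasurable_funM => //; apply: measurable_J => // x; exact: sqr_ge0.
have b0 y : (0 <= (U y)%:E * b y)%E by apply: J0 => x; exact: sqr_ge0.
apply: (@le_trans _ _ (\int[lebesgue_rV n]_y (C%:E * ((U y)%:E * b y) + A%:E * ((F y - c) ^+ 2 * U y)%:E))%E).
  apply: ge0_le_integral => //.
  - by move=> y _; apply: J0 => x; exact: sqr_ge0.
  - by apply: emeasurable_funM => //; apply: measurable_J => // x; exact: sqr_ge0.
  - apply: emeasurable_funD; apply: emeasurable_funM => //.
    exact/measurable_EFinP.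
  move=> y _; have [->|Uy] := eqVneq (U y) 0.
    by rewrite !mul0e mule0 mulr0 mule0 adde0.
  apply: (le_trans (lee_wpmul2l _ (step1 y Uy))); first by rewrite lee_fin.
  rewrite ge0_muleDr//; last 2 first.
  - by rewrite mule_ge0// J_ge0// => x; exact: sqr_ge0.
  - by rewrite lee_fin mulr_ge0 ?sqr_ge0// ltW.
  by rewrite muleCA -!EFinM leeD2l// lee_fin le_eqVlt; apply/orP; left; apply/eqP; ring.
rewrite ge0_integralD//; last 4 first.
- by move=> y _; rewrite mule_ge0.
- exact: emeasurable_funM.
- by move=> y _; rewrite -EFinM lee_fin.
- by apply: emeasurable_funM => //; exact/measurable_EFinP.
rewrite ge0_integralZl_EFin// ge0_integralZl_EFin//; last 3 first.
- by move=> y _; rewrite lee_fin mulr_ge0 ?sqr_ge0.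
- exact/measurable_EFinP.
- exact: ltW.
rewrite [leRHS]ge0_muleDr; last 2 first.
- by apply: integral_ge0 => y _; apply: J0 => x; exact: sqr_ge0.
- by apply: integral_ge0 => y _; apply: J0 => x; exact: sqr_ge0.
rewrite leeD2l//.
apply: (@le_trans _ _ (A%:E * (C%:E * \int[lebesgue_rV n]_y (norm2 (GF y) ^+ 2 * U y)%:E))%E).
  by rewrite lee_wpmul2l// lee_fin ltW.
rewrite muleCA lee_wpmul2l// -ge0_integralZl_EFin//; last 3 first.
- by move=> y _; rewrite lee_fin mulr_ge0 ?sqr_ge0.
- exact/measurable_EFinP.
- exact: ltW.
apply: ge0_le_integral => //.
- by move=> y _; rewrite -EFinM lee_fin.
- by apply: emeasurable_funM => //; exact/measurable_EFinP.
- by apply: emeasurable_funM => //; apply: measurable_J => // x; exact: sqr_ge0.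
move=> y _; have [->|Uy] := eqVneq (U y) 0; first by rewrite mulr0 mule0 mul0e.
rewrite -EFinM mulrA mulrC EFinM lee_wpmul2l ?lee_fin//.
exact: step2.
Qed.

End tensorization.

(** * Uniqueness of Lebesgue measure on boxes and permutations of coordinates *)

Section permutation.
Context {R : realType}.
Local Notation lam := (@lebesgue_measure R).

Definition boxset n (B : 'I_n -> set R) : set 'rV[R]_n :=
  [set x | forall i, B i (x 0 i)].

Lemma measurable_boxset n (B : 'I_n -> set R) :
  (forall i, measurable (B i)) -> measurable (boxset B).
Proof.
move=> mB; have -> : boxset B = \bigcap_(i in [set: 'I_n]) ((fun x : 'rV[R]_n => x 0 i) @^-1` B i).
  by apply/seteqP; split => x /= h i; [move=> _; exact: h|exact: h].
apply: fin_bigcap_measurable; first exact: finite_finset.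
move=> i _; rewrite -[X in measurable X]setTI.
exact: (measurable_entry 0 i measurableT (mB i)).
Qed.

Lemma lebesgue_rV_boxset n (B : 'I_n -> set R) : (forall i, measurable (B i)) ->
  (lebesgue_rV n (boxset B) = \prod_(i < n) lam (B i))%E.
Proof.
elim: n B => [|n IH] B mB.
  rewrite big_ord0 (_ : boxset B = setT) /=; first by rewrite diracT.
  by apply/seteqP; split => // x _ [].
rewrite big_ord_recl -(IH (fun i => B (lift ord0 i)))// /= /lebesgue_cons /pushforward.
rewrite (_ : _ @^-1` _ = B ord0 `*` boxset (fun i => B (lift ord0 i))); last first.
  apply/seteqP; split => -[s y] /= h.
    split => [|i] /=; first by have := h ord0; rewrite consrV0.
    by have := h (lift ord0 i); rewrite consrV_lift.
  case: h => /= h1 h2 i; case: (unliftP ord0 i) => [j|] ->; last by rewrite consrV0.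
  by rewrite consrV_lift; exact: h2.
apply: product_measure1E; first exact: mB.
by apply: measurable_boxset => i.
Qed.

(** Boxes form a generating family stable under intersection, and the cubes [[- k, k] ^ n] exhaust
    the space with finite measure. *)
Lemma lebesgue_rV_unique n (m : {measure set 'rV[R]_n -> \bar R}) :
  (forall B, (forall i, measurable (B i)) -> m (boxset B) = \prod_(i < n) lam (B i))%E ->
  forall A, measurable A -> m A = lebesgue_rV n A.
Proof.
move=> mB A mA.
pose G := [set boxset B | B in [set B : 'I_n -> set R | forall i, measurable (B i)]].
pose g (k : nat) := boxset (fun _ : 'I_n => `[(- k%:R : R), k%:R]%classic).
have Gm : @measurable _ 'rV[R]_n = <<s G >>.
  apply/seteqP; split => X.
    apply: smallest_sub; first exact: smallest_sigma_algebra.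
    move=> _ [i [j [B mBB ->]]]; apply: sub_sigma_algebra.
    exists (fun k => if k == j then B else setT).
      by move=> k /=; case: ifP.
    apply/seteqP; split => x /= h.
      by have := h j; rewrite eqxx ord1.
    by move=> k; case: eqP => // ->; rewrite -(ord1 i).
  apply: smallest_sub; first exact: sigma_algebra_measurable.
  by move=> _ [B mBB <-]; exact: measurable_boxset.
apply: (measure_unique G g) => //.
- move=> _ _ [B1 m1 <-] [B2 m2 <-]; exists (fun i => B1 i `&` B2 i).
    by move=> i /=; exact: measurableI.
  apply/seteqP; split => x /=; first by move=> h; split => i; case: (h i).
  by case=> h1 h2 i; split.
- by move=> k; exists (fun _ => `[(- k%:R : R), k%:R]%classic).
- apply/seteqP; split => // x _.
  exists (Num.bound (\sum_i `|x 0 i|)) => // i /=; rewrite in_itv/= -ler_norml.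
  apply: le_trans (ltW (archi_boundP _)); last by rewrite sumr_ge0.
  by rewrite (bigD1 i)//= lerDl sumr_ge0.
- move=> _ [B mBB <-]; apply: (etrans (mB B mBB)); apply/esym.
  exact: lebesgue_rV_boxset.
- move=> k; rewrite mB//.
  have : (\prod_(i < n) lam `[(- k%:R)%R, k%:R] \is a fin_num)%E.
    apply: prode_fin_num => i _.
    by rewrite lebesgue_measure_itv/=; case: ifP.
  by move/fin_numPlt/andP => [].
Qed.

(** The two dimensions are kept apart because the application has [m = #|S1| + #|S0|], which equals
    [d] without being convertible to it. A bijective [sigma] thus avoids casts. *)
Definition reindex_rV d m (sigma : 'I_d -> 'I_m) (z : 'rV[R]_m) : 'rV[R]_d :=
  \row_i z 0 (sigma i).

Lemma measurable_reindex_rV d m (sigma : 'I_d -> 'I_m) :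
  measurable_fun setT (reindex_rV sigma).
Proof.
apply: measurable_fun_entryP => i j.
under eq_fun do rewrite mxE; exact: measurable_entry.
Qed.

Lemma integral_reindex_rV d m (sigma : 'I_d -> 'I_m) (f : 'rV[R]_d -> \bar R) :
  bijective sigma -> measurable_fun setT f -> (forall x, 0 <= f x)%E ->
  (\int[lebesgue_rV d]_x f x = \int[lebesgue_rV m]_z f (reindex_rV sigma z))%E.
Proof.
move=> sbij mf f0; have [tau sK tK] := sbij.
pose mp := measurable_reindex_rV sigma.
pose m1 : {measure set 'rV[R]_d -> \bar R} :=
  measure_function_pushforward__canonical__measure_function_Measure (lebesgue_rV m) mp.
rewrite -(ge0_integral_pushforward mp _ measurableT mf)//.
apply/esym; apply: (@eq_measure_integral _ _ _ setT (lebesgue_rV d) m1) => A mA _.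
apply: lebesgue_rV_unique => // B mB.
rewrite /m1 /= /pushforward.
have -> : reindex_rV sigma @^-1` boxset B = boxset (fun k => B (tau k)).
  apply/seteqP; split => z /= h k.
    by have := h (tau k); rewrite mxE tK.
  by rewrite mxE -[in B k](sK k).
apply: (etrans (lebesgue_rV_boxset _)) => //; rewrite (reindex sigma)/=; last exact: onW_bij.
by apply: eq_bigr => i _; rewrite sK.
Qed.

End permutation.

Section product_weight.
Context {R : realType}.
Local Notation lam := (@lebesgue_measure R).

Lemma integral_cons_weight n (v : R -> R) (U : 'rV[R]_n -> R) :
  measurable_fun setT v -> (forall s, 0 <= v s) ->
  measurable_fun setT U -> (forall y, 0 <= U y) ->
  (\int[lebesgue_rV n.+1]_x (cons_weight v U x)%:E =
   \int[lam]_s (v s)%:E * \int[lebesgue_rV n]_y (U y)%:E)%E.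
Proof.
move=> mv v0 mU U0; rewrite integral_lebesgue_rVS; last 2 first.
- by apply/measurable_EFinP; exact: measurable_cons_weight.
- by move=> x; rewrite lee_fin mulr_ge0.
rewrite -ge0_integralZr//; last 3 first.
- exact/measurable_EFinP.
- by move=> s _; rewrite lee_fin.
- by apply: integral_ge0 => y _; rewrite lee_fin.
apply: eq_integral => s _; rewrite -ge0_integralZl_EFin//; last 2 first.
- by move=> y _; rewrite lee_fin.
- exact/measurable_EFinP.
by apply: eq_integral => y _; rewrite cons_weightE EFinM.
Qed.

Definition prod_weight k m (v : 'I_k -> R -> R) (rho : 'rV[R]_m -> R)
    (z : 'rV[R]_(k + m)) : R :=
  (\prod_(i < k) v i (z 0 (lshift m i))) * rho (rsubmx z).

Lemma prod_weightS k m (v : 'I_k.+1 -> R -> R) (rho : 'rV[R]_m -> R) :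
  prod_weight v rho =
  cons_weight (v ord0) (prod_weight (fun i => v (lift ord0 i)) rho)
    :> ('rV[R]_(k + m).+1 -> R).
Proof.
apply/funext => z; rewrite /prod_weight /cons_weight big_ord_recl -mulrA.
congr (_ * (_ * _)).
- by congr (v _ (z _ _)); exact/val_inj.
- apply: eq_bigr => i _; rewrite [tailrV _ _ _]mxE.
  by congr (v _ (z _ _)); exact/val_inj.
- congr rho; apply/rowP => i; rewrite !mxE.
  by congr (z _ _); exact/val_inj.
Qed.

(** The inequality for [rho] is assumed only when [rho] has finite mass: what is known beforehand is
    the finiteness of the whole product, from which that of [rho] follows. *)
Lemma weighted_poincare_prod k m (K C : R) (v : 'I_k -> R -> R) (rho : 'rV[R]_m -> R) :
  0 <= C ->
  (forall i, measurable_fun setT (v i)) -> (forall i s, 0 <= v i s) ->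
  (forall i s, v i s != 0 -> `|s| <= K) ->
  (forall i, 0 < \int[lam]_s (v i s)%:E < +oo)%E ->
  (forall i, weighted_poincare1 K (v i) C) ->
  measurable_fun setT rho -> (forall y, 0 <= rho y) ->
  (forall y, rho y != 0 -> in_box K y) ->
  ((\int[lebesgue_rV m]_y (rho y)%:E < +oo)%E -> weighted_poincare K rho C) ->
  (\int[lebesgue_rV (k + m)]_z (prod_weight v rho z)%:E < +oo)%E ->
  weighted_poincare K (prod_weight v rho) C.
Proof.
move=> C0 + + + + + mrho rho0 rhoK Prho.
(* The induction has to carry measurability, sign and support of the partial products, which the
   tensorization step asks of its second factor. *)
suff : (forall i, measurable_fun setT (v i)) -> (forall i s, 0 <= v i s) ->
  (forall i s, v i s != 0 -> `|s| <= K) ->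
  (forall i, 0 < \int[lam]_s (v i s)%:E < +oo)%E ->
  (forall i, weighted_poincare1 K (v i) C) ->
  [/\ measurable_fun setT (prod_weight v rho),
      (forall z, 0 <= prod_weight v rho z),
      (forall z, prod_weight v rho z != 0 -> in_box K z) &
      (\int[lebesgue_rV (k + m)]_z (prod_weight v rho z)%:E < +oo)%E ->
      weighted_poincare K (prod_weight v rho) C].
  by move=> H mv v0 vK vint Pv; case: (H mv v0 vK vint Pv).
elim: k v => [|k IH] v mv v0 vK vint Pv.
  have -> : prod_weight v rho = rho.
    apply/funext => z; rewrite /prod_weight big_ord0 mul1r; congr rho.
    by apply/rowP => i; rewrite mxE; congr (z _ _); exact/val_inj.
  by split.
have [mU U0 UK PU] := IH (fun i => v (lift ord0 i)) (fun i => mv _) (fun i => v0 _)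
  (fun i => vK _) (fun i => vint _) (fun i => Pv _).
rewrite prod_weightS; split.
- exact: measurable_cons_weight.
- by move=> z; exact: mulr_ge0.
- move=> z; rewrite mulf_eq0 negb_or => /andP[/vK z0 /UK zt] i.
  case: (unliftP ord0 i) => [j|] -> //.
  by have := zt j; rewrite mxE.
rewrite [X in (X < _)%E -> _](@integral_cons_weight (k + m))// => fin.
have /andP[v_gt0 v_fin] := vint ord0.
apply: weighted_poincare_cons => //; first by move=> s; exact: vK.
(* The first factor has positive mass, so infinite mass of the others would make the product
   infinite. *)
apply: PU; rewrite ltNge leye_eq; apply/negP => /eqP E.
by move: fin; rewrite E gt0_muley.
Qed.

End product_weight.

(** * One-sided derivatives and the chain rule *)

Section chain_rule.
Context {R : realType}.

Lemma is_derive_of_littleo (f : R -> R) (x d : R) :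
  (forall eps, 0 < eps -> exists2 e, 0 < e &
     forall h, `|h| < e -> `|f (x + h) - f x - d * h| <= eps * `|h|) ->
  is_derive x 1 f d.
Proof.
move=> H.
have cv : (fun h => h^-1 *: (f (h *: 1 + x) - f x)) @ 0^' --> d.
  apply/cvgrPdist_le => /= eps eps0; have [e e0 He] := H eps eps0; near=> h.
  have h0 : h != 0 by near: h; exact: nbhs_dnbhs_neq.
  have he : `|h| < e by near: h; apply: dnbhs0_lt.
  rewrite /GRing.scale /= mulr1 (addrC h).
  have -> : d - h^-1 * (f (x + h) - f x) = - (h^-1 * (f (x + h) - f x - d * h)).
    by field.
  by rewrite normrN normrM normfV ler_pdivrMl ?normr_gt0// [leRHS]mulrC; exact: He.
by split; [apply/cvg_ex; exists d|exact: cvg_lim].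
Unshelve. all: by end_near. Qed.

Lemma MVT_centered (f df : R -> R) (r t : R) :
  (forall x : R, `|x| <= r -> is_derive x 1 f (df x)) -> `|t| <= r ->
  exists2 c, `|c| <= `|t| & f t - f 0 = df c * t.
Proof.
move=> H tr.
have cf a b : `|a| <= r -> `|b| <= r -> {within `[a, b], continuous f}.
  rewrite !ler_norml => /andP[a1 a2] /andP[b1 b2].
  apply: derivable_within_continuous => x; rewrite in_itv/= => /andP[ax xb].
  have := H x; rewrite ler_norml (le_trans a1 ax) (le_trans xb b2) => /(_ isT) ?.
  exact: ex_derive.
have r0 : `|0 : R| <= r by rewrite normr0 (le_trans _ tr).
have [t0|t0|->] := ltgtP t 0; last by exists 0; rewrite // subrr mulr0.
- have [|c /[!in_itv]/= /andP[tc c0] E] := MVT t0 _ (cf _ _ tr r0) (df := df).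
    move=> x; rewrite in_itv/= => /andP[tx x0]; apply: H; apply: le_trans tr.
    by rewrite !ltr0_norm// lerN2 ltW.
  exists c; first by rewrite !ltr0_norm// lerN2 ltW.
  by rewrite -opprB E; ring.
- have [|c /[!in_itv]/= /andP[c0 tc] E] := MVT t0 _ (cf _ _ r0 tr) (df := df).
    move=> x; rewrite in_itv/= => /andP[x0 xt]; apply: H; apply: le_trans tr.
    by rewrite !gtr0_norm// ltW.
  exists c; first by rewrite !gtr0_norm// ltW.
  by rewrite E subr0.
Qed.

Variable n : nat.

(** Each coordinate travels its own fraction [s 0 i] of [w 0 i]. For [s] in the unit cube these
    points fill the box with opposite corners [a] and [a + w], which contains every staircase path
    parallel to the axes. *)
Definition shift_along (a w s : 'rV[R]_n) : 'rV[R]_n :=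
  \row_i (a 0 i + s 0 i * w 0 i).

(* The increment of [f] along [t w] is telescoped into increments parallel to
   the axes, to which the mean value theorem applies. *)
Lemma is_derive_along (f : 'rV[R]_n -> R) (g : 'I_n -> 'rV[R]_n -> R)
    (a w : 'rV[R]_n) (e0 : R) : 0 < e0 ->
  (forall (s : 'rV[R]_n) i, (forall j, `|s 0 j| <= e0) -> w 0 i != 0 ->
     is_derive (0 : R) 1 (fun t : R => f (shift_along a w s + t *: unit_vec i))
       (g i (shift_along a w s))) ->
  (forall i eps, w 0 i != 0 -> 0 < eps -> exists2 e, 0 < e &
     forall s : 'rV[R]_n, (forall j, `|s 0 j| <= e) -> `|g i (shift_along a w s) - g i a| <= eps) ->
  is_derive (0 : R) 1 (fun t : R => f (a + t *: w)) (\sum_i w 0 i * g i a).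
Proof.
move=> e00 Hd Hc; apply: is_derive_of_littleo => eps eps0.
pose W := \sum_i `|w 0 i| + 1.
have W0 : 0 < W by rewrite ltr_wpDl// sumr_ge0.
have eW0 : 0 < eps / W by rewrite divr_gt0.
have [e e_gt0 He] : exists2 e, 0 < e & forall i, w 0 i != 0 ->
    forall s : 'rV[R]_n, (forall j, `|s 0 j| <= e) -> `|g i (shift_along a w s) - g i a| <= eps / W.
  have H i : exists e, 0 < e /\ (w 0 i != 0 -> forall s : 'rV[R]_n, (forall j, `|s 0 j| <= e) ->
      `|g i (shift_along a w s) - g i a| <= eps / W).
    have [wi|wi] := eqVneq (w 0 i) 0; first by exists 1.
    by have [e e_gt0 h] := Hc i _ wi eW0; exists e.
  have [e_ He] := choice H.
  exists (\big[Num.min/1]_i e_ i).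
    by apply: lt_bigmin => // i _; case: (He i).
  move=> i wi s hs; have [_ h] := He i; apply: h => // j.
  by apply: (le_trans (hs j)); exact: bigmin_le_cond.
exists (Num.min e e0); first by rewrite lt_min e_gt0.
move=> t; rewrite lt_min => /andP[te te0]; rewrite add0r scale0r addr0.
(* Staircase from [a] to [a + t w]: coordinates before [k] have completed their move, coordinate [k]
   has moved by [u], the later ones are still at rest. *)
pose sk (k : nat) (u : R) : 'rV[R]_n :=
  \row_i (if (i < k)%N then t else if i == k :> nat then u else 0).
pose q k := f (shift_along a w (sk k 0)).
have q0 : q 0%N = f a.
  by congr f; apply/rowP => i; rewrite !mxE ltn0 if_same mul0r addr0.
have qn : q n = f (a + t *: w).
  by congr f; apply/rowP => i; rewrite !mxE ltn_ord.
have qS k : sk k.+1 0 = sk k t.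
  by apply/rowP => i; rewrite !mxE ltnS leq_eqVlt; case: ltngtP => //= _; rewrite if_same.
have skle k u j : `|u| <= `|t| -> `|sk k u 0 j| <= `|t|.
  by move=> ut; rewrite mxE; case: ifP => // _; case: ifP => //; rewrite normr0.
have step (i : 'I_n) : `|q i.+1 - q i - t * (w 0 i * g i a)| <= `|t| * (`|w 0 i| * (eps / W)).
  have [wi|wi] := eqVneq (w 0 i) 0.
    rewrite wi mul0r mulr0 subr0 normr0 mul0r mulr0.
    rewrite (_ : q i.+1 = q i) ?subrr ?normr0//; congr f; apply/rowP => j.
    rewrite !mxE ltnS leq_eqVlt; have [ji|ji|ji] := ltngtP j i; rewrite ?if_same//=.
    by rewrite (ord_inj ji) wi !mulr0.
  pose phi u := f (shift_along a w (sk i u)).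
  have dphi (u : R) : `|u| <= `|t| -> is_derive u 1 phi (w 0 i * g i (shift_along a w (sk i u))).
    move=> ut; have hs j : `|sk i u 0 j| <= e0.
      by apply: (le_trans (skle _ _ _ ut)); exact: ltW.
    have D1 := Hd _ i hs wi.
    have -> : phi = (fun z => f (shift_along a w (sk i u) + z *: unit_vec i)) \o
        (fun z => (z - u) * w 0 i).
      apply/funext => z /=; congr f; apply/rowP => j; rewrite !mxE eqxx/=.
      have [ji|ji|ji] := ltngtP j i.
      - by rewrite (_ : (j == i) = false) ?mulr0 ?addr0// -val_eqE/= ltn_eqF.
      - by rewrite (_ : (j == i) = false) ?mulr0 ?addr0// -val_eqE/= gtn_eqF.
      - by rewrite (ord_inj ji) eqxx mulr1; ring.
    have D2 : is_derive u 1 (fun z => (z - u) * w 0 i) (w 0 i).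
      by apply: is_derive_eq; rewrite /GRing.scale /=; ring.
    rewrite mulrC; apply: is_derive1_comp.
    by rewrite subrr mul0r.
  have [c ct E] := MVT_centered dphi (lexx `|t|).
  have -> : q i.+1 - q i = w 0 i * g i (shift_along a w (sk i c)) * t.
    by rewrite -E /phi -qS.
  rewrite (_ : _ - _ = t * (w 0 i * (g i (shift_along a w (sk i c)) - g i a))); last by ring.
  rewrite !normrM ler_wpM2l// ler_wpM2l//; apply: He => // j.
  by apply: (le_trans (skle _ _ _ ct)); exact: ltW.
rewrite -qn -q0 -telescope_sumr// big_mkord mulr_suml -sumrB.
rewrite (eq_bigr (fun i : 'I_n => q i.+1 - q i - t * (w 0 i * g i a))); last first.
  by move=> i _; rewrite [_ * t]mulrC.
apply: (le_trans (ler_norm_sum _ _ _)).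
apply: (@le_trans _ _ (\sum_(i < n) `|t| * (`|w 0 i| * (eps / W)))); first by apply: ler_sum => i _; exact: step.
rewrite -mulr_sumr -mulr_suml mulrC ler_wpM2r// mulrCA.
by rewrite ler_piMr ?(ltW eps0)// ler_pdivrMr// mul1r lerDl.
Qed.

End chain_rule.

Section relative_chain_rule.
Context {R : realType} {n : nat}.
Implicit Types (D A : set 'rV[R]_n) (f : 'rV[R]_n -> R) (a w x : 'rV[R]_n).

(** When all small steps along the axis stay in [D], the filter [rel_steps] is the punctured
    neighbourhood filter of 0, and the relative derivative is the ordinary one. *)
Lemma rel_derivable_is_derive D i f x : rel_derivable D i f x ->
  (exists2 e, 0 < e & forall h : R, `|h| < e -> D (x + h *: unit_vec i)) ->
  is_derive (0 : R) 1 (fun t : R => f (x + t *: unit_vec i)) (rel_partial D i f x).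
Proof.
move=> fx [e e0 De].
have De' : \forall h \near 0^', D (x + h *: unit_vec i).
  by near=> h; apply: De; near: h; exact: dnbhs0_lt.
have sE : rel_steps D i x = (0 : R)^'.
  apply/funext => B; apply/propext; split; rewrite /rel_steps /within /=.
    by move=> h; near=> t; apply: (near h t) => //; near: t.
  by apply: filterS => t Bt _.
have qE : (fun h : R => h^-1 *: (f (x + (h *: 1 + 0) *: unit_vec i) - f (x + 0 *: unit_vec i))) =
    rel_quotient i f x.
  by apply/funext => h; rewrite scale0r !addr0 (_ : h *: 1 = h :> R)//; exact: mulr1.
move: fx; rewrite /rel_derivable /rel_partial sE -qE => fx.
by split.
Unshelve. all: by end_near. Qed.

(** [D] governs the difference quotients and [A] carries the regularity. Only directions with
    [w 0 i != 0] need room in [D], so the line may run inside a face of the orthant. *)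
Lemma rel_is_derive_along D A f a w (e0 : R) : 0 < e0 ->
  (forall s : 'rV[R]_n, (forall j, `|s 0 j| <= e0) -> A (shift_along a w s)) ->
  (forall (s : 'rV[R]_n) i, (forall j, `|s 0 j| <= e0) -> w 0 i != 0 ->
     exists2 e, 0 < e & forall h : R, `|h| < e -> D (shift_along a w s + h *: unit_vec i)) ->
  (forall i x, A x -> rel_derivable D i f x) ->
  (forall i, {within A, continuous (rel_partial D i f)}) ->
  is_derive (0 : R) 1 (fun t : R => f (a + t *: w)) (\sum_i w 0 i * rel_partial D i f a).
Proof.
move=> e00 HA HD fd fc; apply: (@is_derive_along R n f (fun i => rel_partial D i f) a w e0) => //.
  move=> s i hs wi; apply: rel_derivable_is_derive; last exact: HD.
  by apply: fd; exact: HA.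
move=> i eps wi eps0.
have Aa : A a.
  have := HA 0; rewrite (_ : shift_along a w 0 = a); last first.
    by apply/rowP => j; rewrite !mxE mul0r addr0.
  by apply => j; rewrite mxE normr0 ltW.
have /subspace_continuousP/(_ a Aa) := fc i.
move=> /cvgrPdist_lt /(_ eps eps0); rewrite near_withinE => /nbhs_ballP[r /= r0 Hr].
pose W := \sum_j `|w 0 j| + 1.
have W0 : 0 < W by rewrite ltr_wpDl// sumr_ge0.
exists (Num.min e0 (r / (2 * W))); first by rewrite lt_min e00 divr_gt0// mulr_gt0.
move=> s hs; rewrite distrC ltW//; apply: Hr; last first.
  by apply: HA => j; apply: (le_trans (hs j)); rewrite ge_min lexx.
split => // i' j; rewrite ord1 /ball /= mxE opprD addNKr normrN normrM.
have sj : `|s 0 j| <= r / (2 * W) by apply: (le_trans (hs j)); rewrite ge_min lexx orbT.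
have wj : `|w 0 j| <= W by rewrite /W (bigD1 j)//= -addrA lerDl addr_ge0// sumr_ge0.
apply: (@le_lt_trans _ _ (r / (2 * W) * W)); first exact: ler_pM.
rewrite (_ : r / (2 * W) * W = r / 2); last by field; rewrite gt_eqF.
by lra.
Qed.

End relative_chain_rule.

(** * Cauchy-Schwarz and the operator norm *)

Section norm2.
Context {R : realType}.

Lemma norm2_ge0 n (x : 'rV[R]_n) : 0 <= norm2 x.
Proof. exact: sqrtr_ge0. Qed.

Lemma norm2_eq0 n (x : 'rV[R]_n) : norm2 x = 0 -> x = 0.
Proof.
move=> x0; apply/rowP => i; rewrite mxE; apply/eqP; rewrite -sqrf_eq0.
have := norm2_sqr x; rewrite x0 expr0n/= => /esym/eqP.
by rewrite psumr_eq0 => [/allP/(_ i (mem_index_enum _))|j _]; rewrite ?sqr_ge0.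
Qed.

Lemma norm2_le n (x : 'rV[R]_n) (r : R) : 0 <= r ->
  (norm2 x <= r) = (\sum_i x 0 i ^+ 2 <= r ^+ 2).
Proof. by move=> r0; rewrite -norm2_sqr ler_pXn2r ?nnegrE ?norm2_ge0. Qed.

Lemma dotrV_le n (x y : 'rV[R]_n) : `|dotrV x y| <= norm2 x * norm2 y.
Proof.
suff H (u v : 'rV[R]_n) : dotrV u v <= norm2 u * norm2 v.
  rewrite ler_norml H andbT lerNl.
  have -> : - dotrV x y = dotrV (- x) y.
    by rewrite /dotrV -sumrN; apply: eq_bigr => i _; rewrite mxE mulNr.
  have -> : norm2 x = norm2 (- x).
    by rewrite /norm2; congr Num.sqrt; apply: eq_bigr => i _; rewrite mxE sqrrN.
  exact: H.
have [u0|u0] := eqVneq (norm2 u) 0.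
  rewrite u0 mul0r (norm2_eq0 u0) /dotrV big1// => i _; by rewrite mxE mul0r.
have [v0|v0] := eqVneq (norm2 v) 0.
  rewrite v0 mulr0 (norm2_eq0 v0) /dotrV big1// => i _; by rewrite mxE mulr0.
have ab : 0 < norm2 u * norm2 v by rewrite mulr_gt0// lt_neqAle eq_sym ?u0 ?v0 norm2_ge0.
rewrite -(ler_pM2l ab).
have : 0 <= \sum_i (norm2 v * u 0 i - norm2 u * v 0 i) ^+ 2.
  by apply: sumr_ge0 => i _; exact: sqr_ge0.
have -> : \sum_i (norm2 v * u 0 i - norm2 u * v 0 i) ^+ 2 =
    2 * (norm2 u ^+ 2 * norm2 v ^+ 2) - 2 * (norm2 u * norm2 v * dotrV u v).
  rewrite (eq_bigr (fun i => norm2 v ^+ 2 * u 0 i ^+ 2 + norm2 u ^+ 2 * v 0 i ^+ 2 -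
    2 * (norm2 u * norm2 v) * (u 0 i * v 0 i))); last by move=> i _; ring.
  rewrite sumrB big_split /= -!mulr_sumr -!norm2_sqr /dotrV; ring.
rewrite subr_ge0 => h; rewrite -(ler_pM2l (ltr0n _ 2)); apply: (le_trans h).
by rewrite le_eqVlt; apply/orP; left; apply/eqP; ring.
Qed.

(** A real [sup] is an upper bound only for a set that is bounded above; a crude entrywise bound is
    enough to license its use in [opnorm]. *)
Lemma opnorm_has_ubound n (A : 'M[R]_n) :
  has_ubound [set norm2 (x *m A^T) | x in [set x : 'rV[R]_n | norm2 x <= 1]].
Proof.
exists (Num.sqrt (\sum_j (\sum_i `|A j i|) ^+ 2)) => _ [x /= x1 <-].
rewrite ler_wsqrtr//; apply: ler_sum => j _.
rewrite -real_normK ?num_real// lerXn2r ?nnegrE ?sumr_ge0//.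
rewrite mxE (le_trans (ler_norm_sum _ _ _))//; apply: ler_sum => i _.
rewrite mxE normrM ler_piMl//.
have : x 0 i ^+ 2 <= 1.
  have := x1; rewrite norm2_le// expr1n; apply: le_trans.
  by rewrite (bigD1 i)//= lerDl sumr_ge0// => k _; exact: sqr_ge0.
by rewrite -real_normK ?num_real// expr_le1.
Qed.

Lemma opnorm_ge0 n (A : 'M[R]_n) : 0 <= opnorm A.
Proof.
apply: (le_trans (norm2_ge0 ((0 : 'rV[R]_n) *m A^T))).
apply: ub_le_sup; first exact: opnorm_has_ubound.
exists 0 => //=; rewrite /norm2 big1 ?sqrtr0// => i _.
by rewrite mxE expr0n.
Qed.

Lemma norm2Z n (c : R) (x : 'rV[R]_n) : norm2 (c *: x) = `|c| * norm2 x.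
Proof.
rewrite /norm2 (eq_bigr (fun i => c ^+ 2 * x 0 i ^+ 2)); last first.
  by move=> i _; rewrite mxE exprMn.
by rewrite -mulr_sumr sqrtrM ?sqr_ge0// sqrtr_sqr.
Qed.

Lemma opnormP n (A : 'M[R]_n) (x : 'rV[R]_n) : norm2 (x *m A^T) <= opnorm A * norm2 x.
Proof.
have [x0|x0] := eqVneq (norm2 x) 0.
  rewrite x0 mulr0 (norm2_eq0 x0) mul0mx /norm2 big1 ?sqrtr0// => i _.
  by rewrite mxE expr0n.
have xp : 0 < norm2 x by rewrite lt_neqAle eq_sym x0 norm2_ge0.
rewrite -ler_pdivrMr// mulrC -[X in X * _]ger0_norm ?invr_ge0 ?norm2_ge0//.
rewrite -norm2Z scalemxAl; apply: ub_le_sup; first exact: opnorm_has_ubound.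
exists ((norm2 x)^-1 *: x) => //=.
by rewrite norm2Z ger0_norm ?invr_ge0 ?norm2_ge0// mulVf.
Qed.

Lemma bilinear_le n (A : 'M[R]_n) (x y : 'rV[R]_n) :
  `|\sum_i x 0 i * \sum_j y 0 j * A j i| <= opnorm A * norm2 x * norm2 y.
Proof.
rewrite (_ : \sum_i _ = dotrV y (x *m A^T)).
  rewrite (le_trans (dotrV_le _ _))// mulrC ler_wpM2r ?norm2_ge0//.
  exact: opnormP.
rewrite /dotrV; under eq_bigr do rewrite mulr_sumr.
rewrite exchange_big /=; apply: eq_bigr => j _; rewrite mxE mulr_sumr.
by apply: eq_bigr => i _; rewrite mxE; ring.
Qed.

End norm2.

Section segments.
Context {R : realType} {d : nat}.

Lemma is_derive_line (F : 'rV[R]_d -> R) (a w : 'rV[R]_d) (t D : R) :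
  is_derive (0 : R) 1 (fun u : R => F (a + t *: w + u *: w)) D ->
  is_derive t 1 (fun u : R => F (a + u *: w)) D.
Proof.
move=> H; have -> : (fun u : R => F (a + u *: w)) =
    (fun u : R => F (a + t *: w + u *: w)) \o (fun u => u - t).
  by apply/funext => u /=; congr F; rewrite -addrA -scalerDl; congr (_ + _ *: _); ring.
have D2 : is_derive t 1 (fun u : R => u - t) 1.
  by apply: is_derive_eq; rewrite subr0.
rewrite -[D]mulr1; apply: is_derive1_comp.
by rewrite subrr.
Qed.

Lemma within_continuous_line (A : set 'rV[R]_d) (F : 'rV[R]_d -> R) (a w : 'rV[R]_d) :
  {within A, continuous F} -> (forall t, 0 <= t <= 1 -> A (a + t *: w)) ->
  {within `[0, 1], continuous (fun t : R => F (a + t *: w))}.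
Proof.
move=> cF HA; apply/subspace_continuousP => t /=; rewrite in_itv/= => t01.
have /subspace_continuousP/(_ _ (HA t t01)) cFt := cF.
apply: (@cvg_comp _ _ _ (fun u : R => a + u *: w) F _ (within A (nbhs (a + t *: w)))) => //.
move=> B; rewrite /within /= => HB.
have cl : (fun u : R => a + u *: w) @ t --> a + t *: w.
  by apply: cvgD; [exact: cvg_cst|apply: cvgZr_tmp; exact: cvg_id].
apply: (@filterS _ (nbhs t) _ _ _ _ (cl _ HB)) => u /= Hu.
by rewrite in_itv/= => /HA; exact: Hu.
Qed.

Variables (D A : set 'rV[R]_d) (a w : 'rV[R]_d).
Hypothesis DE : D = orthant.
Hypothesis segA : forall s : 'rV[R]_d, (forall i, 0 <= s 0 i <= 1) -> A (shift_along a w s).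
Hypothesis segpos : forall (s : 'rV[R]_d) i, (forall j, 0 < s 0 j < 1) -> w 0 i != 0 ->
  0 < shift_along a w s 0 i.
Hypothesis AD : forall x, A x -> D x.

(** At an inner point of the segment, a box smaller than the distance of [t] to 0 and 1 stays inside
    the large box. By [segpos] every moving coordinate is positive there, which leaves room in the
    orthant on both sides. *)
Lemma is_derive_box_segment (F : 'rV[R]_d -> R) (t : R) : 0 < t < 1 ->
  (forall i x, A x -> rel_derivable D i F x) ->
  (forall i, {within A, continuous (rel_partial D i F)}) ->
  is_derive t 1 (fun u : R => F (a + u *: w))
    (\sum_i w 0 i * rel_partial D i F (a + t *: w)).
Proof.
move=> /andP[t0 t1] dF cF; apply: is_derive_line.
pose e0 := Num.min t (1 - t) / 2.
have m0 : 0 < Num.min t (1 - t) by rewrite lt_min t0 subr_gt0.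
have e00 : 0 < e0 by rewrite divr_gt0.
have mt : Num.min t (1 - t) <= t by rewrite ge_min lexx.
have mt1 : Num.min t (1 - t) <= 1 - t by rewrite ge_min lexx orbT.
have et : e0 < t by rewrite /e0; lra.
have et1 : e0 < 1 - t by rewrite /e0; lra.
have sE (s : 'rV[R]_d) : shift_along (a + t *: w) w s = shift_along a w (\row_i (t + s 0 i)).
  by apply/rowP => i; rewrite !mxE; ring.
have s01 (s : 'rV[R]_d) : (forall j, `|s 0 j| <= e0) -> forall i, 0 < (\row_i (t + s 0 i) : 'rV[R]_d) 0 i < 1.
  by move=> hs i; rewrite mxE; have := hs i; rewrite ler_norml => /andP[? ?]; apply/andP; split; lra.
apply: (@rel_is_derive_along R d D A F _ _ e0) => //.
- move=> s hs; rewrite sE; apply: segA => i.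
  by have /andP[/ltW -> /ltW ->] := s01 s hs i.
- move=> s i hs wi; rewrite sE; set y := shift_along _ _ _.
  have yi : 0 < y 0 i by apply: segpos => //; exact: s01.
  have Dy : D y by apply: AD; apply: segA => j; have /andP[/ltW -> /ltW ->] := s01 s hs j.
  exists (y 0 i) => // h hy; move: Dy; rewrite DE /orthant /= => Dy j.
  rewrite mxE [X in _ + X]mxE /unit_vec [X in _ + _ * X]mxE eqxx /=; have [->|ji] := eqVneq j i; last by rewrite mulr0 addr0.
  by rewrite mulr1; move: hy; rewrite ltr_norml => /andP[]; lra.
Qed.

End segments.

(** * The log-likelihood on the good set *)

Section good_set.
Context {R : realType} {d n : nat}.
Variables (ell : 'rV[R]_d -> R) (theta_hat : 'rV[R]_d).
Variables (delta0 delta1 C0 CS0 s2 : R).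
Hypotheses (n_gt0 : (0 < n)%N) (delta0_gt0 : 0 < delta0) (delta1_gt0 : 0 < delta1).
Hypothesis theta_hat_ge0 : orthant theta_hat.
Hypothesis delta0_small : delta0 * Num.sqrt (#|S0 theta_hat|%:R / n%:R) < C0.
Hypothesis H1 : (C0%:E <=
  ereal_inf [set `|theta_hat 0%R i|%:E | i in [set i | i \in S0 theta_hat]])%E.
Hypothesis H2 : forall t, good_set n delta0 delta1 theta_hat t ->
  loewner_ge (- submx_block (S0 theta_hat) (rel_hessian orthant ell t)) CS0%:M.
Hypothesis H4_C2 : C2_on orthant (good_set n delta0 delta1 theta_hat) ell.
Hypothesis H4_bound : (ereal_sup [set (opnorm (rel_hessian orthant ell t))%:E |
  t in good_set n delta0 delta1 theta_hat] <= s2%:E)%E.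

Local Notation S0 := (S0 theta_hat).
Local Notation S1 := (S1 theta_hat).
Local Notation good := (good_set n delta0 delta1 theta_hat).
Let r0 := delta0 * Num.sqrt (#|S0|%:R / n%:R).
Let L := delta1 / n%:R.

Lemma radius_ge0 : 0 <= r0.
Proof. by rewrite mulr_ge0 ?(ltW delta0_gt0)// sqrtr_ge0. Qed.

Lemma width_gt0 : 0 < L.
Proof. by rewrite divr_gt0// ltr0n. Qed.

Lemma S1_notin_S0 i : (i \in S1) = (i \notin S0).
Proof. by rewrite !inE -leNgt eq_le theta_hat_ge0 andbT. Qed.

Lemma theta_hat_S1 i : i \in S1 -> theta_hat 0 i = 0.
Proof. by rewrite inE => /eqP. Qed.

Lemma good_setP t : good t <->
  [/\ forall i, 0 <= t 0 i,
      \sum_(i in S0) (t 0 i - theta_hat 0 i) ^+ 2 <= r0 ^+ 2 &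
      forall i, i \in S1 -> t 0 i <= L].
Proof.
have E0 : norm2 (subvec S0 t - subvec S0 theta_hat) ^+ 2 =
    \sum_(i in S0) (t 0 i - theta_hat 0 i) ^+ 2.
  rewrite norm2_sqr [RHS]big_enum_val; apply: eq_bigr => i _; by rewrite !mxE.
have E1 : (norm2 (subvec S0 t - subvec S0 theta_hat) <= r0) =
    (\sum_(i in S0) (t 0 i - theta_hat 0 i) ^+ 2 <= r0 ^+ 2).
  by rewrite -E0 ler_pXn2r ?nnegrE ?norm2_ge0 ?radius_ge0.
have L0 := ltW width_gt0.
split; rewrite /good_set /= -/r0 -/L.
  rewrite E1 => -[t0 tS0 tS1]; split => // i iS1.
  have := tS1; rewrite [X in X <= _]mx_normrE => /bigmax_leP[_ /(_ (0, enum_rank_in iS1 i) isT)] /=.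
  rewrite !mxE enum_rankK_in// theta_hat_S1// subr0; exact: (le_trans (ler_norm _)).
move=> [t0 tS0 tS1]; split => //; first by rewrite E1.
rewrite [X in X <= _]mx_normrE; apply/bigmax_leP; split => // -[i j] _ /=.
have jS1 := enum_valP j.
by rewrite !mxE theta_hat_S1// subr0 ger0_norm ?t0// tS1.
Qed.

Lemma C0_le_theta_hat i : i \in S0 -> C0 <= theta_hat 0 i.
Proof.
move=> iS0; rewrite -lee_fin -[theta_hat 0 i]ger0_norm ?theta_hat_ge0//.
by apply: (le_trans H1); apply: ereal_inf_lbound; exists i.
Qed.

(** Each coordinate of [theta_hat] in [S0] is at least [C0], and the radius of the ball is smaller
    than [C0]: the ball does not touch the faces of the orthant. *)
Lemma ball_S0_gt0 (t : 'rV[R]_d) i : i \in S0 ->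
  \sum_(i in S0) (t 0 i - theta_hat 0 i) ^+ 2 <= r0 ^+ 2 -> 0 < t 0 i.
Proof.
move=> iS0 tS0; have := C0_le_theta_hat iS0.
have : `|t 0 i - theta_hat 0 i| <= r0.
  rewrite -(@ler_pXn2r _ 2)// ?nnegrE ?radius_ge0// real_normK ?num_real//.
  apply: le_trans tS0; rewrite (bigD1 i)//= lerDl sumr_ge0// => j _; exact: sqr_ge0.
rewrite ler_norml => /andP[h _] h2; move: delta0_small; rewrite -/r0 => h3; lra.
Qed.

Lemma good_set_of_coords (t : 'rV[R]_d) :
  \sum_(i in S0) (t 0 i - theta_hat 0 i) ^+ 2 <= r0 ^+ 2 ->
  (forall i, i \in S1 -> 0 <= t 0 i <= L) -> good t.
Proof.
move=> tS0 tS1; apply/good_setP; split => //; last by move=> i /tS1/andP[].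
move=> i; have [iS0|iS0] := boolP (i \in S0); first exact: ltW (ball_S0_gt0 iS0 tS0).
by have /tS1/andP[] : i \in S1 by rewrite S1_notin_S0.
Qed.

Lemma good_orthant t : good t -> orthant t.
Proof. by move/good_setP => -[]. Qed.

Lemma good_theta_hat : good theta_hat.
Proof.
apply: good_set_of_coords.
  by rewrite big1 ?sqr_ge0// => i _; rewrite subrr expr0n.
by move=> i /theta_hat_S1 ->; rewrite lexx ltW// width_gt0.
Qed.

Lemma hessian_bound t : good t -> opnorm (rel_hessian orthant ell t) <= s2.
Proof.
move=> gt; rewrite -lee_fin; apply: le_trans H4_bound.
by apply: ereal_sup_ubound; exists t.
Qed.

Let ell_cont : {within good, continuous ell}.
Proof. by case: H4_C2. Qed.

Let ell_der i x : good x -> rel_derivable orthant i ell x.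
Proof. by case: H4_C2 => _ /(_ i)[+ _] _; exact. Qed.

Let dell_cont i : {within good, continuous (rel_partial orthant i ell)}.
Proof. by case: H4_C2 => _ /(_ i)[_ +] _. Qed.

Let dell_der i j x : good x -> rel_derivable orthant i (rel_partial orthant j ell) x.
Proof. by case: H4_C2 => _ _ /(_ i j)[+ _] => /[apply] -[]. Qed.

Let ddell_cont i j : {within good, continuous (rel_partial orthant i (rel_partial orthant j ell))}.
Proof. by case: H4_C2 => _ _ /(_ i j)[]. Qed.

Lemma hessian_block_le t (w : 'rV[R]_d) : good t -> (forall i, i \in S1 -> w 0 i = 0) ->
  \sum_i w 0 i * \sum_j w 0 j * rel_hessian orthant ell t j i <= - CS0 * norm2 w ^+ 2.
Proof.
move=> gt w0; have := H2 gt (subvec S0 w); set H := rel_hessian _ _ _.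
have w0' i : i \notin S0 -> w 0 i = 0 by rewrite -S1_notin_S0; exact: w0.
have -> : norm2 w ^+ 2 = \sum_(i in S0) w 0 i ^+ 2.
  rewrite norm2_sqr [RHS]big_mkcond; apply: eq_bigr => i _.
  by case: ifPn => // /w0' ->; rewrite expr0n.
have -> : \sum_i w 0 i * \sum_j w 0 j * H j i =
    \sum_(i in S0) w 0 i * \sum_(j in S0) w 0 j * H j i.
  rewrite [RHS]big_mkcond; apply: eq_bigr => i _; case: ifPn => [iS0|/w0' ->]; last by rewrite mul0r.
  congr (_ * _); rewrite [RHS]big_mkcond; apply: eq_bigr => j _.
  by case: ifPn => // /w0' ->; rewrite mul0r.
suff -> : (subvec S0 w *m (- submx_block S0 H - CS0%:M) *m (subvec S0 w)^T) 0 0 =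
    - (\sum_(i in S0) w 0 i * \sum_(j in S0) w 0 j * H j i) - CS0 * \sum_(i in S0) w 0 i ^+ 2.
  by lra.
rewrite mulmxDr mulmxDl mxE !mulmxN !mulNmx; congr (_ + _).
  rewrite mxE; congr (- _); rewrite [LHS]mxE [RHS]big_enum_val /=.
  apply: eq_bigr => i _; rewrite mulrC; congr (_ * _); first by rewrite !mxE.
  by rewrite [LHS]mxE [RHS]big_enum_val /=; apply: eq_bigr => j _; rewrite !mxE.
rewrite mxE mul_mx_scalar -scalemxAl mxE; congr (- (_ * _)).
rewrite [LHS]mxE [RHS]big_enum_val /=; apply: eq_bigr => i _.
by rewrite !mxE expr2.
Qed.

(* On the slice [t_{S1} = 0], the closed ball is strictly convex, so the open
   segment joining two of its points stays away from the sphere. *)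
Lemma ell_midpoint (x y : 'rV[R]_d) : good x -> good y ->
  (forall i, i \in S1 -> x 0 i = 0) -> (forall i, i \in S1 -> y 0 i = 0) ->
  ell x + ell y + CS0 / 4 * norm2 (x - y) ^+ 2 <= 2 * ell (2^-1 *: (x + y)).
Proof.
move=> gx gy x0 y0; pose w := y - x; pose c := CS0 * norm2 w ^+ 2.
have -> : norm2 (x - y) ^+ 2 = norm2 w ^+ 2.
  by rewrite !norm2_sqr; apply: eq_bigr => i _; rewrite !mxE -sqrrN opprB.
have [wz|wn0] := eqVneq (norm2 w) 0.
  have -> : y = x by have /eqP := norm2_eq0 wz; rewrite subr_eq0 => /eqP.
  rewrite wz expr0n/= mulr0 addr0 (_ : 2^-1 *: (x + x) = x); last first.
    by apply/rowP => i; rewrite !mxE; field.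
  by rewrite mulrDl mul1r.
have wS1 i : i \in S1 -> w 0 i = 0 by move=> iS1; rewrite !mxE y0// x0// subrr.
have [_ xball _] := (good_setP x).1 gx.
have [_ yball _] := (good_setP y).1 gy.
have nw : norm2 w ^+ 2 = \sum_(i in S0) w 0 i ^+ 2.
  rewrite norm2_sqr [RHS]big_mkcond; apply: eq_bigr => i _.
  by case: ifPn => //; rewrite -S1_notin_S0 => /wS1 ->; rewrite expr0n.
have nw0 : 0 < norm2 w ^+ 2 by rewrite lt_neqAle eq_sym sqrf_eq0 wn0 sqr_ge0.
pose u t i := x 0 i + t * w 0 i - theta_hat 0 i.
(* The parallelogram-type identity quantifies strict convexity: the point at parameter [t] has slack
   [t (1 - t) |w| ^ 2] in the squared radius. *)
have uball t : \sum_(i in S0) u t i ^+ 2 =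
    (1 - t) * (\sum_(i in S0) (x 0 i - theta_hat 0 i) ^+ 2) +
    t * (\sum_(i in S0) (y 0 i - theta_hat 0 i) ^+ 2) - t * (1 - t) * norm2 w ^+ 2.
  rewrite nw !mulr_sumr -sumrN -!big_split /=; apply: eq_bigr => i _.
  by rewrite /u !mxE; ring.
have ule (t : R) : 0 <= t <= 1 -> \sum_(i in S0) u t i ^+ 2 <= r0 ^+ 2 - t * (1 - t) * norm2 w ^+ 2.
  by move=> /andP[t0 t1]; rewrite uball; nra.
have gseg (t : R) : 0 <= t <= 1 -> good (x + t *: w).
  move=> t01; apply: good_set_of_coords.
    rewrite (eq_bigr (fun i => u t i ^+ 2)); last by move=> i _; rewrite /u !mxE.
    apply: (le_trans (ule t t01)); rewrite gerBl mulr_ge0// ?(ltW nw0)//.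
    by case/andP: t01 => ? ?; rewrite mulr_ge0// subr_ge0.
  by move=> i iS1; rewrite mxE [X in _ + X]mxE wS1// x0// mulr0 addr0 lexx ltW// width_gt0.
have der (F : 'rV[R]_d -> R) (t : R) : 0 < t < 1 ->
    (forall i x, good x -> rel_derivable orthant i F x) ->
    (forall i, {within good, continuous (rel_partial orthant i F)}) ->
    is_derive t 1 (fun v : R => F (x + v *: w))
      (\sum_i w 0 i * rel_partial orthant i F (x + t *: w)).
  move=> /andP[t0 t1] dF cF; apply: is_derive_line.
  pose sl := t * (1 - t) * norm2 w ^+ 2.
  have sl0 : 0 < sl by apply: mulr_gt0 => //; apply: mulr_gt0 => //; rewrite subr_gt0.
  (* For [e0 <= 1], moving each coordinate by a fraction at most [e0] changes the squared radius by
     less than [e0 Q], and [e0] is chosen so that this does not exceed the slack. *)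
  pose Q := 2 * (\sum_(i in S0) `|u t i * w 0 i|) + norm2 w ^+ 2 + 1.
  have S00 : 0 <= \sum_(i in S0) `|u t i * w 0 i| by exact: sumr_ge0.
  have Q0 : 0 < Q by rewrite /Q; lra.
  pose e0 := Num.min 1 (sl / Q).
  have e00 : 0 < e0 by rewrite lt_min ltr01 divr_gt0.
  have e01 : e0 <= 1 by rewrite ge_min lexx.
  have eQ : e0 * Q <= sl by rewrite -ler_pdivlMr// ge_min lexx orbT.
  have sgood (s : 'rV[R]_d) : (forall j, `|s 0 j| <= e0) -> good (shift_along (x + t *: w) w s).
    move=> hs; apply: good_set_of_coords; last first.
      by move=> i iS1; rewrite !mxE x0// y0// subrr !mulr0 !addr0 lexx ltW// width_gt0.
    rewrite (eq_bigr (fun i => (u t i + s 0 i * w 0 i) ^+ 2)); last first.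
      by move=> i _; rewrite !mxE /u !mxE; congr (_ ^+ 2); ring.
    apply: (@le_trans _ _ (\sum_(i in S0) (u t i ^+ 2 + (2 * e0 * `|u t i * w 0 i| + e0 * w 0 i ^+ 2)))).
      apply: ler_sum => i _; rewrite sqrrD -addrA lerD2l; apply: lerD.
        rewrite -mulr_natl -mulrA ler_wpM2l// (le_trans (ler_norm _))//.
        by rewrite mulrCA normrM ler_wpM2r.
      rewrite exprMn ler_wpM2r ?sqr_ge0// -real_normK ?num_real// expr2.
      by rewrite -[leRHS]mulr1 ler_pM// (le_trans (hs i)).
    rewrite !big_split /= -!mulr_sumr -nw.
    have tt : 0 <= t <= 1 by rewrite !ltW.
    by have := ule t tt; rewrite -/sl; rewrite /Q in eQ; nra.
  apply: (@rel_is_derive_along R d orthant good F _ _ e0) => // s i hs wi.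
  have iS0 : i \in S0.
    by apply: contraNT wi; rewrite -S1_notin_S0 => /wS1 ->.
  set z := shift_along _ _ _; have gz : good z by exact: sgood.
  have [z0 zball _] := (good_setP z).1 gz.
  have zi : 0 < z 0 i := ball_S0_gt0 iS0 zball.
  exists (z 0 i) => // h hz j.
  rewrite mxE [X in _ + X]mxE /unit_vec [X in _ + _ * X]mxE eqxx /=.
  have [->|ji] := eqVneq j i; last by rewrite mulr0 addr0.
  by rewrite mulr1; move: hz; rewrite ltr_norml => /andP[]; lra.
pose g t := ell (x + t *: w).
pose p t := \sum_i w 0 i * rel_partial orthant i ell (x + t *: w).
have dg (t : R) : 0 < t < 1 -> is_derive t 1 g (p t) by move=> t01; exact: der.
have dp (t : R) : 0 < t < 1 -> exists2 q, is_derive t 1 p q & q <= - c.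
  move=> t01; exists (\sum_i w 0 i * \sum_j w 0 j * rel_hessian orthant ell (x + t *: w) j i); last first.
    have /andP[t0 t1] := t01.
    have gt : good (x + t *: w) by apply: gseg; rewrite !ltW.
    by rewrite /c -mulNr; exact: hessian_block_le.
  have -> : p = \sum_i (fun v : R => w 0 i * rel_partial orthant i ell (x + v *: w)).
    by apply/funext => v; rewrite fct_sumE.
  apply: is_derive_sum => i.
  have := der (rel_partial orthant i ell) t t01 (fun j z => @dell_der j i z) (fun j => @ddell_cont j i).
  move=> D1; apply: is_derive_eq; apply: (congr1 (fun z => w 0 i * z)).
  by apply: eq_bigr => j _; rewrite /rel_hessian mxE.
(* As [g'' <= - c], the function [phi] is concave. Two mean values on the halves of [0, 1], and a
   third one for [p] between them, give [phi 0 + phi 1 <= 2 phi (1 / 2)]; the quadratic part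
   accounts for [c / 4]. *)
pose phi t := g t + c / 2 * t ^+ 2.
have dphi (t : R) : 0 < t < 1 -> is_derive t 1 phi (p t + c * t).
  move=> t01; have D1 := dg t t01; apply: is_derive_eq.
  rewrite /GRing.scale /=; by field.
have cg : {within `[0, 1], continuous g} by apply: within_continuous_line.
have cphi : {within `[0, 1], continuous phi}.
  have c2 : {within `[0, 1], continuous (fun t : R => c / 2 * t ^+ 2)}.
    apply: continuous_subspaceT => v.
    by apply: cvgM; [exact: cvg_cst|exact: exprn_continuous].
  by move=> t; apply: cvgD; [exact: cg|exact: c2].
have sub1 : {within `[0, 2^-1], continuous phi}.
  apply: continuous_subspaceW cphi => t /=; rewrite !in_itv/= => /andP[-> h].
  by rewrite (le_trans h)// invf_le1// ler1n.
have sub2 : {within `[2^-1, 1], continuous phi}.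
  apply: continuous_subspaceW cphi => t /=; rewrite !in_itv/= => /andP[h ->].
  by rewrite (le_trans _ h)// invr_ge0.
have h1 : (0 : R) < 2^-1 by rewrite invr_gt0.
have h2 : (2^-1 : R) < 1 by rewrite invf_lt1// ltr1n.
have [|x1 /[!in_itv]/= /andP[x10 x1h] E1] := MVT h1 (df := fun t => p t + c * t) _ sub1.
  by move=> t; rewrite in_itv/= => /andP[t0 th]; apply: dphi; rewrite t0 (lt_trans th).
have [|x2 /[!in_itv]/= /andP[x2h x21] E2] := MVT h2 (df := fun t => p t + c * t) _ sub2.
  by move=> t; rewrite in_itv/= => /andP[th t1]; apply: dphi; rewrite t1 andbT (lt_trans _ th).
have x12 : x1 < x2 by exact: lt_trans x2h.
have hp (t : R) : 0 < t < 1 -> {q : R | is_derive t 1 p q & q <= - c}.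
  by move=> /dp; exact: cid2.
(* The second derivative is only known to exist inside ]0, 1[; the value 0 elsewhere is a
   default. *)
pose q (t : R) := match pselect (0 < t < 1) with left h => s2val (hp t h) | right _ => 0 end.
have dq (t : R) : 0 < t < 1 -> is_derive t 1 p (q t) /\ q t <= - c.
  by move=> t01; rewrite /q; case: pselect => // h; case: (hp t h).
have in01 (t : R) : x1 <= t <= x2 -> 0 < t < 1.
  by move=> /andP[a1 a2]; rewrite (lt_le_trans x10)//= (le_lt_trans a2).
have [| |x3 /[!in_itv]/= /andP[x31 x32] E3] := MVT x12 (f := p) (df := q).
- by move=> t; rewrite in_itv/= => /andP[a1 a2]; apply: (dq t _).1; apply: in01; rewrite !ltW.
- apply: derivable_within_continuous => t; rewrite in_itv/= => t12.
  by have [? _] := dq t (in01 t t12); exact: ex_derive.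
have qx3 : q x3 <= - c by apply: (dq x3 _).2; apply: in01; rewrite !ltW.
have mono : p x2 + c * x2 <= p x1 + c * x1 by nra.
have gx0 : g 0 = ell x by rewrite /g scale0r addr0.
have gy1 : g 1 = ell y by rewrite /g scale1r addrC subrK.
have gm : g 2^-1 = ell (2^-1 *: (x + y)).
  by rewrite /g; congr ell; apply/rowP => i; rewrite !mxE; field.
move: E1 E2; rewrite /phi gx0 gy1 gm !expr2 subr0 !mulr0 addr0 mulr1 => E1 E2.
have : c / 2 * (2^-1 * 2^-1) = c / 8 by field.
have : (1 - 2^-1 : R) = 2^-1 by field.
rewrite -/c (_ : CS0 / 4 * _ = c / 4); last by rewrite /c; field.
move=> e1 e2; rewrite e1 e2 in E2; rewrite e2 in E1.
by lra.
Qed.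

Definition zero_S1 (z : 'rV[R]_d) : 'rV[R]_d :=
  \row_i (if i \in S0 then z 0 i else 0).

(** Two mean values. The first, along [y = z - zero_S1 z], expresses the increment of [ell] by its
    gradient at an intermediate point. The second, along the segment from [theta_hat] to that point,
    compares this gradient with the one at [theta_hat] through the Hessian. The lengths of the two
    vectors are at most [L sqrt #|S1|] and [r0 + L sqrt #|S1|]. *)
Lemma ell_linearization (z : 'rV[R]_d) : good z ->
  `|ell z - ell (zero_S1 z) -
    \sum_(j in S1) z 0 j * rel_partial orthant j ell theta_hat| <=
  s2 * (r0 * L * Num.sqrt #|S1|%:R + L ^+ 2 * #|S1|%:R).
Proof.
move=> gz; have [z0 zball zL] := (good_setP z).1 gz.
set x := zero_S1 z; pose y := z - x.
have xS0 i : i \in S0 -> x 0 i = z 0 i by move=> iS0; rewrite mxE iS0.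
have xS1 i : i \in S1 -> x 0 i = 0 by rewrite S1_notin_S0 mxE => /negbTE ->.
have yS0 i : i \in S0 -> y 0 i = 0 by move=> iS0; rewrite /y mxE [X in _ + X]mxE xS0// subrr.
have yS1 i : i \in S1 -> y 0 i = z 0 i by move=> iS1; rewrite /y mxE [X in _ + X]mxE xS1// subr0.
have L0 := ltW width_gt0.
have S01 i : (i \in S0) \/ (i \in S1) by rewrite S1_notin_S0; case: (i \in S0); [left|right].
have zS1 i : y 0 i != 0 -> i \in S1 /\ 0 < z 0 i.
  move=> yi; have [/yS0 E|iS1] := S01 i; first by rewrite E eqxx in yi.
  by split => //; rewrite lt_neqAle z0 andbT eq_sym -(yS1 i).
have shE (a w s : 'rV[R]_d) i : shift_along a w s 0 i = a 0 i + s 0 i * w 0 i by rewrite mxE.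
have segA1 (s : 'rV[R]_d) : (forall i, 0 <= s 0 i <= 1) -> good (shift_along x y s).
  move=> s01; apply: good_set_of_coords.
    rewrite (eq_bigr (fun i => (z 0 i - theta_hat 0 i) ^+ 2))// => i iS0.
    by rewrite shE yS0// mulr0 addr0 xS0.
  move=> i iS1; rewrite shE xS1// yS1// add0r; have /andP[a b] := s01 i.
  rewrite mulr_ge0//= -[leRHS]mul1r; apply: ler_pM => //; exact: zL.
have segpos1 (s : 'rV[R]_d) i : (forall j, 0 < s 0 j < 1) -> y 0 i != 0 ->
    0 < shift_along x y s 0 i.
  move=> s01 /zS1[iS1 zi]; rewrite shE xS1// yS1// add0r mulr_gt0//.
  by have /andP[] := s01 i.
pose p t := \sum_i y 0 i * rel_partial orthant i ell (x + t *: y).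
have dg (t : R) : t \in `]0, 1[ -> is_derive t 1 (fun u : R => ell (x + u *: y)) (p t).
  rewrite in_itv/= => t01.
  exact: (is_derive_box_segment erefl segA1 segpos1 good_orthant t01 ell_der dell_cont).
have shift_line (a w : 'rV[R]_d) (t : R) : a + t *: w = shift_along a w (const_mx t).
  by apply/rowP => i; rewrite !mxE.
have line_good (a w : 'rV[R]_d) (t : R) :
    (forall s : 'rV[R]_d, (forall i, 0 <= s 0 i <= 1) -> good (shift_along a w s)) ->
    0 <= t <= 1 -> good (a + t *: w).
  by move=> H t01; rewrite shift_line; apply: H => i; rewrite mxE.
have cg : {within `[0, 1], continuous (fun u : R => ell (x + u *: y))}.
  by apply: (within_continuous_line ell_cont) => t; exact: line_good.
have [tau tau01 Etau] := MVT ltr01 dg cg.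
rewrite in_itv/= in tau01.
pose W := x + tau *: y - theta_hat.
have WS0 i : i \in S0 -> W 0 i = z 0 i - theta_hat 0 i.
  by move=> iS0; rewrite /W mxE [X in _ + X]mxE mxE [X in _ + X - _]mxE yS0// mulr0 addr0 xS0.
have WS1 i : i \in S1 -> W 0 i = tau * z 0 i.
  move=> iS1; rewrite /W mxE [X in _ + X]mxE mxE [X in _ + X - _]mxE yS1// xS1// add0r.
  by rewrite theta_hat_S1// subr0.
have /andP[tau0 tau1] := tau01.
(* The box issues from the centre of the ball, so shrinking each coordinate separately keeps it in
   the ball. Similarly, the first box moves only coordinates of [S1], which the ball does not
   constrain. *)
have segA2 (s : 'rV[R]_d) : (forall i, 0 <= s 0 i <= 1) -> good (shift_along theta_hat W s).
  move=> s01; apply: good_set_of_coords.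
    apply: le_trans zball; apply: ler_sum => i iS0.
    rewrite shE WS0// addrC addKr exprMn -[leRHS]mul1r ler_wpM2r ?sqr_ge0//.
    by have /andP[? ?] := s01 i; rewrite expr_le1.
  move=> i iS1; rewrite shE WS1// theta_hat_S1// add0r; have /andP[a b] := s01 i.
  have t0 := ltW tau0; have t1 := ltW tau1.
  rewrite !mulr_ge0//= -[leRHS]mul1r ler_pM ?mulr_ge0//.
  by rewrite -[leRHS]mul1r ler_pM// zL.
have segpos2 (s : 'rV[R]_d) i : (forall j, 0 < s 0 j < 1) -> W 0 i != 0 ->
    0 < shift_along theta_hat W s 0 i.
  move=> s01; have [iS0 _|iS1] := S01 i.
    have gs : good (shift_along theta_hat W s).
      by apply: segA2 => j; have /andP[/ltW -> /ltW ->] := s01 j.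
    by have [_ sball _] := (good_setP _).1 gs; exact: ball_S0_gt0 sball.
  rewrite WS1// mulf_eq0 negb_or => /andP[_ zi]; rewrite shE WS1// theta_hat_S1// add0r.
  have /andP[si _] := s01 i; rewrite mulr_gt0// mulr_gt0//.
  by rewrite lt_neqAle eq_sym zi z0.
pose m t := \sum_i y 0 i * rel_partial orthant i ell (theta_hat + t *: W).
pose dm t := \sum_i y 0 i * \sum_j W 0 j * rel_hessian orthant ell (theta_hat + t *: W) j i.
have dmP (t : R) : t \in `]0, 1[ -> is_derive t 1 m (dm t).
  rewrite in_itv/= => t01.
  have -> : m = \sum_i (fun v : R => y 0 i * rel_partial orthant i ell (theta_hat + v *: W)).
    by apply/funext => v; rewrite fct_sumE.
  apply: is_derive_sum => i.
  have D1 := is_derive_box_segment erefl segA2 segpos2 good_orthant t01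
    (fun j u => @dell_der j i u) (fun j => @ddell_cont j i).
  apply: is_derive_eq; apply: (congr1 (fun v => y 0 i * v)).
  by apply: eq_bigr => j _; rewrite /rel_hessian mxE.
have cm : {within `[0, 1], continuous m}.
  have -> : m = \sum_i (fun v : R => y 0 i * rel_partial orthant i ell (theta_hat + v *: W)).
    by apply/funext => v; rewrite fct_sumE.
  apply: (big_ind (fun h : R -> R => {within `[0, 1], continuous h})).
  - exact: continuous_subspaceT (@cst_continuous _ _ 0).
  - by move=> h1 h2 c1 c2 t; apply: cvgD; [exact: c1|exact: c2].
  - move=> i _ t; apply: cvgM; first exact: cvg_cst.
    have c := @within_continuous_line R d good (rel_partial orthant i ell) theta_hat W (@dell_cont i).
    by apply: c => u; exact: line_good.
have [sg sg01 Esg] := MVT ltr01 dmP cm.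
rewrite in_itv/= in sg01.
have m1 : m 1 = p tau.
  by apply: eq_bigr => i _; rewrite scale1r /W addrC subrK.
have m0 : m 0 = \sum_(j in S1) z 0 j * rel_partial orthant j ell theta_hat.
  rewrite [RHS]big_mkcond; apply: eq_bigr => i _; rewrite scale0r addr0.
  have [iS0|iS1] := S01 i; last by rewrite iS1 yS1.
  by rewrite S1_notin_S0 iS0 yS0// mul0r.
rewrite subr0 mulr1 in Etau; rewrite subr0 mulr1 in Esg.
rewrite scale1r scale0r addr0 (_ : x + y = z) in Etau; last by rewrite /y addrC subrK.
rewrite Etau -m1 -m0 Esg.
apply: (le_trans (bilinear_le _ _ _)).
have gsg : good (theta_hat + sg *: W).
  by apply: (line_good _ _ _ segA2); case/andP: sg01 => /ltW -> /ltW ->.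
clear dg cg dmP cm m1 m0 Etau Esg segpos1 segA1 segpos2 segA2 line_good shift_line p shE m.
pose Y := L * Num.sqrt #|S1|%:R.
have Y0 : 0 <= Y by rewrite mulr_ge0// sqrtr_ge0.
have Y2 : Y ^+ 2 = L ^+ 2 * #|S1|%:R by rewrite exprMn sqr_sqrtr.
have split_sum (h : 'I_d -> R) : \sum_i h i = \sum_(i in S0) h i + \sum_(i in S1) h i.
  rewrite (bigID (mem S0))/=; congr (_ + _).
  by apply: eq_bigl => i; rewrite S1_notin_S0.
have zsum : \sum_(i in S1) z 0 i ^+ 2 <= Y ^+ 2.
  rewrite Y2 mulr_natr -sumr_const; apply: ler_sum => i iS1.
  by rewrite ler_pXn2r ?nnegrE// zL.
have yY : norm2 y <= Y.
  rewrite norm2_le// split_sum big1 ?add0r; last by move=> i iS0; rewrite yS0// expr0n.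
  by apply: le_trans zsum; apply: ler_sum => i iS1; rewrite yS1.
have WY : norm2 W <= r0 + Y.
  rewrite norm2_le ?addr_ge0 ?radius_ge0// split_sum.
  have h1 : \sum_(i in S0) W 0 i ^+ 2 <= r0 ^+ 2.
    by apply: le_trans zball; apply: ler_sum => i iS0; rewrite WS0.
  have h2 : \sum_(i in S1) W 0 i ^+ 2 <= Y ^+ 2.
    apply: le_trans zsum; apply: ler_sum => i iS1; rewrite WS1// exprMn.
    by rewrite -[leRHS]mul1r ler_wpM2r ?sqr_ge0// exprn_ile1// ltW.
  have : 0 <= r0 * Y by rewrite mulr_ge0 ?radius_ge0.
  by rewrite sqrrD mulr2n; lra.
apply: (@le_trans _ _ (s2 * Y * (r0 + Y))).
  apply: ler_pM; rewrite ?mulr_ge0 ?norm2_ge0 ?opnorm_ge0//.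
  by apply: ler_pM; rewrite ?norm2_ge0 ?opnorm_ge0// hessian_bound.
by rewrite -Y2 /Y le_eqVlt; apply/orP; left; apply/eqP; ring.
Qed.

End good_set.

(** * Measurability and test functions *)

Section measurability.
Context {R : realType}.

(** Reconciles the topology of the sup norm with the sigma-algebra generated by the entries: an open
    set is the union of the rational cubes it contains, enumerated through [unpickle]. *)
Lemma open_measurable_rV n (U : set 'rV[R]_n) : open U -> measurable U.
Proof.
move=> oU.
pose cube (p : 'rV[rat]_n * nat) : set 'rV[R]_n :=
  boxset (fun i => `](ratr (p.1 0 i) - p.2.+1%:R^-1)%R, (ratr (p.1 0 i) + p.2.+1%:R^-1)%R[%classic).
have mcube p : measurable (cube p) by apply: measurable_boxset => i.
have UE : U = \bigcup_m (if unpickle m is Some p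
    then if `[< cube p `<=` U >] then cube p else set0 else set0).
  apply/seteqP; split => x; last first.
    by move=> [m _]; case: (unpickle m) => // p; case: asboolP => // h /h.
  move=> Ux; have /nbhs_ballP[r /= r0 xr] : nbhs x U by apply: open_nbhs_nbhs.
  have [k kr] : exists k : nat, k.+1%:R^-1 < r / 2.
    exists (Num.trunc (r / 2)^-1); rewrite invf_plt ?posrE ?divr_gt0//.
    exact: truncnS_gt.
  have : 0 < k.+1%:R^-1 :> R by rewrite invr_gt0.
  move: kr; set e := k.+1%:R^-1 => kr e0.
  have /choice[q qx] : forall i : 'I_n, exists q : rat, `|x 0 i - ratr q| < e.
    move=> i; have [|q] := @rat_in_itvoo R (x 0 i - e) (x 0 i + e).
      by lra.
    rewrite in_itv/= => /andP[h1 h2]; exists q; rewrite ltr_norml; apply/andP; split; lra.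
  pose p : 'rV[rat]_n * nat := (\row_i q i, k).
  have cx : cube p x.
    by move=> i /=; rewrite in_itv/= mxE -ltr_distl; exact: qx.
  exists (pickle p) => //; rewrite pickleK asboolT// => y cy.
  apply: xr; split => // i j; rewrite ord1 /ball /=.
  have := cy j; rewrite /= in_itv/= mxE -ltr_distl -/e => h1; have h2 := qx j.
  rewrite (_ : x 0 j - y 0 j = (x 0 j - ratr (q j)) - (y 0 j - ratr (q j))); last by ring.
  by rewrite (le_lt_trans (ler_normB _ _))//; lra.
rewrite UE; apply: bigcupT_measurable => m.
by case: (unpickle m) => // p; case: ifP.
Qed.

Lemma within_continuous_measurable_rV n (A : set 'rV[R]_n) (f : 'rV[R]_n -> R) :
  measurable A -> {within A, continuous f} -> measurable_fun A f.
Proof.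
move=> mA /continuousP cf; apply: (measurability _ (RGenOpens.measurableE R)).
move=> _ [_ [a [b ->] <-]].
have /open_subspaceP[V oV VA] := cf _ (@interval_open R (BRight a) (BLeft b) isT isT).
rewrite setIC -VA; apply: measurableI => //; exact: open_measurable_rV.
Qed.

Lemma continuous_measurable_rV n (f : 'rV[R]_n -> R) :
  continuous f -> measurable_fun setT f.
Proof.
move=> cf; apply: within_continuous_measurable_rV => //.
exact: continuous_subspaceT.
Qed.

(** Log-concavity makes every superlevel set an interval; no continuity is used, and none need hold
    at the endpoint 0. *)
Lemma log_concave_measurable (A : set R) (f : R -> R) :
  is_interval A -> log_concave_on A f -> measurable_fun A f.
Proof.
move=> iA [f0 fc]; have mA := is_interval_measurable iA.
apply: (measurability _ (RGenCInfty.measurableE R)).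
move=> _ [_ [c ->] <-]; apply: is_interval_measurable => x y [Ax fx] [Ay fy] z /andP[xz zy].
have Az : A z by apply: (iA x y) => //; rewrite xz.
split => //; move: fx fy; rewrite /= !in_itv/= !andbT => fx fy.
have [c0|c0] := leP c 0; first exact: le_trans (f0 z Az).
have [zx|xz'] := eqVneq z x; first by rewrite zx.
have xy : x < y by rewrite (lt_le_trans _ zy)// lt_neqAle eq_sym xz' xz.
pose t := (y - z) / (y - x).
have t0 : 0 <= t by rewrite divr_ge0 ?subr_ge0// ltW.
have t1 : t <= 1 by rewrite ler_pdivrMr ?subr_gt0// mul1r lerD2l lerN2.
have t10 : 0 <= 1 - t by rewrite subr_ge0.
have zE : t * x + (1 - t) * y = z by rewrite /t; field; rewrite subr_eq0 gt_eqF.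
have := fc x y t Ax Ay; rewrite t0 t1 zE => /(_ isT); apply: le_trans.
have cE : c = c `^ t * c `^ (1 - t).
  rewrite -powRD ?(gt_eqF c0) ?implybT//.
  by rewrite addrC subrK powRr1// ltW.
rewrite [leLHS]cE; apply: ler_pM; rewrite ?powR_ge0//.
  by apply: ge0_ler_powR; rewrite // nnegrE ?(ltW c0) ?f0.
by apply: ge0_ler_powR; rewrite // nnegrE ?(ltW c0) ?f0.
Qed.

Lemma log_concave_midpoint (A : set R) (f : R -> R) x y :
  log_concave_on A f -> A x -> A y -> f x * f y <= f (2^-1 * (x + y)) ^+ 2.
Proof.
move=> [f0 fc] Ax Ay; have h01 : 0 <= (2^-1 : R) <= 1.
  by rewrite invr_ge0 ler0n invf_le1// ler1n.
have := fc x y 2^-1 Ax Ay h01.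
have -> : (1 - 2^-1 : R) = 2^-1 by field.
rewrite -mulrDr => h; have h0 : 0 <= f x `^ 2^-1 * f y `^ 2^-1 by rewrite mulr_ge0 ?powR_ge0.
have -> : f x * f y = (f x `^ 2^-1 * f y `^ 2^-1) ^+ 2.
  by rewrite exprMn -!powR_mulrn ?powR_ge0// -!powRrM mulVf// !powRr1 ?f0.
by rewrite ler_pXn2r ?nnegrE// (le_trans h0).
Qed.

End measurability.

Section smooth_tame.
Context {R : realType} {n : nat}.

Lemma rel_quotient_derive (i : 'I_n) (f : 'rV[R]_n -> R) x :
  rel_quotient i f x @ rel_steps setT i x =
  (fun h => h^-1 *: ((f \o shift x) (h *: unit_vec i) - f x)) @ (0 : R)^'.
Proof.
have -> : rel_steps setT i x = (0 : R)^'.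
  apply/funext => B; apply/propext; split; rewrite /rel_steps /within /=.
    by apply: filterS => t /(_ I).
  by apply: filterS => t Bt _.
suff -> : rel_quotient i f x =
    (fun h => h^-1 *: ((f \o shift x) (h *: unit_vec i) - f x)) by [].
by apply/funext => h; rewrite /rel_quotient /= (addrC (h *: _)).
Qed.

Lemma rel_partial_setT (i : 'I_n) (f : 'rV[R]_n -> R) x :
  rel_partial setT i f x = 'D_(unit_vec i) f x.
Proof. by rewrite /rel_partial rel_quotient_derive. Qed.

Lemma rel_derivable_setT (i : 'I_n) (f : 'rV[R]_n -> R) x :
  derivable f x (unit_vec i) -> rel_derivable setT i f x.
Proof. by rewrite /rel_derivable rel_quotient_derive. Qed.

(** For [D = setT] the relative derivatives are the ordinary ones, so the staircase chain rule also
    serves the test functions. *)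
Lemma is_derive_line_C1 (f : 'rV[R]_n -> R) (a w : 'rV[R]_n) (t : R) :
  (forall i x, derivable f x (unit_vec i)) ->
  (forall i, continuous (fun x => 'D_(unit_vec i) f x)) ->
  is_derive t 1 (fun u : R => f (a + u *: w))
    (\sum_i w 0 i * 'D_(unit_vec i) f (a + t *: w)).
Proof.
move=> df cf; apply: is_derive_line.
rewrite (eq_bigr (fun i => w 0 i * rel_partial setT i f (a + t *: w))); last first.
  by move=> i _; rewrite rel_partial_setT.
apply: (@rel_is_derive_along R n setT setT f _ _ 1) => //.
- by move=> s i _ _; exists 1.
- by move=> i x _; exact: rel_derivable_setT.
- move=> i; apply: continuous_subspaceT.
  by rewrite (_ : rel_partial setT i f = fun x => 'D_(unit_vec i) f x); [exact: cf|apply/funext => x; exact: rel_partial_setT].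
Qed.

Lemma continuous_bounded_box (K : R) (f : 'rV[R]_n -> R) : continuous f ->
  exists M, forall x, in_box K x -> `|f x| <= M.
Proof.
move=> cf.
have cK : compact [set x : 'rV[R]_n | forall i, `[- K, K]%classic (x ord0 i)].
  exact: (rV_compact (fun _ : 'I_n => @segment_compact R (- K) K)).
have : compact (f @` [set x : 'rV[R]_n | forall i, `[- K, K]%classic (x ord0 i)]).
  by apply: continuous_compact => //; exact: continuous_subspaceT.
move=> /compact_bounded[M [_ HM]]; exists (M + 1) => x xK.
apply: (HM (M + 1)); first by rewrite ltrDl.
by exists x => // i /=; rewrite in_itv/= -ler_norml; exact: xK.
Qed.

(** The box is compact and convex. One mean value along the segment and another for each partial
    derivative bound the Taylor remainder by the suprema of the second derivatives. *)
Lemma smooth_tame (K : R) (f : 'rV[R]_n -> R) : smooth f -> tame K f (gradient f).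
Proof.
move=> sf.
have cf : continuous f by have [] := sf [::].
have df i x : derivable f x (unit_vec i) by have [_] := sf [::]; exact.
have cdf i : continuous (fun x => 'D_(unit_vec i) f x) by have [] := sf [:: i].
have ddf i j x : derivable (fun x => 'D_(unit_vec i) f x) x (unit_vec j).
  by have [_] := sf [:: i]; exact.
have cddf i j : continuous (fun x => 'D_(unit_vec j) (fun y => 'D_(unit_vec i) f y) x).
  by have [] := sf [:: j; i].
split; first exact: continuous_measurable_rV.
  move=> i; rewrite (_ : (fun x => _) = fun x => 'D_(unit_vec i) f x).
    exact: continuous_measurable_rV.
  by apply/funext => x; rewrite mxE.
have [M0 HM0] := continuous_bounded_box K cf.
have /choice[M1 HM1] : forall i, exists M, forall x, in_box K x -> `|'D_(unit_vec i) f x| <= M.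
  by move=> i; exact: continuous_bounded_box.
have /choice[M2 HM2] : forall ij : 'I_n * 'I_n, exists M, forall x, in_box K x ->
    `|'D_(unit_vec ij.2) (fun y => 'D_(unit_vec ij.1) f y) x| <= M.
  by move=> [i j]; exact: continuous_bounded_box.
pose N1 := \sum_i `|M1 i|; pose N2 := \sum_i \sum_j `|M2 (i, j)|.
have N10 : 0 <= N1 by exact: sumr_ge0.
have N20 : 0 <= N2 by apply: sumr_ge0 => i _; exact: sumr_ge0.
exists (`|M0| + N1 + N2) => x xK; split.
- by rewrite (le_trans (HM0 x xK))// (le_trans (ler_norm M0))// -addrA lerDl addr_ge0.
- move=> i; rewrite mxE (le_trans (HM1 i x xK))// (le_trans (ler_norm _))//.
  apply: (@le_trans _ _ N1); first by rewrite /N1 (bigD1 i)//= lerDl sumr_ge0.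
  by rewrite addrAC lerDr addr_ge0.
move=> y yK; pose w := y - x.
have lineK (t : R) : 0 <= t <= 1 -> in_box K (x + t *: w).
  move=> /andP[t0 t1] i; rewrite !mxE.
  have -> : x 0 i + t * (y 0 i - x 0 i) = (1 - t) * x 0 i + t * y 0 i by ring.
  rewrite (le_trans (ler_normD _ _))// !normrM (ger0_norm t0) (ger0_norm (x := 1 - t)) ?subr_ge0//.
  have := xK i; have := yK i; have t10 : 0 <= 1 - t by rewrite subr_ge0.
  by nra.
have wle i : `|w 0 i| <= norm2 w.
  rewrite -(@ler_pXn2r _ 2)// ?nnegrE ?norm2_ge0// norm2_sqr real_normK ?num_real//.
  by rewrite (bigD1 i)//= lerDl sumr_ge0// => j _; exact: sqr_ge0.
have cphi (g : 'rV[R]_n -> R) (t : R) : continuous g ->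
    {within `[0, t], continuous (fun u : R => g (x + u *: w))}.
  move=> cg; apply: continuous_subspaceT => u.
  apply: continuous_comp; last exact: cg.
  by apply: cvgD; [exact: cvg_cst|apply: cvgZr_tmp; exact: cvg_id].
have [tau /[!in_itv]/= /andP[tau0 tau1] E1] :=
  MVT ltr01 (fun t _ => is_derive_line_C1 x w t df cdf) (cphi _ 1 cf).
rewrite subr0 mulr1 scale1r scale0r addr0 (_ : x + w = y) in E1; last by rewrite /w addrC subrK.
rewrite E1 /dotrV (_ : _ - _ = \sum_i w 0 i *
    ('D_(unit_vec i) f (x + tau *: w) - 'D_(unit_vec i) f x)); last first.
  rewrite -sumrB; apply: eq_bigr => i _; rewrite mulrBr; congr (_ - _).
  by rewrite [gradient f x 0 i]mxE mulrC.
apply: (@le_trans _ _ (\sum_(i < n) norm2 w * ((\sum_j `|M2 (i, j)|) * norm2 w))).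
  apply: (le_trans (ler_norm_sum _ _ _)); apply: ler_sum => i _.
  rewrite normrM ler_pM//.
  have [sg /[!in_itv]/= /andP[sg0 sg1] E2] :=
    MVT tau0 (fun t _ => is_derive_line_C1 x w t (ddf i) (cddf i)) (cphi _ tau (cdf i)).
  rewrite subr0 scale0r addr0 in E2; rewrite E2 normrM (gtr0_norm tau0).
  apply: (@le_trans _ _ (`|\sum_i0 w 0 i0 * 'D_(unit_vec i0) (fun z => 'D_(unit_vec i) f z) (x + sg *: w)|)).
    by rewrite ler_piMr// ltW.
  apply: (le_trans (ler_norm_sum _ _ _)); rewrite mulr_suml; apply: ler_sum => j _.
  rewrite normrM mulrC ler_pM// (le_trans (HM2 (i, j) _ _)) ?ler_norm//.
  by apply: lineK; rewrite (ltW sg0) (ltW (lt_trans sg1 tau1)).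
rewrite -mulr_sumr -mulr_suml -/N2 mulrCA -expr2 ler_wpM2r ?sqr_ge0//.
by rewrite lerDr addr_ge0.
Qed.

End smooth_tame.

(** * Integration against a measure with density *)

Section density.
Context {R : realType} d (T : measurableType d).
Variables (mu nu : {measure set T -> \bar R}) (g : T -> \bar R).
Hypotheses (mg : measurable_fun setT g) (g0 : forall x, (0 <= g x)%E).
Hypothesis nuE : forall A, measurable A -> (nu A = \int[mu]_(x in A) g x)%E.

Import HBNNSimple.

Let integral_density_nnsfun (h : {nnsfun T >-> R}) :
  (\int[nu]_x (h x)%:E = \int[mu]_x ((h x)%:E * g x))%E.
Proof.
under [LHS]eq_integral do rewrite fimfunE -fsumEFin//.
rewrite [LHS]ge0_integral_fsum//; last 2 first.
  - by move=> r; exact/measurable_EFinP/measurableT_comp.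
  - by move=> n x _; rewrite EFinM nnfun_muleindic_ge0.
under [RHS]eq_integral.
  move=> x xD; rewrite fimfunE -fsumEFin// muleC ge0_mule_fsumr; last first.
    by move=> r; rewrite EFinM nnfun_muleindic_ge0.
  over.
rewrite [RHS]ge0_integral_fsum//; last 2 first.
  - move=> r; apply: emeasurable_funM => //.
    by apply/measurable_EFinP; do 2 apply/measurableT_comp => //.
  - by move=> n x _; rewrite EFinM mule_ge0// nnfun_muleindic_ge0.
apply: eq_fsbigr => r _; rewrite integralZl_indic_nnsfun//= integral_indic// setIT.
have mhr : measurable (h @^-1` [set r]) by exact: measurable_sfunP.
rewrite nuE// integral_mkcond.
have [r0|r0] := ltP r 0.
  rewrite preimage_nnfun0// patch_set0 integral0 mule0 integral0_eq// => x _.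
  by rewrite indic0 mulr0 mule0.
rewrite -ge0_integralZl//; last 2 first.
- exact: ((measurable_restrictT g mhr).1 (measurable_funTS mg)).
- by move=> x _; rewrite patchE; case: ifP.
apply: eq_integral => x _; rewrite patchE indicE; case: ifPn => xr.
  by rewrite mulr1 muleC.
by rewrite mulr0 !mule0.
Qed.

Lemma ge0_integral_density (f : T -> \bar R) : measurable_fun setT f ->
  (forall x, 0 <= f x)%E -> (\int[nu]_x f x = \int[mu]_x (f x * g x))%E.
Proof.
move=> mf f0; pose f_ := nnsfun_approx measurableT mf.
transitivity (limn (fun n => \int[nu]_x (f_ n x)%:E)%E).
  rewrite -monotone_convergence//=.
  - apply: eq_integral => x _; apply/esym/cvg_lim => //=.
    exact: cvg_nnsfun_approx.
  - by move=> n; apply/measurable_EFinP.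
  - by move=> n x _; rewrite lee_fin.
  - by move=> x _ a b ab; rewrite lee_fin; exact/lefP/nd_nnsfun_approx.
under eq_fun do rewrite integral_density_nnsfun.
rewrite -monotone_convergence//=.
- apply: eq_integral => x _; apply/cvg_lim => //=.
  have fcvg := cvg_nnsfun_approx measurableT mf (fun x _ => f0 x) (I : setT x).
  (* Limits of products in the extended reals exclude the form [0 * oo], so points where [g] or [f]
     vanishes are treated first. *)
  have [->|gx0] := eqVneq (g x) 0%E.
    by rewrite mule0; apply: cvg_near_cst; apply: nearW => k; rewrite mule0.
  have [fx0|fx0] := eqVneq (f x) 0%E.
    rewrite fx0 mul0e; apply: cvg_near_cst; apply: nearW => k.
    suff -> : f_ k x = 0 by rewrite mul0e.
    apply/eqP; rewrite eq_le fun_ge0 andbT -lee_fin.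
    by have := le_approx k (fun x _ => f0 x) (I : setT x); rewrite fx0 -nnsfun_approxE.
  apply: cvgeM => //; last exact: cvg_cst.
  by rewrite mule_defE negb_or (negbTE gx0) (negbTE fx0).
- by move=> n; apply: emeasurable_funM => //; exact/measurable_EFinP.
- by move=> n x _; rewrite mule_ge0// lee_fin.
- by move=> x _ a b ab; rewrite lee_wpmul2r// lee_fin; exact/lefP/nd_nnsfun_approx.
Qed.

End density.

(** * Perturbation and variance *)

Section perturbation.
Context {R : realType}.
Local Notation lam := (@lebesgue_measure R).

Lemma weighted_poincare1_le (K C C' : R) (v : R -> R) : (forall s, 0 <= v s) ->
  C <= C' -> weighted_poincare1 K v C -> weighted_poincare1 K v C'.
Proof.
move=> v0 CC' P f g fg; have [c Hc] := P f g fg; exists c.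
apply: (le_trans Hc); rewrite lee_wpmul2r ?lee_fin// integral_ge0// => x _.
by rewrite lee_fin mulr_ge0 ?sqr_ge0.
Qed.

Lemma weighted_poincare_le (K C C' : R) n (w : 'rV[R]_n -> R) : (forall x, 0 <= w x) ->
  C <= C' -> weighted_poincare K w C -> weighted_poincare K w C'.
Proof.
move=> w0 CC' P f g fg; have [c Hc] := P f g fg; exists c.
apply: (le_trans Hc); rewrite lee_wpmul2r ?lee_fin// integral_ge0// => x _.
by rewrite lee_fin mulr_ge0 ?sqr_ge0.
Qed.

Section reindex.
Variables (d m : nat) (sigma : 'I_d -> 'I_m) (tau : 'I_m -> 'I_d).
Hypotheses (sigmaK : cancel sigma tau) (tauK : cancel tau sigma).
Local Notation P := (@reindex_rV R d m sigma).

Lemma norm2_sqr_reindex (z : 'rV[R]_m) : norm2 (P z) ^+ 2 = norm2 z ^+ 2.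
Proof.
rewrite !norm2_sqr [RHS](reindex sigma)/=; last exact/onW_bij/(Bijective sigmaK tauK).
by apply: eq_bigr => i _; rewrite mxE.
Qed.

Lemma tame_reindex (K : R) (f : 'rV[R]_d -> R) G : tame K f G ->
  tame K (fun z => f (P z)) (fun z => \row_k G (P z) 0 (tau k)).
Proof.
move=> [mf mG [M HM]]; have mP := @measurable_reindex_rV R d m sigma.
split.
- exact: (measurableT_comp mf mP).
- move=> i; under eq_fun do rewrite mxE.
  exact: (measurableT_comp (mG (tau i)) mP).
exists M => z zK.
have PK (u : 'rV[R]_m) : in_box K u -> in_box K (P u) by move=> uK i; rewrite mxE.
have [h1 h2 h3] := HM _ (PK z zK); split => //; first by move=> i; rewrite mxE.
move=> y yK; have := h3 _ (PK y yK).
have -> : P y - P z = P (y - z) by apply/rowP => i; rewrite !mxE.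
rewrite norm2_sqr_reindex.
suff -> : dotrV (G (P z)) (P (y - z)) = dotrV (\row_k G (P z) 0 (tau k)) (y - z) by [].
rewrite /dotrV [RHS](reindex sigma)/=; last exact/onW_bij/(Bijective sigmaK tauK).
by apply: eq_bigr => i _; rewrite [P (y - z) 0 i]mxE [X in _ = X * _]mxE sigmaK.
Qed.

(* Holley-Stroock: both integrals change by at most a factor [expR D]. *)
Lemma weighted_poincare_perturb (K C D : R) (w : 'rV[R]_d -> R) (W : 'rV[R]_m -> R) :
  0 <= C -> measurable_fun setT w -> (forall x, 0 <= w x) ->
  measurable_fun setT W -> (forall z, 0 <= W z) ->
  (forall z, expR (- D) * W z <= w (P z) <= expR D * W z) ->
  weighted_poincare K W C -> weighted_poincare K w (C * expR (2 * D)).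
Proof.
move=> C0 mw w0 mW W0 wW PW f G fG; have [c Hc] := PW _ _ (tame_reindex fG); exists c.
have [mf mG _] := fG; have mP := @measurable_reindex_rV R d m sigma.
have sbij : bijective sigma by exists tau.
have mfc : measurable_fun setT (fun x => (f x - c) ^+ 2).
  by apply: measurable_funX; apply: measurable_funB.
have mg := measurable_norm2_sqr mG.
have GE z : norm2 (\row_k G (P z) 0 (tau k)) ^+ 2 = norm2 (G (P z)) ^+ 2.
  rewrite -norm2_sqr_reindex; congr (norm2 _ ^+ 2).
  by apply/rowP => i; rewrite !mxE sigmaK.
have IE : (\int[lebesgue_rV m]_z (norm2 (\row_k G (P z) 0%R (tau k)) ^+ 2 * W z)%:E =
    \int[lebesgue_rV m]_z (norm2 (G (P z)) ^+ 2 * W z)%:E)%E.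
  by apply: eq_integral => z _; rewrite GE.
rewrite IE in Hc.
have h0 (h : 'rV[R]_d -> R) z : (forall x, 0 <= h x) -> (0 <= (h (P z) * W z)%:E)%E.
  by move=> h0; rewrite lee_fin mulr_ge0.
rewrite (integral_reindex_rV sbij)//; last 2 first.
- by apply/measurable_EFinP; exact: measurable_funM.
- by move=> x; rewrite lee_fin mulr_ge0// sqr_ge0.
rewrite [X in (_ <= _ * X)%E](integral_reindex_rV sbij)//; last 2 first.
- by apply/measurable_EFinP; exact: measurable_funM.
- by move=> x; rewrite lee_fin mulr_ge0// sqr_ge0.
have mhP (h : 'rV[R]_d -> R) : measurable_fun setT h -> measurable_fun setT (fun z => h (P z)).
  by move=> mh; exact: (measurableT_comp mh mP).
have mWE (h : 'rV[R]_d -> R) : measurable_fun setT h ->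
    measurable_fun setT (fun z => (h (P z) * W z)%:E).
  by move=> mh; apply/measurable_EFinP; apply: measurable_funM => //; exact: mhP.
have mwE (h : 'rV[R]_d -> R) : measurable_fun setT h ->
    measurable_fun setT (fun z => (h (P z) * w (P z))%:E).
  by move=> mh; apply/measurable_EFinP; apply: measurable_funM; exact: mhP.
have eD0 : 0 <= expR D by exact: expR_ge0.
have sq0 x : 0 <= (f x - c) ^+ 2 by exact: sqr_ge0.
have gq0 x : 0 <= norm2 (G x) ^+ 2 by exact: sqr_ge0.
apply: (@le_trans _ _ ((expR D)%:E * \int[lebesgue_rV m]_z ((f (P z) - c) ^+ 2 * W z)%:E)%E).
  rewrite -ge0_integralZl_EFin//; last 2 first.
  - by move=> z _; exact: (h0 (fun x => (f x - c) ^+ 2)).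
  - exact: (mWE (fun x => (f x - c) ^+ 2)).
  apply: ge0_le_integral => //.
  - by move=> z _; rewrite lee_fin mulr_ge0.
  - exact: (mwE (fun x => (f x - c) ^+ 2)).
  - by apply: emeasurable_funM => //; exact: (mWE (fun x => (f x - c) ^+ 2)).
  move=> z _; rewrite -EFinM lee_fin mulrCA ler_wpM2l//.
  by have /andP[] := wW z.
have wle : (\int[lebesgue_rV m]_z (norm2 (G (P z)) ^+ 2 * W z)%:E <=
    (expR D)%:E * \int[lebesgue_rV m]_z (norm2 (G (P z)) ^+ 2 * w (P z))%:E)%E.
  rewrite -ge0_integralZl_EFin//; last 2 first.
  - by move=> z _; rewrite lee_fin mulr_ge0.
  - exact: (mwE (fun x => norm2 (G x) ^+ 2)).
  apply: ge0_le_integral => //.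
  - by move=> z _; rewrite lee_fin mulr_ge0.
  - exact: (mWE (fun x => norm2 (G x) ^+ 2)).
  - by apply: emeasurable_funM => //; exact: (mwE (fun x => norm2 (G x) ^+ 2)).
  move=> z _; rewrite -EFinM lee_fin mulrCA ler_wpM2l//.
  have /andP[h _] := wW z.
  by rewrite -ler_pdivrMl ?expR_gt0// -expRN.
apply: (@le_trans _ _ ((expR D)%:E * (C%:E * ((expR D)%:E *
    \int[lebesgue_rV m]_z (norm2 (G (P z)) ^+ 2 * w (P z))%:E)))%E).
  apply: lee_wpmul2l; first by rewrite lee_fin.
  by apply: (le_trans Hc); apply: lee_wpmul2l; rewrite ?lee_fin.
rewrite !muleA -!EFinM (_ : expR D * C * expR D = C * expR (2 * D))//.
by rewrite (_ : 2 * D = D + D) ?expRD; ring.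
Qed.

End reindex.
End perturbation.

Section variance.
Context {R : realType} d (T : measurableType d) (nu : probability T R).

(** Bias-variance with weight 1, at the centres 0 and [c]. Boundedness of [f] makes the extended
    subtraction on the left an honest one. *)
Lemma variance_le_second_moment (f : T -> R) (M c : R) :
  measurable_fun setT f -> (forall x, `|f x| <= M) ->
  (\int[nu]_x (f x ^+ 2)%:E - (\int[nu]_x (f x)%:E) ^+ 2 <=
   \int[nu]_x ((f x - c) ^+ 2)%:E)%E.
Proof.
move=> mf fM; pose v : T -> R := cst 1.
have vint : (\int[nu]_x (v x)%:E = 1)%E.
  rewrite (_ : (fun x => (v x)%:E) = cst 1%E)// integral_cst// mul1e.
  exact: probability_setT.
have v_gt0 : (0 < \int[nu]_x (v x)%:E)%E by rewrite vint lte01.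
have v_fin : (\int[nu]_x (v x)%:E < +oo)%E by rewrite vint ltry.
have mv : measurable_fun setT v by exact: measurable_cst.
have v0 x : 0 <= v x by exact: ler01.
have fM' x : v x != 0 -> `|f x| <= M by move=> _; exact: fM.
have AE : (\int[nu]_x v x)%R = 1 by rewrite /Rintegral vint.
have BV k := wmean_bias_variance mv v0 v_gt0 v_fin k mf fM'.
have wE (h : T -> R) : (\int[nu]_x (h x * v x)%:E = \int[nu]_x (h x)%:E)%E.
  by apply: eq_integral => x _; rewrite mulr1.
have mean : (\int[nu]_x (f x)%:E = (wmean nu v f)%:E)%E.
  by rewrite -wE (wmean_integral_EFin mv v0 v_gt0 v_fin mf fM') AE mul1r.
have := BV 0; have := BV c; rewrite !wE AE !mul1r.
under [X in _ -> X = _ -> _]eq_integral do rewrite subr0.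
move=> -> ->; rewrite mean subr0 -EFin_expe addeK ?fin_numE//.
by rewrite leeDl// lee_fin sqr_ge0.
Qed.

End variance.

Section test_functions.
Context {R : realType} {n : nat}.

Lemma compactly_supported_bounded (f : 'rV[R]_n -> R) :
  continuous f -> compactly_supported f -> exists M, forall x, `|f x| <= M.
Proof.
move=> cf; rewrite /compactly_supported => cS.
have : compact (f @` closure [set x | f x != 0]).
  by apply: continuous_compact => //; exact: continuous_subspaceT.
move=> /compact_bounded[M [_ HM]]; exists (`|M| + 1) => x.
have [->|fx] := eqVneq (f x) 0; first by rewrite normr0 addr_ge0.
apply: (HM (`|M| + 1)); first by rewrite (le_lt_trans (ler_norm M))// ltrDl.
by exists x => //; exact: subset_closure.
Qed.

End test_functions.

(** * Finite oscillation of the log-prior as two-sided bounds *)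

Section oscillation.
Context {R : realType}.

(** One point with [p > 0] excludes supremum [-oo] and infimum [+oo], so finite oscillation makes
    both extrema of [lne p] finite. [m] and [B] are their exponentials. In particular [p] vanishes
    nowhere on the interval, as [lne 0] is [-oo]. *)
Lemma osc_lne_bounds (L : R) (p : R -> R) : 0 <= L ->
  (exists2 x, 0 <= x <= L & 0 < p x) -> (forall x, 0 <= x <= L -> 0 <= p x) ->
  osc [set x | 0 <= x <= L] (fun x => lne (p x)%:E) != +oo%E ->
  exists m B, [/\ 0 < m, forall x, 0 <= x <= L -> m <= p x <= B &
    expeR (osc [set x | 0 <= x <= L] (fun x => lne (p x)%:E)) = (B / m)%:E].
Proof.
move=> L0 [x0 x0L px0] p0; rewrite /osc.
set S := [set lne (p x)%:E | x in _].
have Sx x : 0 <= x <= L -> S (lne (p x)%:E) by move=> xL; exists x.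
have lnE x : 0 < p x -> lne (p x)%:E = (ln (p x))%:E by move=> px; rewrite /lne leNgt px.
have sup_ge : ((ln (p x0))%:E <= ereal_sup S)%E.
  by apply: ereal_sup_ubound; rewrite -lnE//; exact: Sx.
have inf_le : (ereal_inf S <= (ln (p x0))%:E)%E.
  by apply: ereal_inf_lbound; rewrite -lnE//; exact: Sx.
case Es : (ereal_sup S) sup_ge => [s| |] //; last first.
  by move=> _; case Ei : (ereal_inf S) inf_le.
case Ei : (ereal_inf S) inf_le => [i| |] // _ _ _.
have pos x : 0 <= x <= L -> 0 < p x.
  move=> xL; rewrite lt_neqAle p0// andbT eq_sym; apply/eqP => px.
  have := ereal_inf_lbound (Sx x xL); rewrite Ei px /lne lexx.
  by [].
exists (expR i), (expR s); split.
- exact: expR_gt0.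
- move=> x xL; have px := pos x xL.
  rewrite -[p x]lnK ?posrE// !ler_expR -!lee_fin -Ei -Es -lnE//.
  by rewrite ereal_inf_lbound ?ereal_sup_ubound//; exact: Sx.
- by rewrite -EFinB /= expRB.
Qed.

End oscillation.

(** * The posterior on the good set *)

Section good_weight.
Context {R : realType} {d n : nat}.
Local Notation lam := (@lebesgue_measure R).
Variables (ell : 'rV[R]_d -> R) (prior : 'I_d -> R -> R) (theta_hat : 'rV[R]_d).
Variables (delta0 delta1 C0 CS0 CS1 s2 : R).
Hypotheses (n_gt0 : (0 < n)%N) (delta0_gt0 : 0 < delta0) (delta1_gt0 : 0 < delta1).
Hypothesis prior_log_concave : forall j, log_concave_on [set x | 0 <= x] (prior j).
Hypothesis theta_hat_ge0 : orthant theta_hat.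
Hypothesis delta0_small : delta0 * Num.sqrt (#|S0 theta_hat|%:R / n%:R) < C0.
Hypothesis H1 : (C0%:E <=
  ereal_inf [set `|theta_hat 0%R i|%:E | i in [set i | i \in S0 theta_hat]])%E.
Hypothesis CS0_gt0 : 0 < CS0.
Hypothesis H2 : forall t, good_set n delta0 delta1 theta_hat t ->
  loewner_ge (- submx_block (S0 theta_hat) (rel_hessian orthant ell t)) CS0%:M.
Hypothesis CS1_gt0 : 0 < CS1.
Hypothesis H3 : forall j, j \in S1 theta_hat -> rel_partial orthant j ell theta_hat <= - CS1.
Hypothesis H4_C2 : C2_on orthant (good_set n delta0 delta1 theta_hat) ell.
Hypothesis H4_bound : (ereal_sup [set (opnorm (rel_hessian orthant ell t))%:E |
  t in good_set n delta0 delta1 theta_hat] <= s2%:E)%E.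

Local Notation S0 := (S0 theta_hat).
Local Notation S1 := (S1 theta_hat).
Local Notation good := (good_set n delta0 delta1 theta_hat).
Let r0 := delta0 * Num.sqrt (#|S0|%:R / n%:R).
Let L := delta1 / n%:R.
Let D := n%:R * (s2 * (r0 * L * Num.sqrt #|S1|%:R + L ^+ 2 * #|S1|%:R)).
(** A box containing the good set; the summand 1 gives the strict [L < K] that the Hardy inequality
    requires. *)
Let K := 1 + L + r0 + \sum_i `|theta_hat 0 i|.

Let n0 : 0 < n%:R :> R.
Proof. by rewrite ltr0n. Qed.

Let L_gt0 : 0 < L.
Proof. exact: width_gt0. Qed.

Let r0_ge0 : 0 <= r0.
Proof. exact: (radius_ge0 theta_hat). Qed.

Let mgood : measurable good := measurable_good_set n delta0 delta1 theta_hat.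

(** The prior is constrained only on the half-line. Cutting it to 0 elsewhere makes it measurable
    and nonnegative everywhere; [lg] below does the same for [ell] off the good set. *)
Let pr (j : 'I_d) : R -> R := (prior j) \_ [set x | 0 <= x].

Let prE j x : 0 <= x -> pr j x = prior j x.
Proof. by move=> x0; rewrite /pr patchE mem_set. Qed.

Let pr_ge0 j x : 0 <= pr j x.
Proof.
by rewrite /pr patchE; case: ifPn => // /set_mem h; have [+ _] := prior_log_concave j; exact.
Qed.

Let measurable_pr j : measurable_fun setT (pr j).
Proof.
have iA : is_interval [set x : R | 0 <= x].
  by move=> x y /= x0 _ z /andP[xz _]; exact: le_trans xz.
apply/(measurable_restrictT _ (is_interval_measurable iA)).
exact: log_concave_measurable.
Qed.

Let lg : 'rV[R]_d -> R := ell \_ good.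

Let lgE t : good t -> lg t = ell t.
Proof. by move=> gt; rewrite /lg patchE mem_set. Qed.

Let measurable_lg : measurable_fun setT lg.
Proof.
apply/(measurable_restrictT _ mgood); apply: within_continuous_measurable_rV => //.
by case: H4_C2.
Qed.

Definition good_weight (t : 'rV[R]_d) : R :=
  \1_good t * (\prod_j pr j (t 0 j)) * expR (n%:R * lg t).

Lemma good_weightE t :
  good_weight t = \1_good t * posterior_weight n ell prior t.
Proof.
rewrite /good_weight /posterior_weight -mulrA.
have [gt|ngt] := pselect (good t); last by rewrite indicE memNset// !mul0r.
rewrite lgE//; congr (_ * (_ * _)); apply: eq_bigr => j _.
by rewrite prE// (good_orthant n_gt0 delta0_gt0 delta1_gt0 gt).
Qed.

Lemma measurable_good_weight : measurable_fun setT good_weight.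
Proof.
apply: measurable_funM; first apply: measurable_funM.
- exact: measurable_indic.
- apply: measurable_prod => j _; apply: measurableT_comp => //; exact: measurable_entry.
- by apply: measurableT_comp => //; exact: measurable_funM.
Qed.

Lemma good_weight_ge0 t : 0 <= good_weight t.
Proof. by rewrite mulr_ge0 ?expR_ge0// mulr_ge0// prodr_ge0. Qed.

(** Enumerates [S1] before [S0], matching [prod_weight], whose one-dimensional factors come
    first. *)
Let tauI (k : 'I_(#|S1| + #|S0|)) : 'I_d :=
  match fintype.split k with inl a => enum_val a | inr b => enum_val b end.

Let tauI_l (a : 'I_#|S1|) : tauI (lshift _ a) = enum_val a.
Proof. by rewrite /tauI -[lshift _ a]/(unsplit (inl a)) unsplitK. Qed.

Let tauI_r (b : 'I_#|S0|) : tauI (rshift _ b) = enum_val b.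
Proof. by rewrite /tauI -[rshift _ b]/(unsplit (inr b)) unsplitK. Qed.

Let S1E := S1_notin_S0 theta_hat_ge0.

Let tauI_bij : bijective tauI.
Proof.
apply: inj_card_bij.
  move=> k1 k2; case: (split_ordP k1) => a ->; case: (split_ordP k2) => b ->;
    rewrite ?tauI_l ?tauI_r.
  - by move=> /enum_val_inj ->.
  - by move=> E; have := enum_valP a; rewrite S1E E enum_valP.
  - by move=> E; have := enum_valP b; rewrite S1E -E enum_valP.
  - by move=> /enum_val_inj ->.
rewrite !card_ord -[leqLHS](card_ord d) -(cardsC S0) addnC leq_add2r.
by apply: subset_leq_card; apply/fintype.subsetP => i; rewrite inE S1E.
Qed.

Let prod_split (h : 'I_d -> R) : \prod_j h j =
  (\prod_(a < #|S1|) h (enum_val a)) * (\prod_(b < #|S0|) h (enum_val b)).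
Proof.
rewrite (bigID (mem S1))/= big_enum_val; congr (_ * _).
rewrite -big_enum_val /=; apply: eq_bigl => j; by rewrite S1E negbK.
Qed.

Variables (m B : 'I_d -> R) (beta : R).
Hypothesis m_gt0 : forall j, j \in S1 -> 0 < m j.
Hypothesis mB : forall j, j \in S1 -> forall x, 0 <= x <= L -> m j <= prior j x <= B j.
Hypothesis beta_ge : forall j, j \in S1 -> B j / m j <= beta.

Let slope (j : 'I_d) : R := rel_partial orthant j ell theta_hat.

Let v (a : 'I_#|S1|) (y : R) : R :=
  \1_(`[0, L]%classic) y * pr (enum_val a) y * expR (n%:R * slope (enum_val a) * y).

Let vE a y : 0 <= y <= L -> v a y = prior (enum_val a) y * expR (n%:R * slope (enum_val a) * y).
Proof.
by move=> yL; rewrite /v indicE mem_set /= ?in_itv//= mul1r prE//; case/andP: yL.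
Qed.

Let v_out a y : ~~ (0 <= y <= L) -> v a y = 0.
Proof. by move=> yL; rewrite /v indicE memNset /= ?in_itv ?mul0r//=; exact/negP. Qed.

Let measurable_v a : measurable_fun setT (v a).
Proof.
apply: measurable_funM; first by apply: measurable_funM => //; exact: measurable_indic.
by apply: measurableT_comp => //; exact: measurable_funM.
Qed.

Let v_ge0 a y : 0 <= v a y.
Proof. by rewrite mulr_ge0 ?expR_ge0// mulr_ge0. Qed.

Let v_supp a y : v a y != 0 -> `|y| <= K.
Proof.
have [/andP[y0 yL] _|/v_out ->] := boolP (0 <= y <= L); last by rewrite eqxx.
have : 0 <= \sum_i `|theta_hat 0 i| by exact: sumr_ge0.
have := r0_ge0; rewrite ger0_norm// /K; lra.
Qed.

Let slope_lt0 (a : 'I_#|S1|) : slope (enum_val a) <= - CS1.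
Proof. by apply: H3; exact: enum_valP. Qed.

Let rate_gt0 (a : 'I_#|S1|) : 0 < - (n%:R * slope (enum_val a)).
Proof. by rewrite -mulrN mulr_gt0//; have := CS1_gt0; have := slope_lt0 a; lra. Qed.

Let v_bounds a y : 0 <= y <= L ->
  m (enum_val a) * expR (- (- (n%:R * slope (enum_val a)) * y)) <= v a y <=
  B (enum_val a) * expR (- (- (n%:R * slope (enum_val a)) * y)).
Proof.
move=> yL; rewrite vE// mulNr opprK.
by have /andP[h1 h2] := mB (enum_valP a) yL; rewrite !ler_wpM2r ?expR_ge0.
Qed.

Let v_poincare a : weighted_poincare1 K (v a) (4 / (n%:R ^+ 2 * CS1 ^+ 2) * beta).
Proof.
pose j : 'I_d := enum_val a; have jS1 : j \in S1 := enum_valP a.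
have mj := m_gt0 jS1.
have LK : 0 < L < K.
  rewrite L_gt0/= /K; have : 0 <= \sum_i `|theta_hat 0 i| by exact: sumr_ge0.
  have := r0_ge0; lra.
apply: weighted_poincare1_le (weighted_poincare1_exponential LK (rate_gt0 a) mj
  (measurable_v a) (@v_out a) (@v_bounds a)) => //.
have B0 : 0 <= B j / m j.
  have h0 : 0 <= (0 : R) <= L by rewrite lexx ltW.
  have /andP[h1 h2] := mB jS1 h0.
  by rewrite divr_ge0 ?ltW// (lt_le_trans mj)// (le_trans h1).
have nC : 0 < n%:R * CS1 by rewrite mulr_gt0.
have nr : n%:R * CS1 <= - (n%:R * slope j).
  (* The decay rate is at least [n CS1], and the Hardy constant decreases with the rate. *)
  by rewrite -mulrN ler_pM2l//; have := slope_lt0 a; rewrite -/j; lra.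
rewrite -/j; set s := - (n%:R * slope j) in nr *.
have s0 : 0 < s by exact: lt_le_trans nr.
have -> : 4 * B j / (s ^+ 2 * m j) = 4 * (B j / m j) * (s ^+ 2)^-1.
  by field; rewrite !gt_eqF.
have -> : 4 / (n%:R ^+ 2 * CS1 ^+ 2) * beta = 4 * beta * ((n%:R * CS1) ^+ 2)^-1.
  by field; rewrite !gt_eqF.
apply: ler_pM.
- by rewrite mulr_ge0.
- by rewrite invr_ge0 sqr_ge0.
- by rewrite ler_pM2l// beta_ge.
- by rewrite lef_pV2 ?posrE ?exprn_gt0// ler_pXn2r ?nnegrE ?(ltW nC) ?(ltW s0).
Qed.

Let v_integral a :
  (0 < \int[lam]_y (v a y)%:E < +oo)%E.
Proof.
pose j : 'I_d := enum_val a; have jS1 : j \in S1 := enum_valP a.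
(* The slope being negative, the exponential is smallest at [y = L]; this gives a positive lower
   bound on the whole interval. *)
have mj := m_gt0 jS1; set c := m j * expR (n%:R * slope j * L).
have c0 : 0 < c by rewrite mulr_gt0// expR_gt0.
have h0 : 0 <= (0 : R) <= L by rewrite lexx ltW.
have B0 : 0 <= B j.
  by have /andP[h1 h2] := mB jS1 h0; rewrite ltW// (lt_le_trans mj)// (le_trans h1).
have restr (h : R -> R) : (forall y, h y = \1_(`[0, L]%classic) y * h y) ->
    (\int[lam]_y (h y)%:E =
     \int[lam]_(y in `[0%R, L]) (h y)%:E)%E.
  move=> hE; rewrite [RHS]integral_mkcond; apply: eq_integral => y _.
  by rewrite patchE {1}hE indicE; case: (y \in _); rewrite ?mul1r ?mul0r.
have vr : (\int[lam]_y (v a y)%:E =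
     \int[lam]_(y in `[0%R, L]) (v a y)%:E)%E.
  apply: restr => y; rewrite /v !mulrA; congr (_ * _ * _).
  by rewrite indicE; case: (y \in _); rewrite ?mul1r ?mul0r.
have lL : (lam `[0%R, L] = L%:E)%E.
  by rewrite lebesgue_measure_itv/= lte_fin L_gt0 sube0.
have cst_int (k : R) : (\int[lam]_(y in `[0%R, L]) k%:E = (k * L)%:E)%E.
  rewrite (_ : (fun _ => k%:E) = cst k%:E)// integral_cst//.
  by rewrite EFinM; congr (_ * _)%E; exact: lL.
rewrite vr; apply/andP; split.
  apply: (@lt_le_trans _ _ (\int[lam]_(y in `[0%R, L]) c%:E)%E).
    by rewrite cst_int lte_fin mulr_gt0.
  apply: ge0_le_integral => //.
  - by move=> y _; rewrite lee_fin ltW.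
  - apply/measurable_EFinP; exact: (measurable_funTS (measurable_v a)).
  move=> y /=; rewrite in_itv/= => yL; rewrite lee_fin.
  have /andP[h _] := v_bounds a yL; apply: le_trans h.
  rewrite mulNr opprK ler_pM2l// ler_expR -subr_ge0 -mulrBr.
  rewrite mulr_le0//; first by have := rate_gt0 a; rewrite -/j; lra.
  by case/andP: yL => _; rewrite subr_le0.
apply: (@le_lt_trans _ _ (\int[lam]_(y in `[0%R, L]) (B j)%:E)%E); last first.
  by rewrite cst_int ltry.
apply: ge0_le_integral => //.
- by move=> y _; rewrite lee_fin.
- apply/measurable_EFinP; exact: (measurable_funTS (measurable_v a)).
move=> y /=; rewrite in_itv/= => yL; rewrite lee_fin.
have /andP[_ h] := v_bounds a yL; apply: (le_trans h).
rewrite -[leRHS]mulr1 ler_wpM2l// mulNr opprK -[leRHS]expR0 ler_expR.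
case/andP: yL => y0 _; apply: mulr_le0_ge0 => //.
by have := rate_gt0 a; rewrite -/j; lra.
Qed.

Section slice.
Variable sigma : 'I_d -> 'I_(#|S1| + #|S0|).
Hypotheses (tauK : cancel tauI sigma) (sigmaK : cancel sigma tauI).

Let sigma_S1 (a : 'I_#|S1|) : sigma (enum_val a) = lshift _ a.
Proof. by rewrite -tauI_l tauK. Qed.

Let sigma_S0 (b : 'I_#|S0|) : sigma (enum_val b) = rshift _ b.
Proof. by rewrite -tauI_r tauK. Qed.

Let emb (x : 'rV[R]_#|S0|) : 'rV[R]_d := reindex_rV sigma (row_mx 0 x).

Let emb_S1 x j : j \in S1 -> emb x 0 j = 0.
Proof.
move=> jS1; rewrite -(enum_rankK_in jS1 jS1).
by rewrite mxE sigma_S1 row_mxEl mxE.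
Qed.

Let emb_S0 x (b : 'I_#|S0|) : emb x 0 (enum_val b) = x 0 b.
Proof. by rewrite mxE sigma_S0 row_mxEr. Qed.

Let measurable_emb : measurable_fun setT emb.
Proof.
apply: measurable_fun_entryP => i j; rewrite ord1.
under eq_fun do rewrite mxE.
case: (split_ordP (sigma j)) => k ->.
  by under eq_fun do rewrite row_mxEl mxE; exact: measurable_cst.
by under eq_fun do rewrite row_mxEr; exact: measurable_entry.
Qed.

Let rho (x : 'rV[R]_#|S0|) : R :=
  \1_good (emb x) * (\prod_b pr (enum_val b) (x 0 b)) * expR (n%:R * lg (emb x)).

Let measurable_rho : measurable_fun setT rho.
Proof.
apply: measurable_funM; first apply: measurable_funM.
- by apply: (measurableT_comp (measurable_indic mgood) measurable_emb).
- apply: measurable_prod => b _; apply: measurableT_comp => //; exact: measurable_entry.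
- apply: measurableT_comp => //; apply: measurable_funM => //.
  exact: (measurableT_comp measurable_lg measurable_emb).
Qed.

Let rho_ge0 x : 0 <= rho x.
Proof. by rewrite mulr_ge0 ?expR_ge0// mulr_ge0// prodr_ge0. Qed.

Let rho_good x : rho x != 0 -> good (emb x).
Proof.
move=> rx; apply: contrapT => ng; move: rx.
by rewrite /rho indicE memNset// !mul0r eqxx.
Qed.

Let rhoE x : good (emb x) ->
  rho x = (\prod_b pr (enum_val b) (x 0 b)) * expR (n%:R * ell (emb x)).
Proof. by move=> gx; rewrite /rho indicE mem_set// mul1r lgE. Qed.

Let rho_box x : rho x != 0 -> in_box K x.
Proof.
move=> /rho_good gx b; have [_ ball _] := (good_setP _ n_gt0 delta0_gt0 delta1_gt0 _).1 gx.
set j : 'I_d := enum_val b.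
have h : `|x 0 b - theta_hat 0 j| <= r0.
  rewrite -(@ler_pXn2r _ 2)// ?nnegrE ?r0_ge0// real_normK ?num_real//.
  apply: le_trans ball; rewrite (bigD1 j)/=; last exact: enum_valP.
  by rewrite emb_S0 lerDl sumr_ge0// => i _; exact: sqr_ge0.
have h2 : `|theta_hat 0 j| <= \sum_i `|theta_hat 0 i|.
  by rewrite (bigD1 j)//= lerDl sumr_ge0.
have h3 : `|x 0 b| <= `|x 0 b - theta_hat 0 j| + `|theta_hat 0 j|.
  by rewrite -[in leLHS](subrK (theta_hat 0 j) (x 0 b)) ler_normD.
by have := L_gt0; rewrite /K; lra.
Qed.

Let emb_mid x y : emb (2^-1 *: (x + y)) = 2^-1 *: (emb x + emb y).
Proof.
apply/rowP => j; rewrite [RHS]mxE [X in _ = _ * X]mxE.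
have [jS1|] := boolP (j \in S1); first by rewrite !emb_S1// addr0 mulr0.
rewrite S1E negbK => jS0; rewrite -(enum_rankK_in jS0 jS0) !emb_S0.
by rewrite !mxE.
Qed.

Let good_emb_mid x y : good (emb x) -> good (emb y) -> good (2^-1 *: (emb x + emb y)).
Proof.
move=> gx gy.
have [_ bx _] := (good_setP _ n_gt0 delta0_gt0 delta1_gt0 _).1 gx.
have [_ hy _] := (good_setP _ n_gt0 delta0_gt0 delta1_gt0 _).1 gy.
apply: (good_set_of_coords n_gt0 delta0_gt0 delta1_gt0 theta_hat_ge0 delta0_small H1).
  rewrite -/r0 in bx hy *.
  apply: (@le_trans _ _ (\sum_(i in S0) (2^-1 * (emb x 0 i - theta_hat 0 i) ^+ 2 +
     2^-1 * (emb y 0 i - theta_hat 0 i) ^+ 2))); last first.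
    by rewrite big_split /= -!mulr_sumr; lra.
  apply: ler_sum => i _; rewrite mxE [X in _ * X - _]mxE -subr_ge0.
  rewrite (_ : _ - _ = (2^-1 * (emb x 0 i - emb y 0 i)) ^+ 2); last by field.
  exact: sqr_ge0.
move=> j jS1; rewrite mxE [X in _ * X]mxE !emb_S1// addr0 mulr0 lexx ltW//.
Qed.

Let norm2_emb x y : norm2 (emb x - emb y) ^+ 2 = norm2 (x - y) ^+ 2.
Proof.
have -> : emb x - emb y = reindex_rV sigma (row_mx 0 (x - y)).
  apply/rowP => j; rewrite [LHS]mxE [X in _ + X]mxE.
  have e (z : 'rV[R]_#|S0|) : reindex_rV sigma (row_mx 0 z) 0 j =
    (row_mx 0 z : 'rV[R]_(#|S1| + #|S0|)) 0 (sigma j) by rewrite mxE.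
  rewrite /emb !e.
  by case: (split_ordP (sigma j)) => k ->; rewrite ?row_mxEl ?row_mxEr !mxE ?subrr.
rewrite (norm2_sqr_reindex sigmaK tauK) !norm2_sqr big_split_ord /=.
rewrite big1 ?add0r => [|i _]; last by rewrite row_mxEl mxE expr0n.
by apply: eq_bigr => i _; rewrite row_mxEr.
Qed.

(** Multiplies the midpoint log-concavity of the priors by [exp] of [n] times the midpoint
    inequality for [ell]; embedding the slice by zeros preserves distances, hence
    [kappa = n CS0]. *)
Let rho_midpoint x y :
  rho x * rho y * expR (n%:R * CS0 / 4 * norm2 (x - y) ^+ 2) <= rho (2^-1 *: (x + y)) ^+ 2.
Proof.
have [->|rx] := eqVneq (rho x) 0; first by rewrite !mul0r sqr_ge0.
have [->|ry] := eqVneq (rho y) 0; first by rewrite mulr0 mul0r sqr_ge0.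
have gx := rho_good rx; have gy := rho_good ry.
have gm : good (emb (2^-1 *: (x + y))) by rewrite emb_mid; exact: good_emb_mid.
rewrite !rhoE// mulrACA -[leLHS]mulrA exprMn; apply: ler_pM.
- by rewrite mulr_ge0// prodr_ge0.
- by rewrite !mulr_ge0// expR_ge0.
- rewrite -big_split /= -prodrXl; apply: ler_prod => b _; rewrite mulr_ge0//=.
  have xb0 : 0 <= x 0 b.
    rewrite -emb_S0; exact: (good_orthant n_gt0 delta0_gt0 delta1_gt0 gx).
  have yb0 : 0 <= y 0 b.
    rewrite -emb_S0; exact: (good_orthant n_gt0 delta0_gt0 delta1_gt0 gy).
  rewrite !mxE !prE// ?mulr_ge0 ?addr_ge0 ?invr_ge0//.
  exact: (log_concave_midpoint (prior_log_concave (enum_val b))).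
rewrite -expRM_natl -!expRD ler_expR emb_mid.
have := ell_midpoint n_gt0 delta0_gt0 delta1_gt0 theta_hat_ge0 delta0_small H1 H2 H4_C2
  gx gy (@emb_S1 x) (@emb_S1 y).
rewrite norm2_emb => h.
have := ler_wpM2l (ltW n0) h; set N := norm2 _ ^+ 2; lra.
Qed.

Let W : 'rV[R]_(#|S1| + #|S0|) -> R := prod_weight v rho.

Let P := @reindex_rV R d _ sigma.

Let P_S1 z (a : 'I_#|S1|) : P z 0 (enum_val a) = z 0 (lshift _ a).
Proof. by rewrite mxE sigma_S1. Qed.

Let P_S0 z (b : 'I_#|S0|) : P z 0 (enum_val b) = z 0 (rshift _ b).
Proof. by rewrite mxE sigma_S0. Qed.

Let emb_rsubmx z : emb (rsubmx z) = zero_S1 theta_hat (P z).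
Proof.
apply/rowP => j; rewrite [RHS]mxE; case: ifPn => [jS0|]; last first.
  by rewrite -S1E => /emb_S1.
by rewrite -(enum_rankK_in jS0 jS0) emb_S0 P_S0 mxE.
Qed.

Let sum_S0_emb z : \sum_(i in S0) (emb (rsubmx z) 0 i - theta_hat 0 i) ^+ 2 =
  \sum_(i in S0) (P z 0 i - theta_hat 0 i) ^+ 2.
Proof. by apply: eq_bigr => i iS0; rewrite emb_rsubmx mxE iS0. Qed.

(** In the reordered coordinates the good set is a ball times a cube. This lets the product weight
    vanish wherever [good_weight] does by leaving the good set, as a multiplicative comparison
    demands. *)
Let good_P z : good (P z) <->
  good (emb (rsubmx z)) /\ forall a : 'I_#|S1|, 0 <= z 0 (lshift _ a) <= L.
Proof.
have gP t := good_setP theta_hat n_gt0 delta0_gt0 delta1_gt0 t.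
have gC := good_set_of_coords n_gt0 delta0_gt0 delta1_gt0 theta_hat_ge0 delta0_small H1.
split=> [/gP[h1 h2 h3]|[/gP[_ h2 _] h3]].
  split; last by move=> a; rewrite -P_S1 h1 h3// enum_valP.
  apply: gC; first by rewrite sum_S0_emb.
  by move=> j jS1; rewrite emb_S1// lexx ltW.
apply: gC; first by rewrite -sum_S0_emb.
by move=> j jS1; rewrite -(enum_rankK_in jS1 jS1) P_S1 h3.
Qed.

Let weight_ratio z : expR (- D) * W z <= good_weight (P z) <= expR D * W z.
Proof.
have [gz|ngz] := pselect (good (P z)); last first.
  rewrite /good_weight indicE memNset// !mul0r.
  suff -> : W z = 0 by rewrite !mulr0 lexx.
  rewrite /W /prod_weight; have [gr|ngr] := pselect (good (emb (rsubmx z))); last first.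
    by rewrite /rho indicE memNset// !mul0r mulr0.
  have [a za] : exists a : 'I_#|S1|, ~~ (0 <= z 0 (lshift _ a) <= L).
    apply: contrapT => H; apply: ngz; apply/good_P; split => // a.
    by apply: contrapT => /negP h; apply: H; exists a.
  by rewrite (bigD1 a)//= v_out// !mul0r.
have [gr za] := (good_P z).1 gz.
(* All priors are gathered into the factor that [good_weight] also has; the ratio of the two weights
   is then [exp] of [n] times the linearization error. *)
have -> : W z = (\prod_j pr j (P z 0 j)) * expR (n%:R * ell (emb (rsubmx z)) +
    n%:R * \sum_(j in S1) P z 0 j * slope j).
  rewrite /W /prod_weight rhoE// prod_split -!mulrA.
  rewrite (eq_bigr (fun a => pr (enum_val a) (P z 0 (enum_val a)) *
     expR (n%:R * (P z 0 (enum_val a) * slope (enum_val a))))); last first.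
    by move=> a _; rewrite vE// P_S1 prE ?(andP (za a)).1//; congr (_ * expR _); ring.
  rewrite big_split /= -mulrA; congr (_ * _).
  have -> : \prod_b pr (enum_val b) (rsubmx z 0 b) =
      \prod_(b < #|S0|) pr (enum_val b) (P z 0 (enum_val b)).
    by apply: eq_bigr => b _; rewrite P_S0 mxE.
  rewrite mulrCA; congr (_ * _); rewrite expRD mulrC; congr (_ * _).
  by rewrite -expR_sum -mulr_sumr [X in _ = expR (_ * X)]big_enum_val.
have -> : good_weight (P z) = (\prod_j pr j (P z 0 j)) * expR (n%:R * ell (P z)).
  by rewrite /good_weight indicE mem_set// mul1r lgE.
have lin := ell_linearization n_gt0 delta0_gt0 delta1_gt0 theta_hat_ge0 delta0_small H1
  H4_C2 H4_bound gz.
rewrite emb_rsubmx !(mulrCA (expR _) (\prod_j _)) -!expRD.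
have p0 : 0 <= \prod_j pr j (P z 0 j) by exact: prodr_ge0.
move: lin; rewrite -/r0 -/L -/slope ler_norml => /andP[l1 l2].
have := ler_wpM2l (ltW n0) l1; have := ler_wpM2l (ltW n0) l2; rewrite -/D => {}l2 {}l1.
rewrite mulrN -/D in l1.
by rewrite !ler_wpM2l//= ler_expR; [lra|lra].
Qed.

Lemma weighted_poincare_good_slice : 0 <= beta ->
  (\int[lebesgue_rV d]_t (good_weight t)%:E < +oo)%E ->
  weighted_poincare K good_weight
    (Num.max (n%:R * CS0)^-1 (4 / (n%:R ^+ 2 * CS1 ^+ 2) * beta) * expR (2 * D)).
Proof.
move=> beta0 fin.
set C := Num.max _ _.
have nC0 : 0 < n%:R * CS0 by rewrite mulr_gt0.
have C0' : 0 <= C by rewrite le_max invr_ge0 (ltW nC0).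
have sbij : bijective sigma by exists tauI.
have mW : measurable_fun setT W.
  apply: measurable_funM.
    apply: measurable_prod => a _; apply: measurableT_comp => //; exact: measurable_entry.
  apply: (measurableT_comp measurable_rho); apply: measurable_fun_entryP => i j.
  by under eq_fun do rewrite mxE; exact: measurable_entry.
have W0 z : 0 <= W z by rewrite mulr_ge0// prodr_ge0.
apply: (weighted_poincare_perturb sigmaK tauK C0' measurable_good_weight good_weight_ge0
  mW W0 weight_ratio).
apply: weighted_poincare_prod => //.
- move=> a; apply: weighted_poincare1_le (v_poincare a) => //.
  by rewrite le_max lexx orbT.
- move=> rfin; apply: (@weighted_poincare_le R K (n%:R * CS0)^-1) => //.
    by rewrite le_max lexx.
  exact: weighted_poincare_midpoint.
(* The same two-sided comparison transfers finite mass from [good_weight] to the product weight. *)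
move: fin; rewrite (integral_reindex_rV sbij); last 2 first.
- by apply/measurable_EFinP; exact: measurable_good_weight.
- by move=> t; rewrite lee_fin good_weight_ge0.
move=> fin; apply: (@le_lt_trans _ _ ((expR D)%:E *
    \int[lebesgue_rV (#|S1| + #|S0|)]_z (good_weight (P z))%:E)%E); last first.
  by apply: lte_mul_pinfty => //.
have mgP : measurable_fun setT (fun z => (good_weight (P z))%:E).
  apply/measurable_EFinP.
  exact: (measurableT_comp measurable_good_weight (measurable_reindex_rV sigma)).
rewrite -ge0_integralZl_EFin ?expR_ge0//; last by move=> z _; rewrite lee_fin good_weight_ge0.
apply: ge0_le_integral => //.
- by move=> z _; rewrite lee_fin.
- exact/measurable_EFinP.
- exact: emeasurable_funM.
move=> z _; rewrite -EFinM lee_fin; have /andP[h _] := weight_ratio z.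
by rewrite -ler_pdivrMl ?expR_gt0// -expRN.
Qed.

End slice.

Lemma weighted_poincare_good : 0 <= beta ->
  (\int[lebesgue_rV d]_t (good_weight t)%:E < +oo)%E ->
  weighted_poincare K good_weight
    (Num.max (n%:R * CS0)^-1 (4 / (n%:R ^+ 2 * CS1 ^+ 2) * beta) * expR (2 * D)).
Proof.
by have [sigma tauK sigmaK] := tauI_bij; exact: (weighted_poincare_good_slice tauK sigmaK).
Qed.

End good_weight.

(** The normalising constant [k] multiplies both sides of the weighted inequality, and the mean is
    at least as good a centre as [c]. *)
Lemma poincare_const_le {R : realType} n (nu : probability 'rV[R]_n R)
    (w : 'rV[R]_n -> R) (K C k : R) :
  0 <= C -> 0 <= k -> measurable_fun setT w -> (forall x, 0 <= w x) ->
  (forall A, measurable A -> nu A = \int[lebesgue_rV n]_(x in A) (k * w x)%:E)%E ->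
  weighted_poincare K w C -> (poincare_const nu <= C%:E)%E.
Proof.
move=> C0 k0 mw w0 nuE Pw; apply: ereal_inf_lbound; exists C => //; split => // f sf cf.
have cont : continuous f by have [] := sf [::].
have [M fM] := compactly_supported_bounded cont cf.
have [mf mG _] := smooth_tame K sf.
have [c Hc] := Pw _ _ (smooth_tame K sf).
have intE (h : 'rV[R]_n -> R) : measurable_fun setT h -> (forall x, 0 <= h x) ->
    (\int[nu]_x (h x)%:E = k%:E * \int[lebesgue_rV n]_x (h x * w x)%:E)%E.
  move=> mh h0; rewrite (@ge0_integral_density _ _ _ (lebesgue_rV n) nu
    (fun x => (k * w x)%:E) _ _ nuE); last 4 first.
  - by apply/measurable_EFinP; exact: measurable_funM.
  - by move=> x; rewrite lee_fin mulr_ge0.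
  - exact/measurable_EFinP.
  - by move=> x; rewrite lee_fin.
  rewrite -ge0_integralZl_EFin//; last 2 first.
  - by move=> x _; rewrite lee_fin mulr_ge0.
  - by apply/measurable_EFinP; exact: measurable_funM.
  by apply: eq_integral => x _; rewrite -!EFinM mulrCA.
apply: (le_trans (variance_le_second_moment nu c mf fM)).
rewrite !intE; last 4 first.
- exact: measurable_norm2_sqr.
- by move=> x; exact: sqr_ge0.
- by apply: measurable_funX; exact: measurable_funB.
- by move=> x; exact: sqr_ge0.
by rewrite muleCA; apply: lee_wpmul2l => //; rewrite lee_fin.
Qed.

Lemma poincare_const_dirac {R : realType} n (nu : probability 'rV[R]_n R) (a : 'rV[R]_n) :
  (forall A, measurable A -> nu A = \d_a A) -> (poincare_const nu <= 0)%E.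
Proof.
move=> nuE; apply: ereal_inf_lbound; exists 0 => //; split => // f sf _.
have cont : continuous f by have [] := sf [::].
have mf := continuous_measurable_rV cont.
have intE (g : 'rV[R]_n -> R) : measurable_fun setT g -> (\int[nu]_x (g x)%:E = (g a)%:E)%E.
  move=> mg; transitivity (\int[\d_a]_x (g x)%:E)%E.
    by apply: eq_measure_integral => A mA _; exact: nuE.
  rewrite integral_dirac// ?diracT ?mul1e//; exact/measurable_EFinP.
rewrite mul0e !intE//; last exact: measurable_funX.
by rewrite -EFin_expe subee.
Qed.

Section good_posterior.
Context {R : realType} {d n : nat}.
Variables (ell : 'rV[R]_d -> R) (prior : 'I_d -> R -> R) (theta_hat : 'rV[R]_d).
Variables (mu : probability 'rV[R]_d R) (delta0 delta1 : R).
Hypotheses (n_gt0 : (0 < n)%N) (delta0_gt0 : 0 < delta0) (delta1_gt0 : 0 < delta1).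
Hypothesis mu_posterior : is_posterior n ell prior mu.
Hypothesis prior_log_concave : forall j, log_concave_on [set x | 0 <= x] (prior j).
Hypothesis H4_C2 : C2_on orthant (good_set n delta0 delta1 theta_hat) ell.

Local Notation good := (good_set n delta0 delta1 theta_hat).
Local Notation w := (@good_weight R d n ell prior theta_hat delta0 delta1).

Let Z : R := (\int[lebesgue_rV d]_(u in orthant) posterior_weight n ell prior u)%R.

Let mw : measurable_fun setT w := measurable_good_weight prior_log_concave H4_C2.
Let w0 t : 0 <= w t := good_weight_ge0 ell theta_hat delta0 delta1 prior_log_concave t.
Let mgood : measurable good := measurable_good_set n delta0 delta1 theta_hat.

Let posterior_weight_ge0 (t : 'rV[R]_d) : orthant t -> 0 <= posterior_weight n ell prior t.
Proof.
move=> t0; rewrite mulr_ge0 ?expR_ge0// prodr_ge0// => j _.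
by have [+ _] := prior_log_concave j; apply; exact: t0.
Qed.

Let Z_ge0 : 0 <= Z.
Proof.
by apply: fine_ge0; apply: integral_ge0 => t t0; rewrite lee_fin posterior_weight_ge0.
Qed.

Let muE A : measurable A -> (mu (A `&` good) =
  \int[lebesgue_rV d]_(t in A) (Z^-1 * w t)%:E)%E.
Proof.
move=> mA; rewrite mu_posterior; last exact: measurableI.
rewrite [LHS]integral_mkcond [RHS]integral_mkcond; apply: eq_integral => t _.
rewrite !patchE !in_setI; case: (t \in A) => //=.
rewrite good_weightE// indicE; have [gt|_] := boolP (t \in good).
  rewrite mem_set /=; last exact: (good_orthant n_gt0 delta0_gt0 delta1_gt0 (set_mem gt)).
  by rewrite mul1r mulrC.
by rewrite mul0r mulr0.
Qed.

(** [Z] is a real integral, equal to 0 when the true one is infinite; its inverse would then be 0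
    and the good set would have no mass. So [Z] is positive, and [mu good <= 1] bounds the integral
    of the weight. *)
Lemma good_weight_integrable : mu good != 0%E ->
  (0 < \int[lebesgue_rV d]_t (w t)%:E < +oo)%E.
Proof.
move=> mu0.
have : (mu good = Z^-1%:E * \int[lebesgue_rV d]_t (w t)%:E)%E.
  rewrite -[good in LHS]setTI muE// -ge0_integralZl_EFin ?invr_ge0//.
  - by move=> t _; rewrite lee_fin.
  - exact/measurable_EFinP.
set I := (\int[_]_t _)%E => muI.
have I0 : (0 <= I)%E by apply: integral_ge0 => t _; rewrite lee_fin.
have Z0 : Z != 0 by apply: contraNN mu0 => /eqP Z0; rewrite muI Z0 invr0 mul0e.
have Zi : 0 < Z^-1 by rewrite invr_gt0 lt_neqAle eq_sym Z0.
apply/andP; split.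
  by rewrite lt_neqAle I0 andbT eq_sym; apply: contraNN mu0 => /eqP E; rewrite muI E mule0.
rewrite ltey; apply/eqP => E; have := probability_le1 mu mgood.
by rewrite muI E gt0_muley ?lte_fin.
Qed.

Let good_posterior_if A : good_posterior n delta0 delta1 theta_hat mu A =
  if (mu good == 0%E) || (mu good == +oo%E) then \d_theta_hat A
  else (mu (A `&` good) * (fine (mu good))^-1%:E)%E.
Proof.
rewrite -[mu good](congr1 mu (setTI good)) /good_posterior /= /mnormalize.
by rewrite /mrestr; case: ifP.
Qed.

Lemma good_posteriorE : mu good != 0%E -> exists2 k : R, 0 <= k &
  forall A, measurable A -> good_posterior n delta0 delta1 theta_hat mu A =
    (\int[lebesgue_rV d]_(t in A) (k * w t)%:E)%E.
Proof.
move=> mu0; exists ((fine (mu good))^-1 * Z^-1).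
  by apply: mulr_ge0; rewrite invr_ge0 ?Z_ge0 ?fine_ge0.
move=> A mA; rewrite good_posterior_if.
have muoo : (mu good == +oo)%E = false.
  by apply/negbTE; rewrite -ltey (le_lt_trans (probability_le1 mu mgood)) ?ltry.
rewrite (negbTE mu0) muoo /= muE// muleC -ge0_integralZl_EFin//.
- by apply: eq_integral => t _; rewrite -EFinM mulrA.
- by move=> t _; rewrite lee_fin mulr_ge0 ?invr_ge0.
- by apply/measurable_EFinP; apply: measurable_funTS; exact: measurable_funM.
- by rewrite invr_ge0 fine_ge0.
Qed.

Lemma good_posterior_dirac : mu good = 0%E -> forall A, measurable A ->
  good_posterior n delta0 delta1 theta_hat mu A = \d_theta_hat A.
Proof.
by move=> mu0 A _; rewrite good_posterior_if mu0 eqxx.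
Qed.

(** A prior vanishing on the whole interval would make the weight vanish on the good set. This
    supplies the point of positivity that the oscillation bounds need. *)
Lemma prior_pos_near0 j : j \in S1 theta_hat -> mu good != 0%E ->
  exists2 x, 0 <= x <= delta1 / n%:R & 0 < prior j x.
Proof.
move=> jS1 mu0; apply: contrapT => H.
have [] := andP (good_weight_integrable mu0).
rewrite integral0_eq ?ltxx// => t _; congr EFin; rewrite good_weightE//.
have [gt|ngt] := pselect (good t); last by rewrite indicE memNset// mul0r.
have t0 := good_orthant n_gt0 delta0_gt0 delta1_gt0 gt.
have [_ _ tS1] := (good_setP theta_hat n_gt0 delta0_gt0 delta1_gt0 t).1 gt.
rewrite /posterior_weight (bigD1 j)//=.
suff -> : prior j (t 0 j) = 0 by rewrite !mul0r mulr0.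
apply: le_anti; apply/andP; split; last by have [+ _] := prior_log_concave j; apply; exact: t0.
by rewrite leNgt; apply/negP => p; apply: H; exists (t 0 j) => //; rewrite t0 tS1.
Qed.

End good_posterior.

Theorem theorem3p4 (R : realType) (d n : nat)
  (ell : 'rV[R]_d -> R) (prior : 'I_d -> R -> R) (theta_hat : 'rV[R]_d)
  (mu : probability 'rV[R]_d R)
  (delta0 delta1 C0 CS0 CS1 s2 : R)
  (n_gt0 : (0 < n)%N)
  (mu_posterior : is_posterior n ell prior mu)
  (theta_hat_max : unique_maximizer orthant ell theta_hat)
  (prior_log_concave : forall j, log_concave_on [set x | 0 <= x] (prior j))
  (ell_C2_interior : C2_on orthant (interior orthant) ell)
  (d1_ge1 : (1 <= #|S1 theta_hat|)%N)
  (delta0_gt0 : 0 < delta0) (delta1_gt0 : 0 < delta1)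
  (delta0_small : delta0 * Num.sqrt (#|S0 theta_hat|%:R / n%:R) < C0)
  (C0_gt0 : 0 < C0)
  (H1 : (C0%:E <= ereal_inf [set `|theta_hat 0 i|%:E | i in [set i | i \in S0 theta_hat]])%E)
  (CS0_gt0 : 0 < CS0)
  (H2 : forall t, good_set n delta0 delta1 theta_hat t ->
     loewner_ge (- submx_block (S0 theta_hat) (rel_hessian orthant ell t)) CS0%:M)
  (CS1_gt0 : 0 < CS1)
  (H3 : forall j, j \in S1 theta_hat -> rel_partial orthant j ell theta_hat <= - CS1)
  (H4_C2 : C2_on orthant (good_set n delta0 delta1 theta_hat) ell)
  (H4_bound : (ereal_sup [set (opnorm (rel_hessian orthant ell t))%:E |
                 t in good_set n delta0 delta1 theta_hat] <= s2%:E)%E)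
  (H5 : delta0 ^+ 2 * #|S0 theta_hat|%:R / C0 ^+ 2 <= n%:R) :
  (poincare_const (good_posterior n delta0 delta1 theta_hat mu) <=
   maxe (n%:R * CS0)^-1%:E
     ((4%:R / (n%:R ^+ 2 * CS1 ^+ 2))%:E *
      \big[maxe/-oo]_(j in S1 theta_hat)
         expeR (osc [set x | 0 <= x <= delta1 / n%:R]%R
                    (fun x => lne (prior j x)%:E))) *
   (expR (2%:R * s2 *
      (delta0 * delta1 * Num.sqrt (#|S0 theta_hat|%:R * #|S1 theta_hat|%:R) / Num.sqrt n%:R
       + delta1 ^+ 2 * #|S1 theta_hat|%:R / n%:R)))%:E)%E.
Proof.
have theta_hat_ge0 := theta_hat_max.1.
have n0 : 0 < n%:R :> R by rewrite ltr0n.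
have L_ge0 : 0 <= delta1 / n%:R by rewrite divr_ge0// ltW.
have a_gt0 : 0 < (n%:R * CS0)^-1 by rewrite invr_gt0 mulr_gt0.
have c_gt0 : 0 < 4 / (n%:R ^+ 2 * CS1 ^+ 2) by rewrite divr_gt0// mulr_gt0// exprn_gt0.
pose osc_j j := expeR (osc [set x | 0 <= x <= delta1 / n%:R]%R (fun x => lne (prior j x)%:E)).
set M := \big[maxe/-oo%E]_(j in _) _; set e := expR _.
have e_gt0 : 0 < e by exact: expR_gt0.
(* With no mass on the good set, [good_posterior] is its default Dirac mass, whose Poincare constant
   is 0. *)
have [mu0|mu0] := eqVneq (mu (good_set n delta0 delta1 theta_hat)) 0%E.
  apply: (le_trans (poincare_const_dirac (good_posterior_dirac mu0))).
  by rewrite mule_ge0// ?lee_fin ?(ltW e_gt0)// le_max lee_fin (ltW a_gt0).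
have M_ge j : j \in S1 theta_hat -> (osc_j j <= M)%E.
  by move=> jS1; exact: (le_bigmax_cond _ osc_j).
(* An infinite oscillation makes the right side infinite; otherwise every prior factor has finite
   two-sided bounds. *)
have [Moo|Moo] := eqVneq M +oo%E.
  by rewrite Moo gt0_muley ?lte_fin// maxey gt0_mulye ?lte_fin// leey.
have bounds j : exists mB : R * R, j \in S1 theta_hat -> [/\ 0 < mB.1,
    forall x, 0 <= x <= delta1 / n%:R -> mB.1 <= prior j x <= mB.2 &
    osc_j j = (mB.2 / mB.1)%:E].
  have [jS1|_] := boolP (j \in S1 theta_hat); last by exists (0, 0).
  have pos := prior_pos_near0 n_gt0 delta0_gt0 delta1_gt0 mu_posterior
    prior_log_concave H4_C2 jS1 mu0.
  have [||m [B [m0 mB oscE]]] := osc_lne_bounds L_ge0 pos; last by exists (m, B).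
  - by move=> x /andP[x0 _]; have [+ _] := prior_log_concave j; exact.
  - apply: contraNN Moo => /eqP oscoo.
    by rewrite -leye_eq; have := M_ge j jS1; rewrite /osc_j oscoo.
have [mB mBP] := choice bounds.
(* Since [S1] is nonempty, the maximum [M] is not the default [-oo] of an empty one. *)
have [j0 j0S1] : exists j, j \in S1 theta_hat.
  by apply/set0Pn; rewrite -card_gt0.
have M_fin : M \is a fin_num.
  rewrite fin_numE Moo andbT; apply: contraTN (M_ge _ j0S1) => /eqP ->.
  by have [_ _ ->] := mBP _ j0S1.
have beta_ge j : j \in S1 theta_hat -> (mB j).2 / (mB j).1 <= fine M.
  by move=> jS1; have [_ _ E] := mBP _ jS1; rewrite -lee_fin -E fineK// M_ge.
have beta_ge0 : 0 <= fine M.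
  have [m0 mBx _] := mBP _ j0S1; apply: le_trans (beta_ge _ j0S1).
  have /andP[h1 h2] := mBx 0 (introT andP (conj (lexx _) L_ge0)).
  by rewrite divr_ge0// ltW// (lt_le_trans m0)// (le_trans h1).
have /andP[_ int_fin] := good_weight_integrable n_gt0 delta0_gt0 delta1_gt0 mu_posterior
  prior_log_concave H4_C2 mu0.
have PW := weighted_poincare_good n_gt0 delta0_gt0 delta1_gt0 prior_log_concave
  theta_hat_ge0 delta0_small H1 CS0_gt0 H2 CS1_gt0 H3 H4_C2 H4_bound
  (fun j jS1 => let: And3 h _ _ := mBP j jS1 in h)
  (fun j jS1 => let: And3 _ h _ := mBP j jS1 in h) beta_ge beta_ge0 int_fin.
have [k k0 nuE] := good_posteriorE n_gt0 delta0_gt0 delta1_gt0 mu_posterior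
  prior_log_concave H4_C2 mu0.
have := poincare_const_le _ k0 (measurable_good_weight prior_log_concave H4_C2)
  (good_weight_ge0 ell theta_hat delta0 delta1 prior_log_concave) nuE PW.
rewrite -(fineK M_fin) -EFinM -EFin_max -EFinM.
rewrite (_ : expR (2 * _) = e).
  by apply; rewrite mulr_ge0 ?expR_ge0// le_max (ltW a_gt0).
(* Expressed through [q = sqrt n], the exponent [2 D], with its radius [delta0 sqrt (d0 / n)] and
   width [delta1 / n], becomes the stated one by field arithmetic. *)
rewrite /e; congr expR; rewrite !sqrtrM// sqrtrV ?(ltW n0)//.
set q := Num.sqrt n%:R; have nE : n%:R = q ^+ 2 by rewrite sqr_sqrtr// ltW.
have q0 : q != 0 by rewrite gt_eqF// sqrtr_gt0.
by rewrite !nE; field.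
Qed.
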